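(* Let $(q_n),(r_n)$ be complex sequences vanishing faster than any negative power of $|n|$ as $n\to\pm\infty$ with $1-q_nr_n\neq0$ and $1+q_nr_{n+1}\ne0$ for all $n$, and let $u_n,v_n,p_n,s_n,D_\infty,E_\infty$ be as in the context. With the notation of the context, for $1\le j\le N$ and $1\le j'\le\bar N$, $$C_j^{(u,v)}=C_j^{(p,s)}(I-A_j^{-2}),\qquad \bar C_{j'}^{(p,s)}=\bar C_{j'}^{(u,v)}\big[I-(\bar A_{j'})^{-2}\big],$$ hence $C^{(u,v)}=C^{(p,s)}(I-A^{-2})$ and $\bar C^{(p,s)}=\bar C^{(u,v)}[I-(\bar A)^{-2}]$; moreover $$C_j^{(q,r)}=\frac{E_\infty}{D_\infty}C_j^{(p,s)},\qquad \bar C_{j'}^{(q,r)}=\frac{D_\infty}{E_\infty}\bar C_{j'}^{(p,s)},$$ hence $C^{(p,s)}=\frac{D_\infty}{E_\infty}C^{(q,r)}$, $\bar C^{(p,s)}=\frac{E_\infty}{D_\infty}\bar C^{(q,r)}$, and consequently $$C^{(u,v)}=\frac{D_\infty}{E_\infty}C^{(q,r)}(I-A^{-2}),\qquad \bar C^{(u,v)}=\frac{E_\infty}{D_\infty}\bar C^{(q,r)}\big[I-(\bar A)^{-2}\big]^{-1}.$$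
   Context: System (Q): $\begin{bmatrix}\alpha_n\\ \beta_n\end{bmatrix}=\begin{bmatrix} z & (z-z^{-1})q_n\\ z r_n & z^{-1}+(z-z^{-1})q_nr_n\end{bmatrix}\begin{bmatrix}\alpha_{n+1}\\ \beta_{n+1}\end{bmatrix}$; system (U) with potentials $(a,b)$: $\begin{bmatrix}\xi_n\\ \eta_n\end{bmatrix}=\begin{bmatrix} z & z a_n\\ z^{-1}b_n & z^{-1}\end{bmatrix}\begin{bmatrix}\xi_{n+1}\\ \eta_{n+1}\end{bmatrix}$. $D_n=\prod_{j\le n}(1-q_jr_j)$, $E_n=\prod_{j\le n}(1+q_jr_{j+1})$, $D_\infty,E_\infty$ the full products; $u_n=q_nE_{n-1}/D_n$, $v_n=(-r_n+r_{n+1}-q_nr_nr_{n+1})D_{n-1}/E_n$, $p_n=(q_n-q_{n+1}-q_nq_{n+1}r_{n+1})E_{n-1}/D_{n+1}$, $s_n=r_{n+1}D_n/E_n$. Superscripts $(q,r),(u,v),(p,s)$ refer to (Q) and to (U) with potentials $(u,v)$, $(p,s)$. For $|z|=1$ the Jost solutions (overbars not complex conjugation) are $\psi_n=\begin{bmatrix}o(1)\\ z^n[1+o(1)]\end{bmatrix}$, $\bar\psi_n=\begin{bmatrix}z^{-n}[1+o(1)]\\ o(1)\end{bmatrix}$ ($n\to+\infty$), $\phi_n=\begin{bmatrix}z^{-n}[1+o(1)]\\ o(1)\end{bmatrix}$, $\bar\phi_n=\begin{bmatrix}o(1)\\ z^{n}[1+o(1)]\end{bmatrix}$ ($n\to-\infty$),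 extended analytically in $z$ ($\psi_n,\phi_n$ to $0<|z|<1$; $\bar\psi_n,\bar\phi_n$ to $|z|>1$). Right transmission coefficients: first component of $\phi_n$ $=(1/T_{\rm r})z^{-n}[1+o(1)]$, second component of $\bar\phi_n$ $=(1/\bar T_{\rm r})z^n[1+o(1)]$ as $n\to+\infty$ (for (Q) these are $T^{(q,r)},\bar T^{(q,r)}$), meromorphic in $|z|<1$, resp. $|z|>1$. The three systems have common poles: the poles in $0<|z|<1$ are $\pm z_j$, $1\le j\le N$, with multiplicity $m_j$, and the poles in $|z|>1$ are $\pm\bar z_j$, $1\le j\le\bar N$, with multiplicity $\bar m_j$. Residues: $T_{\rm r}=\sum_{k=1}^{m_j}t_{jk}(z-z_j)^{-k}+O(1)$ as $z\to z_j$, and $\bar T_{\rm r}=\sum_{k=1}^{\bar m_j}\bar t_{jk}(z-\bar z_j)^{-k}+O(1)$ as $z\to\bar z_j$. Dependency constants $\gamma_{jk}$ ($0\le k\le m_j-1$): $\frac{d^k\phi_n(z_j)}{dz^k}=\sum_{l=0}^k\binom kl\gamma_{j(k-l)}\frac{d^l\psi_n(z_j)}{dz^l}$ for all $n$; $\bar\gamma_{jk}$ analogously with $\bar\phi_n,\bar\psi_n,\bar z_j,\bar m_j$. Norming constants (for each system): $c_{jk}=-2\sum_{l=0}^{m_j-1-k}t_{j(k+1+l)}\gamma_{jl}/l!$ ($0\le k\le m_j-1$), $\bar c_{jk}=2\sum_{l=0}^{\bar m_j-1-k}\bar t_{j(k+1+l)}\bar\gamma_{jl}/l!$ ($0\le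 k\le\bar m_j-1$). Matrices: $A_j$ is the $m_j\times m_j$ Jordan block with $z_j$ on the diagonal and $1$ on the superdiagonal; $C_j=\begin{bmatrix}c_{j(m_j-1)}&c_{j(m_j-2)}&\cdots&c_{j0}\end{bmatrix}$; $\bar A_j$, $\bar C_j=\begin{bmatrix}\bar c_{j(\bar m_j-1)}&\cdots&\bar c_{j0}\end{bmatrix}$ analogously with $\bar z_j,\bar m_j$; $A=\mathrm{diag}(A_1,\dots,A_N)$, $C=\begin{bmatrix}C_1&\cdots&C_N\end{bmatrix}$, $\bar A=\mathrm{diag}(\bar A_1,\dots,\bar A_{\bar N})$, $\bar C=\begin{bmatrix}\bar C_1&\cdots&\bar C_{\bar N}\end{bmatrix}$; superscripts on $C,C_j,\bar C,\bar C_j$ indicate the system. *)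

(* Defs.v *)
From HB Require Import structures.
From mathcomp Require Import all_boot all_order all_algebra.
From mathcomp Require Import all_classical all_reals all_analysis.
From mathcomp Require Import complex.
Set Implicit Arguments.
Unset Strict Implicit.
Unset Printing Implicit Defensive.
Import Order.TTheory GRing.Theory Num.Theory.
Import numFieldNormedType.Exports.
Local Open Scope ring_scope.
Local Open Scope complex_scope.
Local Open Scope classical_set_scope.

Section Defs.
Variable R : realType.
Local Notation C := (R[i]).

Definition seq_lim (u : nat -> C) (l : C) : Prop :=
  (u : nat -> (R[i])^o) @ \oo --> (l : (R[i])^o).

Definition lim_pinf (f : int -> C) (l : C) : Prop := seq_lim (fun k => f k%:Z) l.
Definition lim_minf (f : int -> C) (l : C) : Prop := seq_lim (fun k => f (- k%:Z)) l.

Definition rapid_decay (f : int -> C) : Prop :=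
  forall k : nat, lim_pinf (fun n => n%:~R ^+ k * f n) 0 /\
                  lim_minf (fun n => n%:~R ^+ k * f n) 0.

Definition cont_on (D : set (R[i])^o) (f : (R[i])^o -> (R[i])^o) : Prop :=
  {within D, continuous f}.

(* complex differentiability at every point of a set (holomorphy on an open set) *)
Definition holo (D : set C) (f : C -> C) : Prop :=
  forall z, D z -> derivable (f : (R[i])^o -> (R[i])^o) z 1.

Definition cderivn (k : nat) (f : C -> C) (z : C) : C :=
  @derive1n (R[i]) (R[i])^o k (f : (R[i])^o -> (R[i])^o) z.

Definition disk_in : set C := [set z | 0 < `|z| < 1].
Definition cldisk_in : set C := [set z | 0 < `|z| <= 1].
Definition disk_out : set C := [set z | 1 < `|z|].
Definition cldisk_out : set C := [set z | 1 <= `|z|].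

Definition ext_in (f : C -> C) : Prop := holo disk_in f /\ @cont_on cldisk_in f.
Definition ext_out (f : C -> C) : Prop := holo disk_out f /\ @cont_on cldisk_out f.

Definition mat2 := ((C * C) * (C * C))%type.

Definition mulv (M : mat2) (X : C * C) : C * C :=
  (M.1.1 * X.1 + M.1.2 * X.2, M.2.1 * X.1 + M.2.2 * X.2).

Definition transferQ (q r : int -> C) (n : int) (z : C) : mat2 :=
  ((z, (z - z^-1) * q n), (z * r n, z^-1 + (z - z^-1) * q n * r n)).

Definition transferU (a b : int -> C) (n : int) (z : C) : mat2 :=
  ((z, z * a n), (z^-1 * b n, z^-1)).

Definition is_sol (M : int -> C -> mat2) (z : C) (X : int -> C * C) : Prop :=
  forall n, X n = mulv (M n z) (X (n + 1)).

Definition jost_psi (M : int -> C -> mat2) (psi : int -> C -> C * C) : Prop :=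
  (forall z, `|z| = 1 ->
     [/\ is_sol M z (fun n => psi n z),
         lim_pinf (fun n => (psi n z).1) 0 &
         lim_pinf (fun n => (psi n z).2 * z ^ (- n)) 1]) /\
  (forall n, ext_in (fun z => (psi n z).1) /\ ext_in (fun z => (psi n z).2)).

Definition jost_psib (M : int -> C -> mat2) (psib : int -> C -> C * C) : Prop :=
  (forall z, `|z| = 1 ->
     [/\ is_sol M z (fun n => psib n z),
         lim_pinf (fun n => (psib n z).1 * z ^ n) 1 &
         lim_pinf (fun n => (psib n z).2) 0]) /\
  (forall n, ext_out (fun z => (psib n z).1) /\ ext_out (fun z => (psib n z).2)).

Definition jost_phi (M : int -> C -> mat2) (phi : int -> C -> C * C) : Prop :=
  (forall z, `|z| = 1 ->
     [/\ is_sol M z (fun n => phi n z),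
         lim_minf (fun n => (phi n z).1 * z ^ n) 1 &
         lim_minf (fun n => (phi n z).2) 0]) /\
  (forall n, ext_in (fun z => (phi n z).1) /\ ext_in (fun z => (phi n z).2)).

Definition jost_phib (M : int -> C -> mat2) (phib : int -> C -> C * C) : Prop :=
  (forall z, `|z| = 1 ->
     [/\ is_sol M z (fun n => phib n z),
         lim_minf (fun n => (phib n z).1) 0 &
         lim_minf (fun n => (phib n z).2 * z ^ (- n)) 1]) /\
  (forall n, ext_out (fun z => (phib n z).1) /\ ext_out (fun z => (phib n z).2)).

(* a = 1/T_r : first component of phi_n = (1/T_r) z^{-n} [1+o(1)], n -> +oo,
   on |z| = 1, extended analytically to 0<|z|<1 *)
Definition trans_in (phi : int -> C -> C * C) (a : C -> C) : Prop :=
  ext_in a /\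
  forall z, `|z| = 1 -> lim_pinf (fun n => (phi n z).1 * z ^ n) (a z).

(* ab = 1/Tbar_r : second component of phib_n = (1/Tbar_r) z^n [1+o(1)] *)
Definition trans_out (phib : int -> C -> C * C) (ab : C -> C) : Prop :=
  ext_out ab /\
  forall z, `|z| = 1 -> lim_pinf (fun n => (phib n z).2 * z ^ (- n)) (ab z).

(* T = 1/a has at w a pole of order m with principal part
   sum_{k=1}^m t_k (z-w)^{-k}:  T(z) - sum_k t_k (z-w)^{-k} = O(1), z -> w *)
Definition pole_order (a : C -> C) (w : C) (m : nat) (t : nat -> C) : Prop :=
  [/\ (0 < m)%N, t m != 0 &
      exists delta K : C, 0 < delta /\
        forall z, 0 < `|z - w| < delta ->
          a z != 0 /\
          `|(a z)^-1 - \sum_(1 <= k < m.+1) t k / (z - w) ^+ k| <= K].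

Definition poles_in (a : C -> C) (N : nat) (zs : 'I_N -> C) (ms : 'I_N -> nat)
    (t : 'I_N -> nat -> C) : Prop :=
  [/\ forall z, 0 < `|z| < 1 -> (a z = 0 <-> exists j, z = zs j \/ z = - zs j),
      forall j, pole_order a (zs j) (ms j) (t j) &
      forall j, exists t', pole_order a (- zs j) (ms j) t'].

Definition poles_out (ab : C -> C) (N : nat) (zbs : 'I_N -> C) (mbs : 'I_N -> nat)
    (tb : 'I_N -> nat -> C) : Prop :=
  [/\ forall z, 1 < `|z| -> (ab z = 0 <-> exists j, z = zbs j \/ z = - zbs j),
      forall j, pole_order ab (zbs j) (mbs j) (tb j) &
      forall j, exists t', pole_order ab (- zbs j) (mbs j) t'].

Definition depend (phi psi : int -> C -> C * C) (w : C) (m : nat) (g : nat -> C) : Prop :=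
  forall k, (k < m)%N -> forall n,
    cderivn k (fun z => (phi n z).1) w =
      \sum_(l < k.+1) 'C(k, l)%:R * g (k - l)%N * cderivn l (fun z => (psi n z).1) w /\
    cderivn k (fun z => (phi n z).2) w =
      \sum_(l < k.+1) 'C(k, l)%:R * g (k - l)%N * cderivn l (fun z => (psi n z).2) w.

Definition norming_in (M : int -> C -> mat2) (N : nat) (zs : 'I_N -> C)
    (ms : 'I_N -> nat) (c : 'I_N -> nat -> C) : Prop :=
  exists (psi phi : int -> C -> C * C) (a : C -> C) (t g : 'I_N -> nat -> C),
    [/\ jost_psi M psi /\ jost_phi M phi, trans_in phi a, poles_in a zs ms t,
        forall j, depend phi psi (zs j) (ms j) (g j) &
        forall j k, (k < ms j)%N ->
          c j k = - 2 * \sum_(l < ms j - k) t j (k + 1 + l)%N * g j l / (l`!)%:R].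

Definition norming_out (M : int -> C -> mat2) (N : nat) (zbs : 'I_N -> C)
    (mbs : 'I_N -> nat) (cb : 'I_N -> nat -> C) : Prop :=
  exists (psib phib : int -> C -> C * C) (ab : C -> C) (tb gb : 'I_N -> nat -> C),
    [/\ jost_psib M psib /\ jost_phib M phib, trans_out phib ab, poles_out ab zbs mbs tb,
        forall j, depend phib psib (zbs j) (mbs j) (gb j) &
        forall j k, (k < mbs j)%N ->
          cb j k = 2 * \sum_(l < mbs j - k) tb j (k + 1 + l)%N * gb j l / (l`!)%:R].

Definition is_Dseq (q r : int -> C) (D : int -> C) : Prop :=
  forall n, seq_lim (fun m => \prod_(i < m) (1 - q (n - i%:Z) * r (n - i%:Z))) (D n).

Definition is_Eseq (q r : int -> C) (E : int -> C) : Prop :=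
  forall n, seq_lim (fun m => \prod_(i < m) (1 + q (n - i%:Z) * r (n - i%:Z + 1))) (E n).

Definition useq (q r D E : int -> C) (n : int) : C := q n * E (n - 1) / D n.
Definition vseq (q r D E : int -> C) (n : int) : C :=
  (- r n + r (n + 1) - q n * r n * r (n + 1)) * D (n - 1) / E n.
Definition pseq (q r D E : int -> C) (n : int) : C :=
  (q n - q (n + 1) - q n * q (n + 1) * r (n + 1)) * E (n - 1) / D (n + 1).
Definition sseq (q r D E : int -> C) (n : int) : C := r (n + 1) * D n / E n.

Definition jordan (w : C) (m : nat) : 'M[C]_m :=
  \matrix_(i < m, k < m)
    (if (i : nat) == k then w else if (k : nat) == (i : nat).+1 then 1 else 0).

Definition Crow (N : nat) (ms : 'I_N -> nat) (c : 'I_N -> nat -> C) (j : 'I_N) :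
    'rV[C]_(ms j) :=
  \row_(i < ms j) c j (ms j - 1 - i)%N.

Definition Cfull (N : nat) (ms : 'I_N -> nat) (c : 'I_N -> nat -> C) :
    'rV[C]_(\sum_j ms j) :=
  \mxrow_(j < N) Crow ms c j.

Definition Afull (N : nat) (zs : 'I_N -> C) (ms : 'I_N -> nat) : 'M[C]_(\sum_j ms j) :=
  \mxdiag_(j < N) jordan (zs j) (ms j).

Definition IminusAinv2 (m : nat) (A : 'M[C]_m) : 'M[C]_m := 1%:M - invmx (A *m A).

End Defs.

(* Main.v *)
(* For both pairs of potentials there is a gauge matrix, polynomial in z^2,
   which maps solutions of the system (U) to solutions of (Q) and whose
   off-diagonal entries vanish as n -> +-oo.  On |z| = 1 the system (Q) is a
   summable perturbation of diag(z, 1/z), so that a solution tending to 0 at one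
   end is 0 and the gauge images of the Jost solutions of (U) are multiples of
   those of (Q): the factors are the diagonal limits of the gauge matrix, that is
   1 or z^2 or z^2 - 1 up to D_oo and E_oo.  A function holomorphic inside and
   continuous up to |z| = 1 is determined by its values there, so these relations
   extend to the domains of analyticity and give 1/T^(U) = const 1/T^(Q).

   The jets at z_j of the Jost solutions, written as upper triangular Toeplitz
   matrices, satisfy phi = Gamma psi with Gamma the Toeplitz matrix of the
   dependency constants, and multiplication by z becomes multiplication by the
   Jordan block A_j.  Since psi(z_j) <> 0 its jet can be cancelled, and the
   polynomial factors in z turn into the factors in A_j relating the rows C_j.

   The complex analysis rests on Goursat's lemma for rectangles: it yields local
   primitives F, hence difference quotients of F approximating f with a
   second-order Taylor expansion, for which the maximum principle is elementary;
   Cauchy's estimates follow from the maximum principle. *)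
Require Import Defs.
From HB Require Import structures.
From mathcomp Require Import all_boot all_order all_algebra.
From mathcomp Require Import all_classical all_reals all_analysis.
From mathcomp Require Import complex.
From mathcomp Require Import ring lra zify.
Import Order.TTheory GRing.Theory Num.Theory.
Import numFieldNormedType.Exports.
Local Open Scope ring_scope.
Local Open Scope complex_scope.
Local Open Scope classical_set_scope.

Set Implicit Arguments.
Unset Strict Implicit.
Unset Printing Implicit Defensive.

(** A Jost solution is assumed to satisfy its difference equation on |z| = 1 only, and nothing is
    assumed about its behaviour as z -> 0. Every relation is therefore proved on the circle in a
    form free of division, because z^2 - 1 vanishes at z = 1 and z = -1, then carried into the
    domain, and only there are the polynomial factors cancelled. For the same reason psi(z_j) <> 0
    cannot be read off from the recursion: a second solution is constructed on the whole closed
    disc, where it visibly does not vanish for large n, and identified with psi through its values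
    on the circle. All estimates concern (Q), whose coefficients decay by hypothesis; none is made
    for (U). What is not known about a (U) solution at +oo, the growth of its other component, is
    eliminated by Cramer's rule when the transmission coefficients are compared. The transfer matrix
    of (Q) has determinant 1 and that of (U) has determinant 1 - a_n b_n; the products D_n and E_n
    in the gauge matrices compensate this difference. *)

Section ComplexNorm.
Variable R : realType.
Local Notation C := R[i].
Local Notation nm := (@Normc.normc R).
Local Notation Re := (@complex.Re R).
Local Notation Im := (@complex.Im R).
Implicit Types (z w : C) (x y : R).

(** The order of [R[i]] is partial, so estimates use the real-valued modulus [nm], for which linear
    arithmetic is available; this identity converts from the norm of the statement. *)
Lemma normE z : `|z| = (nm z)%:C. Proof. by []. Qed.

Lemma nm_ge0 z : 0 <= nm z.
Proof. by case: z => a b /=; rewrite sqrtr_ge0. Qed.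

Lemma nm0 : nm 0 = 0. Proof. exact: Normc.normc0. Qed.
Lemma nm1 : nm 1 = 1. Proof. exact: Normc.normc1. Qed.
Lemma nmN z : nm (- z) = nm z. Proof. exact: normcN. Qed.
Lemma nmM z w : nm (z * w) = nm z * nm w. Proof. exact: Normc.normcM. Qed.
Lemma nmV z : nm z^-1 = (nm z)^-1. Proof. exact: Normc.normcV. Qed.
Lemma nmD z w : nm (z + w) <= nm z + nm w. Proof. exact: le_normcD. Qed.
Lemma nmB z w : nm (z - w) <= nm z + nm w.
Proof. by rewrite -(nmN w); exact: nmD. Qed.
Lemma nmBC z w : nm (z - w) = nm (w - z).
Proof. by rewrite -nmN opprB. Qed.
Lemma nm_triB z w : nm z - nm w <= nm (z - w).
Proof. by rewrite lerBlDr; have := nmD (z - w) w; rewrite subrK. Qed.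
Lemma nm_triD z w : nm z - nm w <= nm (z + w).
Proof. by have := nm_triB z (- w); rewrite nmN opprK. Qed.

Lemma nmX z n : nm (z ^+ n) = nm z ^+ n.
Proof. by elim: n => [|n IH]; rewrite ?expr0 ?nm1 // !exprS nmM IH. Qed.

Lemma nmXz z (n : int) : nm (z ^ n) = nm z ^ n.
Proof. by case: n => n; rewrite ?NegzE -?exprnN ?nmV /= nmX. Qed.

Lemma nm_eq0 z : (nm z == 0) = (z == 0).
Proof.
by apply/eqP/eqP => [/Normc.eq0_normc|->] //; rewrite nm0.
Qed.

Lemma nm_gt0 z : (0 < nm z) = (z != 0).
Proof. by rewrite lt_def nm_ge0 andbT nm_eq0. Qed.

Lemma nm_real x : nm x%:C = `|x|.
Proof. by rewrite /= expr0n addr0 sqrtr_sqr. Qed.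

Lemma nm_i : nm 'i%C = 1.
Proof. by rewrite /= expr0n expr1n add0r sqrtr1. Qed.

Lemma nm_Re z : `|Re z| <= nm z.
Proof. by have := normc_ge_Re z; rewrite normE lecR. Qed.

Lemma nm_Im z : `|Im z| <= nm z.
Proof.
by have := nm_Re (z * 'i%C); rewrite ReiNIm normrN nmM nm_i mulr1.
Qed.

Lemma nm_ReIm z : nm z <= `|Re z| + `|Im z|.
Proof.
rewrite {1}[z]complexE; apply: le_trans (nmD _ _) _.
by rewrite nmM nm_i mul1r !nm_real.
Qed.

Lemma nm_sqr z : nm z ^+ 2 = Re z ^+ 2 + Im z ^+ 2.
Proof. by case: z => a b /=; rewrite sqr_sqrtr // addr_ge0 ?sqr_ge0. Qed.

Lemma complex_gt0P (e : C) : 0 < e -> exists2 x, 0 < x & e = x%:C.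
Proof.
case: e => a b; rewrite ltcE /= => /andP[/eqP -> a0]; by exists a.
Qed.

Lemma ReB z w : Re (z - w) = Re z - Re w. Proof. by case: z; case: w. Qed.
Lemma ImB z w : Im (z - w) = Im z - Im w. Proof. by case: z; case: w. Qed.

Lemma complex_eta z : z = Re z +i* Im z. Proof. by case: z. Qed.

End ComplexNorm.

(** * Complex differentiability with real radii *)

Section ComplexDerivative.

Lemma derive_limP (K : numFieldType) (f : K^o -> K^o) (x l : K) :
  ((fun h : K => h^-1 *: (f (h + x) - f x) : K^o) @ 0^' --> (l : K^o)) <->
  (forall e : K, 0 < e -> exists2 d : K, 0 < d &
     forall h, `|h| < d -> `|f (x + h) - f x - l * h| <= e * `|h|).
Proof.
have E h : h != 0 -> `|l - h^-1 * (f (h + x) - f x)| * `|h| = `|f (x + h) - f x - l * h|.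
  move=> h0; rewrite -normrM -normrN; congr (`| _ |).
  by rewrite (addrC h x); field.
split.
  move=> /cvgrPdist_le H e e0; have /= := H e e0.
  rewrite /dnbhs /within /= => /nbhs_ballP[d /= d0 dP].
  exists d => // h hd; have [->|h0] := eqVneq h 0.
    by rewrite addr0 subrr mulr0 subr0 normr0 mulr0.
  rewrite -(E h h0) ler_wpM2r //; apply: dP => //.
  by rewrite /ball /= sub0r normrN.
move=> H; apply/cvgrPdist_le => e e0; have [d d0 dP] := H e e0.
rewrite /dnbhs /within /=; apply/nbhs_ballP; exists d => //= h.
rewrite /ball /= sub0r normrN => /dP hd h0.
by rewrite -(ler_pM2r (_ : 0 < `|h|)) ?normr_gt0 // E.
Qed.

Lemma derivable_limP (K : numFieldType) (f : K^o -> K^o) (x : K) :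
  derivable f x 1 <->
  exists l : K, (fun h : K => h^-1 *: (f (h + x) - f x) : K^o) @ 0^' --> (l : K^o).
Proof.
have E : (fun h : K => h^-1 *: ((f \o shift x) (h *: (1 : K^o)) - f x) : K^o) =
         (fun h : K => h^-1 *: (f (h + x) - f x) : K^o).
  by apply/funext => h; rewrite /= /GRing.scale /= mulr1.
rewrite /derivable E; split; first by move=> /cvg_ex[l dl]; exists l.
by case=> l dl; apply/cvg_ex; exists l.
Qed.

Lemma derivable_epsP (K : numFieldType) (f : K^o -> K^o) (x : K) :
  derivable f x 1 <-> exists l : K, forall e : K, 0 < e -> exists2 d : K, 0 < d &
     forall h, `|h| < d -> `|f (x + h) - f x - l * h| <= e * `|h|.
Proof.
by split=> [/derivable_limP[l /derive_limP]|[l /derive_limP H]];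
  [exists l|apply/derivable_limP; exists l].
Qed.

Lemma derive1_eps (K : numFieldType) (f : K^o -> K^o) (x l : K) :
  (forall e : K, 0 < e -> exists2 d : K, 0 < d &
     forall h, `|h| < d -> `|f (x + h) - f x - l * h| <= e * `|h|) ->
  derive1 f x = l.
Proof. by move=> /derive_limP; exact: cvg_lim. Qed.

Variable R : realType.
Local Notation C := R[i].
Local Notation nm := (@Normc.normc R).
Implicit Types (f g : C -> C) (z w l : C).

(** The inequality is multiplied out by h, so that h = 0 needs no exclusion. *)
Definition cdiff f z l := forall e : R, 0 < e -> exists2 d : R, 0 < d &
  forall h, nm h < d -> nm (f (z + h) - f z - l * h) <= e * nm h.

Definition ccont (f : C -> C) z := forall e : R, 0 < e -> exists2 d : R, 0 < d &
  forall h, nm h < d -> nm (f (z + h) - f z) <= e.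

Lemma cdiff_cont f z l : cdiff f z l -> ccont f z.
Proof.
move=> df e e0; have [d d0 dP] := df 1 ltr01.
have K0 : 0 < 1 + nm l by rewrite ltr_wpDr ?nm_ge0.
exists (Num.min d (e / (1 + nm l))); first by rewrite lt_min d0 divr_gt0.
move=> h; rewrite lt_min => /andP[/dP]; rewrite mul1r => hd he.
have -> : f (z + h) - f z = (f (z + h) - f z - l * h) + l * h by ring.
apply: le_trans (nmD _ _) _; rewrite nmM.
have : nm h * (1 + nm l) <= e by rewrite -ler_pdivlMr // ltW.
by lra.
Qed.

Lemma cdiff_ext f g z l r : 0 < r -> (forall w, nm (w - z) < r -> f w = g w) ->
  cdiff f z l -> cdiff g z l.
Proof.
move=> r0 fg df e e0; have [d d0 dP] := df e e0.
exists (Num.min d r); first by rewrite lt_min d0.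
move=> h; rewrite lt_min => /andP[hd hr].
rewrite -!fg ?dP // ?subrr ?nm0 //.
by have -> : z + h - z = h by ring.
Qed.

Lemma cdiff_epsP (f : C -> C) z l : cdiff f z l <->
  (forall e : C, 0 < e -> exists2 d : C, 0 < d &
     forall h, `|h| < d -> `|f (z + h) - f z - l * h| <= e * `|h|).
Proof.
split.
  move=> df e /complex_gt0P[e' e'0 ->]; have [d d0 dP] := df e' e'0.
  exists d%:C; first by rewrite ltcR.
  by move=> h; rewrite !normE ltcR -rmorphM lecR; exact: dP.
move=> df e e0; have [|d' d'0 dP] := df e%:C; first by rewrite ltcR.
have [d d0 dE] := complex_gt0P d'0; exists d => // h hd.
by have := dP h; rewrite dE !normE ltcR -rmorphM lecR; exact.
Qed.

Lemma derivable_cdiffP (f : C -> C) z :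
  derivable (f : C^o -> C^o) z 1 <-> exists l, cdiff f z l.
Proof.
by split=> [/derivable_epsP[l /cdiff_epsP]|[l /cdiff_epsP H]];
  [exists l|apply/derivable_epsP; exists l].
Qed.

Lemma cdiff_derive1 (f : C -> C) z l : cdiff f z l ->
  derive1 (f : C^o -> C^o) z = l.
Proof. by move=> /cdiff_epsP; exact: derive1_eps. Qed.

Lemma cdiff_is_derive f z l : cdiff f z l <-> is_derive (z : C^o) (1 : C^o) (f : C^o -> C^o) l.
Proof.
split=> [df|[/derivable_cdiffP[m dm] fl]].
  apply: DeriveDef; first by apply/derivable_cdiffP; exists l.
  by rewrite -derive1E (cdiff_derive1 df).
by rewrite -fl -derive1E (cdiff_derive1 dm).
Qed.

Lemma cdiff_cst (c z : C) : cdiff (fun=> c) z 0.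
Proof.
move=> e e0; exists 1 => // h _; rewrite subrr mul0r subr0 nm0.
by rewrite mulr_ge0 ?nm_ge0 ?ltW.
Qed.

Lemma cdiff_id z : cdiff id z 1.
Proof.
move=> e e0; exists 1 => // h _.
have -> : z + h - z - 1 * h = 0 by ring.
by rewrite nm0 mulr_ge0 ?nm_ge0 ?ltW.
Qed.

Lemma cdiffD f g z l m : cdiff f z l -> cdiff g z m ->
  cdiff (fun w => f w + g w) z (l + m).
Proof.
by move=> /cdiff_is_derive df /cdiff_is_derive dg; apply/cdiff_is_derive.
Qed.

Lemma cdiffM f g z l m : cdiff f z l -> cdiff g z m ->
  cdiff (fun w => f w * g w) z (l * g z + f z * m).
Proof.
move=> /cdiff_is_derive df /cdiff_is_derive dg.
apply/cdiff_is_derive; rewrite addrC [l * _]mulrC.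
exact: (@is_deriveM _ _ _ _ _ _ _ _ df dg).
Qed.

Lemma cdiffZ (c : C) f z l : cdiff f z l -> cdiff (fun w => c * f w) z (c * l).
Proof.
by move=> df; have := cdiffM (cdiff_cst c z) df; rewrite mul0r add0r.
Qed.

Lemma cdiffN f z l : cdiff f z l -> cdiff (fun w => - f w) z (- l).
Proof.
move=> /(cdiffZ (-1)); rewrite mulN1r; apply: (cdiff_ext ltr01) => w _.
by rewrite mulN1r.
Qed.

Lemma cdiffB f g z l m : cdiff f z l -> cdiff g z m ->
  cdiff (fun w => f w - g w) z (l - m).
Proof. by move=> df dg; exact: cdiffD df (cdiffN dg). Qed.

Lemma cdiffX f z l n : cdiff f z l ->
  exists m, cdiff (fun w => f w ^+ n) z m.
Proof.
move=> df; elim: n => [|n [m IH]].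
  by exists 0; apply: (cdiff_ext ltr01 _ (cdiff_cst 1 z)) => w _; rewrite expr0.
exists (l * f z ^+ n + f z * m).
by apply: (cdiff_ext ltr01 _ (cdiffM df IH)) => w _; rewrite exprS.
Qed.

Lemma cdiff_inv z : z != 0 -> cdiff (fun w => w^-1) z (- (z ^- 2)).
Proof.
move=> z0 e e0; have nz : 0 < nm z by rewrite nm_gt0.
have q0 : 0 < e * nm z ^+ 3 / 2 by rewrite !divr_gt0 ?mulr_gt0 ?exprn_gt0.
exists (Num.min (nm z / 2) (e * nm z ^+ 3 / 2)); first by rewrite lt_min divr_gt0.
move=> h; rewrite lt_min => /andP[h1 h2].
have zh : nm z / 2 < nm (z + h) by have := nm_triD z h; lra.
have zh0 : z + h != 0 by rewrite -nm_gt0; apply: lt_trans zh; rewrite divr_gt0.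
have -> : (z + h)^-1 - z^-1 - (- z ^- 2) * h = h * h / (z ^+ 2 * (z + h)).
  by field; rewrite z0 zh0.
rewrite nmM nmV (nmM h h) (nmM (z ^+ 2)) nmX mulrAC ler_wpM2r ?nm_ge0 //.
rewrite ler_pdivrMr ?mulr_gt0 ?exprn_gt0 //; last by rewrite nm_gt0.
apply: (le_trans (ltW h2)).
have -> : e * nm z ^+ 3 / 2 = e * (nm z ^+ 2 * (nm z / 2)) by rewrite exprSr; ring.
by rewrite ler_wpM2l ?ler_wpM2l ?exprn_ge0 // ltW.
Qed.

Lemma cdiff_comp f g z l m : cdiff g z m -> cdiff f (g z) l ->
  exists k, cdiff (fun w => f (g w)) z k.
Proof.
have D (h : C -> C) w : (exists n, cdiff h w n) <-> differentiable (h : C^o -> C^o) (w : C^o).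
  exact: iff_trans (iff_sym (derivable_cdiffP h w)) (derivable1_diffP _ _).
move=> dg df; apply/D; apply: (@differentiable_comp _ C^o C^o C^o g f z).
  by apply/D; exists m.
by apply/D; exists l.
Qed.

Lemma cdiff_shift f k z l : cdiff f (z + k) l -> cdiff (fun w => f (w + k)) z l.
Proof. by move=> dg e /dg[d d0 dP]; exists d => // h /dP; rewrite (addrAC z k h). Qed.

Lemma ccontX f z n : ccont f z -> ccont (fun w => f w ^+ n) z.
Proof.
move=> cf e e0; have [m dm] := cdiffX n (cdiff_id (f z)).
have [d d0 dP] := cdiff_cont dm e0.
have [d' d'0 d'P] := cf _ (divr_gt0 d0 (ltr0Sn _ 1)); exists d' => // h /d'P fh.
by have := dP (f (z + h) - f z); rewrite subrKC; apply; lra.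
Qed.

End ComplexDerivative.

(** * Goursat's lemma for rectangles and local primitives *)

Section Subdivision.
Variable R : realType.

Lemma half_pow_lt (d : R) : 0 < d -> exists n, 2^-1 ^+ n < d.
Proof.
move=> d0; have [n nP] : exists n : nat, d^-1 < n%:R.
  by exists (Num.bound d^-1); have := archi_boundP (ltW (_ : 0 < d^-1)); apply; rewrite invr_gt0.
exists n; rewrite exprVn invf_plt ?posrE ?exprn_gt0 //.
by apply: lt_trans nP _; rewrite -natrX ltr_nat ltn_expl.
Qed.

Lemma nested_point (x t : nat -> R) :
  (forall n, x n <= x n.+1) -> (forall n, t n.+1 <= t n) ->
  (forall n, x n <= t n) -> exists X, forall n, x n <= X <= t n.
Proof.
move=> xi td xt.
have xm : forall m n, (m <= n)%N -> x m <= x n.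
  by move=> m n; apply: (homo_leq_in (fun _ => lexx _) (fun y x z => @le_trans _ _ y x z)) => //.
have tm : forall m n, (m <= n)%N -> t n <= t m.
  move=> m n; elim: n => [|n IH]; first by rewrite leqn0 => /eqP ->.
  rewrite leq_eqVlt => /orP[/eqP -> //|]; rewrite ltnS => /IH; exact: le_trans.
have xtmn m n : x m <= t n.
  apply: (le_trans (xm _ _ (leq_maxl m n))); apply: le_trans (xt _) _.
  exact: tm (leq_maxr _ _).
exists (sup (range x)) => n; apply/andP; split.
  apply: ub_le_sup; last by exists n.
  by exists (t 0%N) => _ [m _ <-].
by apply: ge_sup; [exists (x 0%N), 0%N|move=> _ [m _ <-]].
Qed.

(** Cousin's lemma by quadrisection: a failure of P would persist on nested quarters shrinking to a
    point (X, Y), against the local hypothesis there. Both sides carry the same scale s, so that P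
    may contain a bound in terms of s, such as the s^2 of Goursat's lemma. *)
Lemma subdivision_rect (w h : R) (P : R -> R -> R -> Prop) (x0 y0 : R) :
  0 <= w -> 0 <= h ->
  (forall x y s, 0 < s -> P x y (s / 2) -> P (x + s / 2 * w) y (s / 2) ->
     P x (y + s / 2 * h) (s / 2) -> P (x + s / 2 * w) (y + s / 2 * h) (s / 2) ->
     P x y s) ->
  (forall X Y, x0 <= X <= x0 + w -> y0 <= Y <= y0 + h ->
     exists2 d, 0 < d & forall x y s, 0 < s < d ->
       x0 <= x -> x + s * w <= x0 + w -> y0 <= y -> y + s * h <= y0 + h ->
       x <= X <= x + s * w -> y <= Y <= y + s * h -> P x y s) ->
  P x0 y0 1.
Proof.
move=> w0 h0 sub loc; apply: contrapT => nP0.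
pose s n : R := 2^-1 ^+ n.
have s0 n : 0 < s n by rewrite exprn_gt0 // invr_gt0.
have sS n : s n.+1 = s n / 2 by rewrite /s exprS mulrC.
(* The implication stands inside the existential, so that [choice] yields a total function and the
   failure of P is carried along afterwards. *)
have step (n : nat) (p : R * R) : exists p' : R * R,
  [/\ ~ P p.1 p.2 (s n) -> ~ P p'.1 p'.2 (s n.+1),
    p.1 <= p'.1 /\ p'.1 + s n.+1 * w <= p.1 + s n * w &
    p.2 <= p'.2 /\ p'.2 + s n.+1 * h <= p.2 + s n * h].
  have sn := s0 n; have sw : 0 <= s n * w by rewrite mulr_ge0 // ltW.
  have sh : 0 <= s n * h by rewrite mulr_ge0 // ltW.
  rewrite sS; case: p => x y /=.
  have [H|_] := pselect (P x y (s n)).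
    by exists (x, y); split => //=; split; lra.
  have [P1|P1] := pselect (P x y (s n / 2)); last first.
    by exists (x, y); split => //=; split; lra.
  have [P2|P2] := pselect (P (x + s n / 2 * w) y (s n / 2)); last first.
    by exists (x + s n / 2 * w, y); split => //=; split; lra.
  have [P3|P3] := pselect (P x (y + s n / 2 * h) (s n / 2)); last first.
    by exists (x, y + s n / 2 * h); split => //=; split; lra.
  exists (x + s n / 2 * w, y + s n / 2 * h); split => /=; [|split; lra|split; lra].
  by move=> nP P4; apply: nP; exact: sub.
have [F FP] := choice (fun np : nat * (R * R) => step np.1 np.2).
pose u := fix u n : R * R := if n is m.+1 then F (m, u m) else (x0, y0).
have uP n : ~ P (u n).1 (u n).2 (s n).
  by elim: n => [|n IH]; [rewrite /s expr0|have [+ _ _] := FP (n, u n); exact].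
have [X XP] := @nested_point (fun n => (u n).1) (fun n => (u n).1 + s n * w)
  (fun n => let: And3 _ (conj a _) _ := FP (n, u n) in a)
  (fun n => let: And3 _ (conj _ b) _ := FP (n, u n) in b)
  (fun n => ler_wpDr (mulr_ge0 (ltW (s0 n)) w0) (lexx _)).
have [Y YP] := @nested_point (fun n => (u n).2) (fun n => (u n).2 + s n * h)
  (fun n => let: And3 _ _ (conj a _) := FP (n, u n) in a)
  (fun n => let: And3 _ _ (conj _ b) := FP (n, u n) in b)
  (fun n => ler_wpDr (mulr_ge0 (ltW (s0 n)) h0) (lexx _)).
have inv n : [/\ x0 <= (u n).1, (u n).1 + s n * w <= x0 + w,
    y0 <= (u n).2 & (u n).2 + s n * h <= y0 + h].
  elim: n => [|n [i1 i2 i3 i4]]; first by rewrite /s expr0 !mul1r /=; split.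
  have [_ [a b] [c d]] := FP (n, u n); rewrite /= in a b c d *.
  by split; [exact: le_trans a|exact: le_trans i2|exact: le_trans c|exact: le_trans i4].
have X0 : x0 <= X <= x0 + w by have := XP 0%N; rewrite /s expr0 mul1r.
have Y0 : y0 <= Y <= y0 + h by have := YP 0%N; rewrite /s expr0 mul1r.
have [d d0 dP] := loc X Y X0 Y0; have [n nd] := half_pow_lt d0.
have [i1 i2 i3 i4] := inv n.
by apply: (uP n); apply: dP => //; rewrite s0.
Qed.

Lemma subdivision_itv (w : R) (P : R -> R -> Prop) (x0 : R) : 0 <= w ->
  (forall x s, 0 < s -> P x (s / 2) -> P (x + s / 2 * w) (s / 2) -> P x s) ->
  (forall X, x0 <= X <= x0 + w ->
     exists2 d, 0 < d & forall x s, 0 < s < d ->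
       x0 <= x -> x + s * w <= x0 + w -> x <= X <= x + s * w -> P x s) ->
  P x0 1.
Proof.
move=> w0 sub loc.
apply: (@subdivision_rect w 0 (fun x _ s => P x s) x0 0) => //.
  by move=> x y s s0 H1 H2 _ _; exact: sub.
by move=> X Y /loc[d d0 dP] _; exists d => // x y s sd a b _ _ c _; exact: dP.
Qed.

End Subdivision.

(** * Compactness by bisection and the mean value inequality *)

Section CompactAndMeanValue.
Variable R : realType.
Local Notation C := R[i].
Local Notation nm := (@Normc.normc R).
Local Notation Re := (@complex.Re R).
Local Notation Im := (@complex.Im R).
Implicit Types (K : C -> Prop) (z w : C).

(** Bisection of the square of half-side B about 0 replaces the extraction of finite subcovers; a
    point of the square outside K has a neighbourhood on which Q concerns an empty set. *)
Lemma compact_induction K (B : R) (Q : (C -> Prop) -> Prop) :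
  (forall z, K z -> nm z <= B) ->
  (forall z, ~ K z -> exists2 d : R, 0 < d & forall w, nm (w - z) < d -> ~ K w) ->
  (forall S, (forall z, ~ S z) -> Q S) ->
  (forall S S1 S2 : C -> Prop, (forall z, S z -> S1 z \/ S2 z) -> Q S1 -> Q S2 -> Q S) ->
  (forall z, K z -> exists2 d : R, 0 < d & Q (fun w => K w /\ nm (w - z) < d)) ->
  Q K.
Proof.
move=> bK cK Q0 QU Ql.
have [B0|B0] := ltP B 0.
  by apply: Q0 => z /bK; have := nm_ge0 z; lra.
pose rc x y s : C -> Prop := fun z => [/\ K z, x <= Re z <= x + s * (2 * B) &
  y <= Im z <= y + s * (2 * B)].
have sub (S S' : C -> Prop) : (forall z, S z -> S' z) -> Q S' -> Q S.
  by move=> SS' QS'; apply: (QU _ S' S') => // z /SS'; left.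
suff : Q (rc (- B) (- B) 1).
  apply: sub => z Kz; have zB := bK z Kz.
  have := le_trans (nm_Re z) zB; have := le_trans (nm_Im z) zB.
  by rewrite !ler_norml => /andP[? ?] /andP[? ?]; split => //; lra.
apply: (@subdivision_rect R (2 * B) (2 * B) (fun x y s => Q (rc x y s))); try lra.
- move=> x y s s0 H1 H2 H3 H4.
  pose lo : C -> Prop := fun z => rc x y (s / 2) z \/ rc (x + s / 2 * (2 * B)) y (s / 2) z.
  pose hi : C -> Prop := fun z => rc x (y + s / 2 * (2 * B)) (s / 2) z \/
    rc (x + s / 2 * (2 * B)) (y + s / 2 * (2 * B)) (s / 2) z.
  apply: (QU _ lo hi).
  + move=> z [Kz /andP[a b] /andP[c d]]; rewrite /lo /hi /rc.
    have [hx|hx] := leP (Re z) (x + s / 2 * (2 * B));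
    have [hy|hy] := leP (Im z) (y + s / 2 * (2 * B)).
    * by left; left; split => //; lra.
    * by right; left; split => //; lra.
    * by left; right; split => //; lra.
    * by right; right; split => //; lra.
  + exact: (QU _ _ _ (fun z => id) H1 H2).
  + exact: (QU _ _ _ (fun z => id) H3 H4).
- move=> X Y XB YB.
  (* A rectangle of scale s has sides s 2B, so its points lie within s 4B of (X, Y); the added 1
     avoids a zero denominator when B = 0. *)
  have near (x y s d : R) z : s < d / (4 * B + 1) -> 0 < d -> x <= X <= x + s * (2 * B) ->
      y <= Y <= y + s * (2 * B) -> rc x y s z -> nm (z - (X +i* Y)) < d.
    move=> sd d0 Xx Yy [_ zx zy].
    apply: le_lt_trans (nm_ReIm _) _.
    have : s * (4 * B + 1) < d by rewrite -ltr_pdivlMr //; lra.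
    case: z zx zy => a b /= zx zy sd'.
    have h1 : `|a - X| <= s * (2 * B) by rewrite ler_norml; lra.
    have h2 : `|b - Y| <= s * (2 * B) by rewrite ler_norml; lra.
    have s0 : 0 <= s * B by lra.
    have : 0 <= s \/ s < 0 by case: (leP 0 s); [left|right].
    by case=> ?; [|have : s * B <= 0 by rewrite nmulr_rle0]; lra.
  have [KXY|nK] := pselect (K (X +i* Y)).
    have [d d0 dQ] := Ql _ KXY; exists (d / (4 * B + 1)); first by rewrite divr_gt0 //; lra.
    move=> x y s /andP[s0 sd] _ _ _ _ Xx Yy; apply: sub dQ => z zr.
    by split; [case: zr|exact: near zr].
  have [d d0 dQ] := cK _ nK; exists (d / (4 * B + 1)); first by rewrite divr_gt0 //; lra.
  move=> x y s /andP[s0 sd] _ _ _ _ Xx Yy; apply: Q0 => z zr.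
  by apply: (dQ z) (near _ _ _ _ _ sd d0 Xx Yy zr) _; case: zr.
Qed.

Definition is_compact K := (exists B, forall z, K z -> nm z <= B) /\
  (forall z, ~ K z -> exists2 d : R, 0 < d & forall w, nm (w - z) < d -> ~ K w).

Lemma bounded_on_compact K (g : C -> R) : is_compact K ->
  (forall z, K z -> exists2 d : R, 0 < d & exists M, forall w, K w -> nm (w - z) < d -> g w <= M) ->
  exists M, forall z, K z -> g z <= M.
Proof.
move=> [[B bK] cK] loc.
apply: (@compact_induction K B (fun S => exists M, forall z, S z -> g z <= M)) => //.
- by move=> S S0; exists 0 => z /S0.
- move=> S S1 S2 SS [M1 H1] [M2 H2]; exists (Num.max M1 M2) => z /SS[/H1|/H2] h.
    by rewrite le_max h.
  by rewrite le_max h orbT.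
- by move=> z /loc[d d0 [M MP]]; exists d => //; exists M => w [? ?]; exact: MP.
Qed.

(** If the supremum S were not attained, upper semicontinuity would make 1/(S - g) locally bounded,
    hence bounded on K, and g would stay below S by a fixed amount. *)
Lemma max_on_compact K (g : C -> R) z0 : is_compact K -> K z0 ->
  (forall z, K z -> forall e, 0 < e -> exists2 d : R, 0 < d &
     forall w, K w -> nm (w - z) < d -> g w <= g z + e) ->
  exists2 z1, K z1 & forall z, K z -> g z <= g z1.
Proof.
move=> cK Kz0 uc.
have [M MP] : exists M, forall z, K z -> g z <= M.
  apply: bounded_on_compact => // z /uc/(_ 1 ltr01)[d d0 dP].
  by exists d => //; exists (g z + 1).
pose A := g @` K; have Anz : A !=set0 by exists (g z0), z0.
have Aub : has_ubound A by exists M => _ [z Kz <-]; exact: MP.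
pose S := sup A.
have leS z : K z -> g z <= S by move=> Kz; apply: ub_le_sup => //; exists z.
apply: contrapT => nex.
have ltS z : K z -> g z < S.
  move=> Kz; rewrite lt_neqAle leS // andbT; apply/eqP => gS.
  by apply: nex; exists z => // w Kw; rewrite gS; exact: leS.
have [L LP] : exists L, forall z, K z -> (S - g z)^-1 <= L.
  apply: bounded_on_compact => // z Kz.
  have e0 : 0 < (S - g z) / 2 by have := ltS z Kz; lra.
  have [d d0 dP] := uc z Kz _ e0; exists d => //; exists ((S - g z) / 2)^-1 => w Kw wz.
  rewrite lef_pV2 ?posrE ?e0 //; last by have := ltS w Kw; lra.
  by have := dP w Kw wz; lra.
have L0 : 0 < L by apply: lt_le_trans (LP z0 Kz0); rewrite invr_gt0 subr_gt0 ltS.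
have : S <= S - L^-1.
  apply: ge_sup => // _ [z Kz <-].
  have := LP z Kz; rewrite -[X in _ <= X]invrK lef_pV2 ?posrE ?invr_gt0 ?subr_gt0 ?ltS //.
  by lra.
by have : 0 < L^-1 by [rewrite invr_gt0]; lra.
Qed.

Lemma unif_cont_on_compact K (f : C -> C) : is_compact K ->
  (forall z, K z -> ccont f z) ->
  forall e : R, 0 < e -> exists2 d : R, 0 < d &
    forall z h, K z -> nm h < d -> nm (f (z + h) - f z) <= e.
Proof.
move=> [[B bK] cK] fc e e0.
apply: (@compact_induction K B (fun S => exists2 d : R, 0 < d &
    forall z h, S z -> nm h < d -> nm (f (z + h) - f z) <= e)) => //.
- by move=> S S0; exists 1 => // z h /S0.
- move=> S S1 S2 SS [d1 d10 H1] [d2 d20 H2]; exists (Num.min d1 d2); first by rewrite lt_min d10.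
  by move=> z h /SS[S1z|S2z]; rewrite lt_min => /andP[? ?]; [exact: H1|exact: H2].
- move=> z Kz; have [d d0 dP] := fc z Kz (e / 2) (divr_gt0 e0 (ltr0Sn _ 1)).
  exists (d / 2); first lra; exists (d / 2); first lra.
  move=> w h [Kw wz] hd.
  have H1 : nm (w - z + h) < d by apply: le_lt_trans (nmD _ _) _; lra.
  have H2 : nm (w - z) < d by lra.
  have -> : f (w + h) - f w = (f (z + (w - z + h)) - f z) - (f (z + (w - z)) - f z).
    have -> : z + (w - z + h) = w + h by ring.
    have -> : z + (w - z) = w by ring.
    by ring.
  by apply: le_trans (nmB _ _) _; have := dP _ H1; have := dP _ H2; lra.
Qed.

Lemma compact_annulus (a b : R) (c : C) : is_compact (fun z => a <= nm (z - c) <= b).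
Proof.
split.
  exists (nm c + b) => z /andP[_ zb]; have -> : z = c + (z - c) by ring.
  by apply: le_trans (nmD _ _) _; lra.
move=> z nz.
have Hd (w : C) : nm (w - c) <= nm (z - c) + nm (w - z) /\ nm (z - c) <= nm (w - c) + nm (w - z).
  split; first by have -> : w - c = (z - c) + (w - z) by [ring]; exact: nmD.
  by have -> : z - c = (w - c) - (w - z) by [ring]; exact: nmB.
have [za|za] := ltP (nm (z - c)) a.
  exists (a - nm (z - c)); first lra.
  by move=> w wz /andP[wa _]; have [? _] := Hd w; lra.
have [zb|zb] := ltP b (nm (z - c)).
  exists (nm (z - c) - b); first lra.
  by move=> w wz /andP[_ wb]; have [_ ?] := Hd w; lra.
by exfalso; apply: nz; rewrite za zb.
Qed.

Lemma compact_disc (b : R) (c : C) : is_compact (fun z => nm (z - c) <= b).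
Proof.
suff <- : (fun z : C => is_true (0 <= nm (z - c) <= b)) = (fun z => is_true (nm (z - c) <= b)).
  exact: compact_annulus.
by apply/funext => z; rewrite nm_ge0.
Qed.

Definition rdiff (p : R -> C) (t : R) (l : C) := forall e : R, 0 < e ->
  exists2 d : R, 0 < d & forall k : R, `|k| < d -> nm (p (t + k) - p t - l * k%:C) <= e * `|k|.

(** The bound with m + e' adds up under bisection and holds near each point by differentiability;
    the derivative need not be integrated. *)
Lemma mean_value_bound (p : R -> C) (a b m : R) : a <= b ->
  (forall t, a <= t <= b -> exists2 l, rdiff p t l & nm l <= m) ->
  nm (p b - p a) <= m * (b - a).
Proof.
move=> ab dp; apply/ler_addgt0Pr => e e0.
pose e' := e / (b - a + 1).
have e'0 : 0 < e' by rewrite divr_gt0 //; lra.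
suff H : nm (p (a + 1 * (b - a)) - p a) <= (m + e') * (1 * (b - a)).
  have eab : a + 1 * (b - a) = b by ring.
  rewrite eab in H; apply: le_trans H _; rewrite mul1r mulrDl lerD2l.
  have ba1 : 0 < b - a + 1 by lra.
  rewrite /e' mulrAC ler_pdivrMr // ler_wpM2l //; first exact: ltW.
  by lra.
apply: (@subdivision_itv R (b - a) (fun x s => nm (p (x + s * (b - a)) - p x) <= (m + e') * (s * (b - a)))).
- by rewrite subr_ge0.
- move=> x s s0 H1 H2.
  have -> : p (x + s * (b - a)) - p x = (p (x + s / 2 * (b - a) + s / 2 * (b - a)) - p (x + s / 2 * (b - a)))
     + (p (x + s / 2 * (b - a)) - p x).
    have -> : x + s / 2 * (b - a) + s / 2 * (b - a) = x + s * (b - a) by field.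
    by ring.
  by apply: le_trans (nmD _ _) _; lra.
- move=> X; have -> : a + (b - a) = b by ring.
  move=> Xab; have [l dl lm] := dp X Xab; have [d d0 dP] := dl e' e'0.
  exists (d / (b - a + 1)); first by rewrite divr_gt0 //; lra.
  move=> x s /andP[s0 sd] ax xb xX.
  have sd' : s * (b - a) + s < d by have : s * (b - a + 1) < d; [rewrite -ltr_pdivlMr //; lra|lra].
  set y := x + s * (b - a) in xb xX *.
  have yE : y = x + s * (b - a) by [].
  have h1 : `|y - X| < d by rewrite ltr_norml; lra.
  have h2 : `|x - X| < d by rewrite ltr_norml; lra.
  have := dP _ h1; have := dP _ h2.
  have -> : X + (x - X) = x by ring.
  have -> : X + (y - X) = y by ring.
  rewrite (ger0_norm (_ : 0 <= y - X)); last lra.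
  rewrite (ler0_norm (_ : x - X <= 0)); last lra.
  set u := p x - _ - _; set v := p y - _ - _ => Hu Hv.
  have -> : p y - p x = v - u + l * (y - x)%:C.
    by rewrite /u /v !rmorphB /=; ring.
  apply: le_trans (nmD _ _) _; apply: le_trans (lerD (nmB _ _) (lexx _)) _.
  rewrite nmM nm_real ger0_norm; last lra.
  have -> : s * (b - a) = y - x by rewrite /y; ring.
  have : nm l * (y - x) <= m * (y - x) by rewrite ler_wpM2r //; lra.
  by lra.
Qed.

Lemma mean_value_bound_abs (p : R -> C) (a b m : R) :
  (forall t, Num.min a b <= t <= Num.max a b -> exists2 l, rdiff p t l & nm l <= m) ->
  nm (p b - p a) <= m * `|b - a|.
Proof.
move=> dp; have [ab|ba] := leP a b.
  rewrite ger0_norm ?subr_ge0 //; apply: (mean_value_bound ab) => t tab.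
  by apply: dp; rewrite (min_idPl ab) (max_idPr ab).
have ba' := ltW ba.
rewrite nmBC distrC ger0_norm ?subr_ge0 //; apply: (mean_value_bound ba') => t tab.
by apply: dp; rewrite (min_idPr ba') (max_idPl ba').
Qed.

Lemma rdiff_line (f : C -> C) z h (t : R) l :
  cdiff f (z + t%:C * h) l -> rdiff (fun t : R => f (z + t%:C * h)) t (l * h).
Proof.
move=> dl e e0.
have H0 : 0 < nm h + 1 by have := nm_ge0 h; lra.
have [d d0 dP] := dl (e / (nm h + 1)) (divr_gt0 e0 H0).
exists (d / (nm h + 1)); first by rewrite divr_gt0.
move=> k; rewrite ltr_pdivlMr // => kd.
have kh : nm (k%:C * h) < d.
  by rewrite nmM nm_real; have := normr_ge0 k; lra.
have := dP _ kh; rewrite nmM nm_real.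
have -> : z + t%:C * h + k%:C * h = z + (t + k)%:C * h by rewrite rmorphD /=; ring.
have -> : l * h * k%:C = l * (k%:C * h) by ring.
move=> H; apply: le_trans H _.
have -> : e * `|k| = e / (nm h + 1) * (`|k| * (nm h + 1)) by field; rewrite lt0r_neq0.
apply: ler_wpM2l; first by rewrite divr_ge0 // ltW.
by apply: ler_wpM2l => //; lra.
Qed.

Lemma rdiffB (p q : R -> C) t l m : rdiff p t l -> rdiff q t m ->
  rdiff (fun t => p t - q t) t (l - m).
Proof.
move=> dp dq e e0.
have [d1 d10 H1] := dp _ (divr_gt0 e0 (ltr0Sn _ 1)).
have [d2 d20 H2] := dq _ (divr_gt0 e0 (ltr0Sn _ 1)).
exists (Num.min d1 d2); first by rewrite lt_min d10.
move=> k; rewrite lt_min => /andP[/H1 h1 /H2 h2].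
have -> : p (t + k) - q (t + k) - (p t - q t) - (l - m) * k%:C =
  (p (t + k) - p t - l * k%:C) - (q (t + k) - q t - m * k%:C) by ring.
by apply: le_trans (nmB _ _) _; lra.
Qed.

Lemma rdiffZ (c : C) (p : R -> C) t l : rdiff p t l -> rdiff (fun t => c * p t) t (c * l).
Proof.
move=> dp e e0; have c0 : 0 < nm c + 1 by have := nm_ge0 c; lra.
have [d d0 H] := dp _ (divr_gt0 e0 c0); exists d => // k /H h.
have -> : c * p (t + k) - c * p t - c * l * k%:C = c * (p (t + k) - p t - l * k%:C) by ring.
rewrite nmM; apply: (@le_trans _ _ ((nm c + 1) * (e / (nm c + 1) * `|k|))).
  by apply: ler_pM; rewrite ?nm_ge0 //; lra.
by rewrite mulrA [_ * (e / _)]mulrC divfK // lt0r_neq0.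
Qed.

Lemma mean_value_bound_seg (f : C -> C) z h (m : R) :
  (forall t : R, 0 <= t <= 1 -> exists2 l, cdiff f (z + t%:C * h) l & nm l <= m) ->
  nm (f (z + h) - f z) <= m * nm h.
Proof.
move=> df.
have := @mean_value_bound (fun t => f (z + t%:C * h)) 0 1 (m * nm h) ler01.
rewrite mul1r mul0r addr0 subr0 mulr1; apply => t /df[l dl lm].
by exists (l * h); [exact: rdiff_line|rewrite nmM ler_wpM2r ?nm_ge0].
Qed.

End CompactAndMeanValue.

Section RealPrimitive.
Variable R : realType.

(** The one place where Lebesgue integration enters: everything later uses the primitive only
    through its derivative. The bound u fixes the segment on which g is integrated. *)
Lemma real_primitive (g : R -> R) (a u : R) : continuous g ->
  exists G : R -> R, forall x, a < x < u -> forall e, 0 < e ->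
    exists2 d, 0 < d & forall k, `|k| < d -> `|G (x + k) - G x - g x * k| <= e * `|k|.
Proof.
move=> cg; exists (fun x => (\int[lebesgue_measure]_(t in `[a, x]) g t)%R) => x /andP[ax xu].
have gi : lebesgue_measure.-integrable `[a, u] (EFin \o g).
  apply: continuous_compact_integrable; first exact: segment_compact.
  exact: continuous_subspaceT.
have [/derivable_epsP[l lP] G'] := @continuous_FTC1_closed R g a x u xu gi ax (cg x).
by rewrite -G' (derive1_eps lP).
Qed.

End RealPrimitive.

Section Goursat.
Variable R : realType.
Local Notation C := R[i].
Local Notation nm := (@Normc.normc R).
Local Notation Re := (@complex.Re R).
Local Notation Im := (@complex.Im R).

Lemma rdiff_components (P Q p q : R -> R) t :
  (forall e : R, 0 < e -> exists2 d : R, 0 < d & forall k, `|k| < d -> `|P (t + k) - P t - p t * k| <= e * `|k|) ->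
  (forall e : R, 0 < e -> exists2 d : R, 0 < d & forall k, `|k| < d -> `|Q (t + k) - Q t - q t * k| <= e * `|k|) ->
  rdiff (fun t => P t +i* Q t) t (p t +i* q t).
Proof.
move=> dP dQ e e0.
have [d1 d10 H1] := dP _ (divr_gt0 e0 (ltr0Sn _ 1)).
have [d2 d20 H2] := dQ _ (divr_gt0 e0 (ltr0Sn _ 1)).
exists (Num.min d1 d2); first by rewrite lt_min d10.
move=> k; rewrite lt_min => /andP[/H1 h1 /H2 h2].
apply: le_trans (nm_ReIm _) _; simpc => /=.
by lra.
Qed.

Lemma path_primitive (p : R -> C) (a u : R) :
  (forall x (e : R), 0 < e -> exists2 d : R, 0 < d & forall k, `|k| < d -> nm (p (x + k) - p x) <= e) ->
  exists P : R -> C, forall x, a < x < u -> rdiff P x (p x).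
Proof.
move=> pc.
have cRe : continuous (fun x => Re (p x)).
  move=> x; apply/cvgrPdist_le => e e0; have [d d0 dP] := pc x e e0.
  apply/nbhs_ballP; exists d => //= y; rewrite /ball /= distrC => yx.
  have := dP (y - x) yx; have -> : x + (y - x) = y by ring.
  by move=> H; apply: le_trans H; rewrite distrC -ReB; exact: nm_Re.
have cIm : continuous (fun x => Im (p x)).
  move=> x; apply/cvgrPdist_le => e e0; have [d d0 dP] := pc x e e0.
  apply/nbhs_ballP; exists d => //= y; rewrite /ball /= distrC => yx.
  have := dP (y - x) yx; have -> : x + (y - x) = y by ring.
  by move=> H; apply: le_trans H; rewrite distrC -ImB; exact: nm_Im.
have [G GP] := real_primitive a u cRe; have [H HP] := real_primitive a u cIm.
exists (fun x => G x +i* H x) => x xau; rewrite (complex_eta (p x)).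
exact: (@rdiff_components G H (fun x => Re (p x)) (fun x => Im (p x)) x (GP x xau) (HP x xau)).
Qed.

(** Retraction of the line onto [-s, s]. It extends f from the closed square to functions continuous
    along whole lines, as [path_primitive] requires. *)
Definition clamp (s x : R) : R := Num.max (- s) (Num.min s x).

Lemma clamp_bound (s x : R) : 0 < s -> `|clamp s x| <= s.
Proof.
move=> s0; rewrite ler_norml /clamp le_max lexx /= ge_max ge_min lexx /= andbT.
by lra.
Qed.

Lemma clamp_id (s x : R) : `|x| <= s -> clamp s x = x.
Proof.
rewrite ler_norml => /andP[a b]; rewrite /clamp (min_idPr b).
by rewrite (max_idPr a).
Qed.

Lemma clamp_lip (s x k : R) : 0 < s -> `|clamp s (x + k) - clamp s x| <= `|k|.
Proof.
move=> s0; have B1 := ler_norm k; have B2 := ler_norm (- k); rewrite normrN in B2.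
rewrite ler_norml /clamp; case: (leP s (x + k)) => h1; case: (leP s x) => h2;
rewrite ?(max_idPr (_ : - s <= s)); try lra;
by do ?[case: (leP (- s) _) => ?]; lra.
Qed.

Lemma rdiff_hline (g : C -> C) (x y : R) l : cdiff g (x +i* y) l -> rdiff (fun t => g (t +i* y)) x l.
Proof.
move=> dg; have := @rdiff_line R g (0 +i* y) 1 x l.
have E t : 0 +i* y + t%:C * 1 = t +i* y :> C.
  by apply/eqP; rewrite eq_complex /= !(mulr1, mulr0, subr0, addr0, add0r) !eqxx.
rewrite E mulr1 => /(_ dg).
suff -> : (fun t : R => g (0 +i* y + t%:C * 1)) = (fun t => g (t +i* y)) by [].
by apply/funext => t; rewrite E.
Qed.

Lemma rdiff_vline (g : C -> C) (x y : R) l : cdiff g (x +i* y) l ->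
  rdiff (fun t => g (x +i* t)) y (l * 'i%C).
Proof.
move=> dg; have := @rdiff_line R g (x +i* 0) 'i%C y l.
have E t : x +i* 0 + t%:C * 'i%C = x +i* t :> C.
  by apply/eqP; rewrite eq_complex /= !(mulr1, mulr0, mul0r, subr0, addr0, add0r) !eqxx.
rewrite E => /(_ dg).
suff -> : (fun t : R => g (x +i* 0 + t%:C * 'i%C)) = (fun t => g (x +i* t)) by [].
by apply/funext => t; rewrite E.
Qed.

Lemma ii : 'i%C * 'i%C = -1 :> C.
Proof. by rewrite -expr2 sqr_i. Qed.

Lemma imulB (v1 v2 b1 b2 : C) : 'i%C * (v1 - (- 'i%C) * b1 - (v2 - (- 'i%C) * b2)) =
  'i%C * (v1 - v2) - (b1 - b2).
Proof.
have -> : 'i%C * (v1 - (- 'i%C) * b1 - (v2 - (- 'i%C) * b2)) =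
  'i%C * (v1 - v2) + ('i%C * 'i%C) * (b1 - b2) by ring.
by rewrite ii mulN1r.
Qed.

Lemma dist_between (a b k : R) : Num.min a (a + k) <= b <= Num.max a (a + k) -> `|b - a| <= `|k|.
Proof.
have := ler_norm k; have := ler_norm (- k); rewrite normrN => k1 k2.
by rewrite ge_min le_max => /andP[/orP[?|?] /orP[?|?]]; rewrite ler_norml; lra.
Qed.

Section Square.
Variables (f : C -> C) (s : R).
Hypothesis s0 : 0 < s.
Hypothesis df : forall z, `|Re z| <= s -> `|Im z| <= s -> exists l, cdiff f z l.
Local Notation cl := (clamp s).

Local Notation hpath := (fun y x => f (cl x +i* cl y)).
Local Notation vpath := (fun x y => f (cl x +i* cl y)).

Lemma hpath_cont y x (e : R) : 0 < e -> exists2 d : R, 0 < d &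
  forall k, `|k| < d -> nm (hpath y (x + k) - hpath y x) <= e.
Proof.
move=> e0; have [l /cdiff_cont/(_ e e0)[d d0 dP]] := df (z := cl x +i* cl y) (clamp_bound x s0) (clamp_bound y s0).
exists d => // k kd; have := dP ((cl (x + k) - cl x)%:C).
rewrite nm_real => /(_ (le_lt_trans (clamp_lip x k s0) kd)).
rewrite /=; suff -> : (cl x +i* cl y) + (cl (x + k) - cl x)%:C = cl (x + k) +i* cl y by [].
by apply/eqP; rewrite eq_complex /= addr0 eqxx andbT; apply/eqP; ring.
Qed.

Lemma vpath_cont x y (e : R) : 0 < e -> exists2 d : R, 0 < d &
  forall k, `|k| < d -> nm (vpath x (y + k) - vpath x y) <= e.
Proof.
move=> e0; have [l /cdiff_cont/(_ e e0)[d d0 dP]] := df (z := cl x +i* cl y) (clamp_bound x s0) (clamp_bound y s0).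
exists d => // k kd; have := dP ((cl (y + k) - cl y)%:C * 'i%C).
rewrite nmM nm_i mulr1 nm_real => /(_ (le_lt_trans (clamp_lip y k s0) kd)).
rewrite /=; suff -> : (cl x +i* cl y) + (cl (y + k) - cl y)%:C * 'i%C = cl x +i* cl (y + k) by [].
by apply/eqP; rewrite eq_complex /= !(mulr0, mulr1, mul0r, subr0, addr0, add0r) eqxx /=; apply/eqP; ring.
Qed.

Variables H V : R -> R -> C.
Hypothesis HP : forall x y, `|x| <= s -> `|y| <= s -> rdiff (H y) x (f (x +i* y)).
Hypothesis VP : forall x y, `|x| <= s -> `|y| <= s -> rdiff (V x) y (f (x +i* y)).

(* The integral of f along the boundary of [a, b] x [c, d], because H y and V x
   are primitives of f along horizontal and vertical lines. *)
Definition rect_int a b c d := (H c b - H c a) + 'i%C * (V b d - V b c) - (H d b - H d a)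
  - 'i%C * (V a d - V a c).
Local Notation J := rect_int.

(** On the boundary f differs from its affine approximation A at X + iY by at most (e / 2) L, with L
    the half perimeter. The polynomial B is a primitive of A, so its boundary integral is 0, and the
    sides, of total length 2L, contribute at most e L^2. *)
Lemma rect_int_small X Y (e : R) : `|X| <= s -> `|Y| <= s -> 0 < e ->
  exists2 r : R, 0 < r & forall x b y d, x <= X <= b -> y <= Y <= d ->
    - s <= x -> b <= s -> - s <= y -> d <= s -> (b - x) + (d - y) < r ->
    nm (J x b y d) <= e * ((b - x) + (d - y)) ^+ 2.
Proof.
move=> Xs Ys e0; have [l dl] := df (z := X +i* Y) Xs Ys.
have [r r0 rP] := dl _ (divr_gt0 e0 (ltr0Sn _ 1)).
exists r => // x b y d /andP[xX Xb] /andP[yY Yd] sx bs sy ds.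
set L := b - x + (d - y) => Lr.
have xb : x <= b := le_trans xX Xb.
have yd : y <= d := le_trans yY Yd.
have L0 : 0 <= L by rewrite addr_ge0 // subr_ge0.
pose z0 : C := X +i* Y.
pose A (z : C) := f z0 + l * (z - z0).
pose B (z : C) := f z0 * z + l / 2 * ((z - z0) * (z - z0)).
have dB z : cdiff B z (A z).
  have dz : cdiff (fun w => w - z0) z (1 - 0) by exact: cdiffB (cdiff_id z) (cdiff_cst z0 z).
  have -> : A z = f z0 * 1 + l / 2 * ((1 - 0) * (z - z0) + (z - z0) * (1 - 0)).
    by rewrite /A; field.
  by apply: cdiffD; apply: cdiffZ; [exact: cdiff_id|exact: cdiffM].
pose m := e / 2 * L.
have m0 : 0 <= m by rewrite mulr_ge0 // divr_ge0 // ltW.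
have fA u v : x <= u <= b -> y <= v <= d -> nm (f (u +i* v) - A (u +i* v)) <= m.
  move=> /andP[xu ub] /andP[yv vd]; have -> : u +i* v = z0 + ((u - X) +i* (v - Y)).
    by apply/eqP; rewrite eq_complex /= !subrKC !eqxx.
  set k := (_ +i* _).
  have kL : nm k <= L.
    apply: le_trans (nm_ReIm _) _; rewrite /L; apply: lerD => /=; rewrite ler_norml.
      by clear - xX Xb xu ub; lra.
    by clear - yY Yd yv vd; lra.
  have := rP k (le_lt_trans kL Lr).
  have -> : f (z0 + k) - A (z0 + k) = f (z0 + k) - f z0 - l * k by rewrite /A; ring.
  by move=> h; apply: le_trans h _; rewrite /m ler_wpM2l // divr_ge0 // ltW.
have us u : x <= u <= b -> `|u| <= s.
  by move=> /andP[xu ub]; rewrite ler_norml (le_trans sx xu) (le_trans ub bs).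
have vs v : y <= v <= d -> `|v| <= s.
  by move=> /andP[yv vd]; rewrite ler_norml (le_trans sy yv) (le_trans vd ds).
have hb v : y <= v <= d -> nm (H v b - B (b +i* v) - (H v x - B (x +i* v))) <= m * (b - x).
  move=> vy; apply: (@mean_value_bound R (fun u => H v u - B (u +i* v))) => // u ux.
  exists (f (u +i* v) - A (u +i* v)); last exact: fA.
  by apply: rdiffB; [exact: HP (us _ ux) (vs _ vy)|exact: rdiff_hline].
(* Along a vertical line B has derivative i A, so the primitive of A to be compared with V is -i
   B. *)
have vb u : x <= u <= b ->
    nm (V u d - (- 'i%C) * B (u +i* d) - (V u y - (- 'i%C) * B (u +i* y))) <= m * (d - y).
  move=> ux; apply: (@mean_value_bound R (fun v => V u v - (- 'i%C) * B (u +i* v))) => // v vy.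
  exists (f (u +i* v) - (- 'i%C) * (A (u +i* v) * 'i%C)).
    by apply: rdiffB; [exact: VP (us _ ux) (vs _ vy)|apply: rdiffZ; exact: rdiff_vline].
  have -> : - 'i%C * (A (u +i* v) * 'i%C) = A (u +i* v).
    by rewrite mulrC mulrN -mulrA ii mulrN1 opprK.
  exact: fA.
have -> : J x b y d =
    (H y b - B (b +i* y) - (H y x - B (x +i* y)))
    + 'i%C * (V b d - (- 'i%C) * B (b +i* d) - (V b y - (- 'i%C) * B (b +i* y)))
    - (H d b - B (b +i* d) - (H d x - B (x +i* d)))
    - 'i%C * (V x d - (- 'i%C) * B (x +i* d) - (V x y - (- 'i%C) * B (x +i* y))).
  by rewrite !imulB /J; ring.
have h1 := hb y (ltac:(by rewrite lexx)); have h2 := hb d (ltac:(by rewrite lexx yd)).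
have v1 := vb x (ltac:(by rewrite lexx)); have v2 := vb b (ltac:(by rewrite lexx xb)).
have -> : e * L ^+ 2 = m * (b - x) + m * (d - y) + m * (b - x) + m * (d - y).
  by rewrite -!addrA addrA -mulrDr -/L /m; field.
apply: le_trans (nmB _ _) _; apply: lerD; last by rewrite nmM nm_i mul1r.
apply: le_trans (nmB _ _) _; apply: lerD => //.
by apply: le_trans (nmD _ _) _; apply: lerD => //; rewrite nmM nm_i mul1r.
Qed.

(** The bound e r^2 at scale r survives quadrisection because 4 (r / 2)^2 = r^2, and
    [rect_int_small] gives it at small scales; e is arbitrary. *)
Lemma goursat_rect a b c d : - s <= a -> a <= b -> b <= s -> - s <= c -> c <= d -> d <= s ->
  J a b c d = 0.
Proof.
move=> sa ab bs sc cd ds; apply/eqP; rewrite -nm_eq0 eq_le nm_ge0 andbT.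
apply/ler_addgt0Pr => e e0; rewrite add0r.
have -> : J a b c d = J a (a + 1 * (b - a)) c (c + 1 * (d - c)) by rewrite !mul1r !subrKC.
suff : nm (J a (a + 1 * (b - a)) c (c + 1 * (d - c))) <= e * (1 : R) ^+ 2 by rewrite expr1n mulr1.
apply: (@subdivision_rect R (b - a) (d - c)
  (fun x y r => nm (J x (x + r * (b - a)) y (y + r * (d - c))) <= e * r ^+ 2)); rewrite ?subr_ge0 //.
  move=> x y r r0; set w := r / 2 * (b - a); set h := r / 2 * (d - c).
  have -> : x + w + w = x + r * (b - a) by rewrite /w; field.
  have -> : y + h + h = y + r * (d - c) by rewrite /h; field.
  move=> H1 H2 H3 H4.
  have -> : J x (x + r * (b - a)) y (y + r * (d - c)) =
    J x (x + w) y (y + h) + J (x + w) (x + r * (b - a)) y (y + h) +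
    (J x (x + w) (y + h) (y + r * (d - c)) +
     J (x + w) (x + r * (b - a)) (y + h) (y + r * (d - c))) by rewrite /J; ring.
  apply: le_trans (nmD _ _) _; apply: le_trans (lerD (nmD _ _) (nmD _ _)) _.
  have -> : e * r ^+ 2 = 4 * (e * (r / 2) ^+ 2) by field.
  by clear - H1 H2 H3 H4; lra.
move=> X Y; rewrite !subrKC => /andP[aX Xb] /andP[cY Yd].
have [L L0 LE] : exists2 L, 0 < L & (b - a) + (d - c) <= L.
  by exists ((b - a) + (d - c) + 1); [rewrite ltr_wpDl // addr_ge0 // subr_ge0|rewrite lerDl].
have e1 : 0 < e / L ^+ 2 by rewrite divr_gt0 // exprn_gt0.
have [||r r0 rP] := @rect_int_small X Y _ _ _ e1.
- by rewrite ler_norml (le_trans sa aX) (le_trans Xb bs).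
- by rewrite ler_norml (le_trans sc cY) (le_trans Yd ds).
exists (r / L); first by rewrite divr_gt0.
move=> x y t /andP[t0 tr] ax xb cy yd xX yY.
have E : (x + t * (b - a) - x) + (y + t * (d - c) - y) = t * ((b - a) + (d - c)) by ring.
have tL : t * ((b - a) + (d - c)) <= t * L.
  by rewrite ler_wpM2l // ltW.
have tLr : t * L < r by rewrite -ltr_pdivlMr.
apply: le_trans (rP _ _ _ _ xX yY (le_trans sa ax) (le_trans xb bs) (le_trans sc cy) (le_trans yd ds) _) _.
  by rewrite E (le_lt_trans tL).
rewrite E; have -> : e * t ^+ 2 = e / L ^+ 2 * (t * L) ^+ 2 by field; rewrite lt0r_neq0.
apply: ler_wpM2l; first exact: ltW.
have t1 : 0 <= t * ((b - a) + (d - c)) by rewrite mulr_ge0 // ?(ltW t0) // addr_ge0 // subr_ge0.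
by rewrite ler_pXn2r ?nnegrE // (le_trans t1).
Qed.

(** Exchanging the ends of a side changes the sign of the integral, so the corners need no order;
    the increments below may have either sign. *)
Lemma rect_int0 a b c d : `|a| <= s -> `|b| <= s -> `|c| <= s -> `|d| <= s -> J a b c d = 0.
Proof.
rewrite !ler_norml => /andP[? ?] /andP[? ?] /andP[? ?] /andP[? ?].
have Jh a' b' c' d' : J a' b' c' d' = - J b' a' c' d' by rewrite /J; ring.
have Jv a' b' c' d' : J a' b' c' d' = - J a' b' d' c' by rewrite /J; ring.
have [ab|/ltW ba] := leP a b; have [cd|/ltW dc] := leP c d.
- exact: goursat_rect.
- by rewrite Jv goursat_rect ?oppr0.
- by rewrite Jh goursat_rect ?oppr0.
- by rewrite Jv Jh goursat_rect ?oppr0.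
Qed.

(** The candidate integrates f along the real axis to Re z and then vertically. By [rect_int0] the
    horizontal part of an increment can be moved from height 0 to height Im z, where f is within e /
    2 of f z; what remains is two one-dimensional mean value estimates. *)
Lemma line_primitives_glue z : `|Re z| < s -> `|Im z| < s ->
  cdiff (fun z => H 0 (Re z) + 'i%C * (V (Re z) (Im z) - V (Re z) 0)) z (f z).
Proof.
move=> zx zy e e0.
have [l /cdiff_cont dl] := df (ltW zx) (ltW zy).
have [d d0 dP] := dl _ (divr_gt0 e0 (ltr0Sn _ 1)).
exists (Num.min d (Num.min (s - `|Re z|) (s - `|Im z|)) / 2).
  by rewrite divr_gt0 // !lt_min d0 !subr_gt0 zx zy.
move=> h; rewrite ltr_pdivlMr // !lt_min => /and3P[hd hx hy].
have np := nm_Re h; have nq := nm_Im h; have n0 := nm_ge0 h.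
have [N NE] : {N | N = nm h} by exists (nm h).
rewrite -NE in hd hx hy np nq n0 *.
case: z zx zy dl dP hx hy => x y /= zx zy _ dP hx hy.
case: h NE np nq => p q; set h := p +i* q => _ np nq /=; rewrite /= in np nq.
have xp : `|x + p| <= s by apply: le_trans (ler_normD _ _) _; lra.
have yq : `|y + q| <= s by apply: le_trans (ler_normD _ _) _; lra.
have s00 : `|0 : R| <= s by rewrite normr0 ltW.
have J1 := rect_int0 (ltW zx) xp s00 (ltW zy).
have -> : H 0 (x + p) + 'i%C * (V (x + p) (y + q) - V (x + p) 0) -
    (H 0 x + 'i%C * (V x y - V x 0)) - f (x +i* y) * h =
  ((H y (x + p) - f (x +i* y) * (x + p)%:C) - (H y x - f (x +i* y) * x%:C)) +
  'i%C * ((V (x + p) (y + q) - f (x +i* y) * (y + q)%:C) - (V (x + p) y - f (x +i* y) * y%:C))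
  + J x (x + p) 0 y.
  have -> : h = p%:C + 'i%C * q%:C by rewrite [h]complexE.
  by rewrite /J !rmorphD /=; ring.
rewrite J1 addr0.
have near u v : Num.min x (x + p) <= u <= Num.max x (x + p) ->
    Num.min y (y + q) <= v <= Num.max y (y + q) ->
    [/\ `|u| <= s, `|v| <= s & nm (f (u +i* v) - f (x +i* y)) <= e / 2].
  move=> ux vy.
  have ux' := dist_between ux; have vy' := dist_between vy.
  have ub : `|u| <= `|x| + `|u - x|.
    by have := ler_normD x (u - x); rewrite subrKC.
  have vb : `|v| <= `|y| + `|v - y|.
    by have := ler_normD y (v - y); rewrite subrKC.
  split; [lra|lra|].
  have := dP ((u - x) +i* (v - y)).
  have -> : (x +i* y) + ((u - x) +i* (v - y)) = u +i* v.
    by apply/eqP; rewrite eq_complex /= !subrKC !eqxx.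
  by apply; apply: le_lt_trans (nm_ReIm _) _ => /=; lra.
have lin (c : C) t : rdiff (fun u : R => c * u%:C) t c.
  move=> e' e'0; exists 1 => // k _; rewrite rmorphD /=.
  have -> : c * (t%:C + k%:C) - c * t%:C - c * k%:C = 0 by ring.
  by rewrite nm0 mulr_ge0 // ltW.
have yy : Num.min y (y + q) <= y <= Num.max y (y + q) by rewrite ge_min le_max lexx.
have xx : Num.min x (x + p) <= x + p <= Num.max x (x + p) by rewrite ge_min le_max !lexx !orbT.
have hb : nm ((H y (x + p) - f (x +i* y) * (x + p)%:C) - (H y x - f (x +i* y) * x%:C)) <= e / 2 * `|x + p - x|.
  apply: (@mean_value_bound_abs R (fun u => H y u - f (x +i* y) * u%:C)) => u ux.
  have [us ys fe] := near _ _ ux yy.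
  by exists (f (u +i* y) - f (x +i* y)) => //; apply: rdiffB; [exact: (HP us ys)|exact: lin].
have vb : nm ((V (x + p) (y + q) - f (x +i* y) * (y + q)%:C) - (V (x + p) y - f (x +i* y) * y%:C)) <= e / 2 * `|y + q - y|.
  apply: (@mean_value_bound_abs R (fun v => V (x + p) v - f (x +i* y) * v%:C)) => v vy.
  have [us ys fe] := near _ _ xx vy.
  by exists (f ((x + p) +i* v) - f (x +i* y)) => //; apply: rdiffB; [exact: (VP us ys)|exact: lin].
apply: le_trans (nmD _ _) _; rewrite nmM nm_i mul1r.
have px : x + p - x = p by ring.
have qy : y + q - y = q by ring.
rewrite px in hb; rewrite qy in vb.
have e2 : 0 <= e / 2 by lra.
have := ler_wpM2l e2 np; have := ler_wpM2l e2 nq.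
by lra.
Qed.

End Square.

Lemma square_primitive (f : C -> C) (s : R) : 0 < s ->
  (forall z, `|Re z| <= s -> `|Im z| <= s -> exists l, cdiff f z l) ->
  exists F : C -> C, forall z, `|Re z| < s -> `|Im z| < s -> cdiff F z (f z).
Proof.
move=> s0 df.
have [H HP] := choice (fun y => path_primitive (- s - 1) (s + 1) (hpath_cont s0 df y)).
have [V VP] := choice (fun x => path_primitive (- s - 1) (s + 1) (vpath_cont s0 df x)).
have inside (x : R) : `|x| <= s -> - s - 1 < x < s + 1 by rewrite ler_norml; lra.
exists (fun z => H 0 (Re z) + 'i%C * (V (Re z) (Im z) - V (Re z) 0)) => z.
apply: line_primitives_glue => // x y xs ys.
  by have := HP y x (inside x xs); rewrite /= !clamp_id.
by have := VP x y (inside y ys); rewrite /= !clamp_id.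
Qed.

End Goursat.

(** * The maximum principle and Cauchy's estimates *)

Section MaximumPrinciple.
Variable R : realType.
Local Notation C := R[i].
Local Notation nm := (@Normc.normc R).

Definition taylor2 (f : C -> C) z := exists f1 f2, forall e : R, 0 < e ->
  exists2 d : R, 0 < d & forall h, nm h < d ->
    nm (f (z + h) - f z - f1 * h - f2 * (h * h)) <= e * nm h ^+ 2.

(** Parallelogram law over the fourth roots of unity: at t, -t, it, -it the mixed products of a, b t
    and c t^2 cancel in the sum. *)
Lemma four_point_average (a b c : C) (t : R) :
  nm (a + b * t%:C + c * (t%:C * t%:C)) ^+ 2 +
  nm (a + b * - t%:C + c * (- t%:C * - t%:C)) ^+ 2 +
  (nm (a + b * (t%:C * 'i%C) + c * (t%:C * 'i%C * (t%:C * 'i%C))) ^+ 2 +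
   nm (a + b * - (t%:C * 'i%C) + c * (- (t%:C * 'i%C) * - (t%:C * 'i%C))) ^+ 2) =
  4 * (nm a ^+ 2 + t ^+ 2 * nm b ^+ 2 + t ^+ 4 * nm c ^+ 2).
Proof.
by rewrite !nm_sqr; case: a b c => [a1 a2] [b1 b2] [c1 c2] /=; ring.
Qed.

Lemma sqr_usc (a e : R) : 0 <= a -> 0 < e ->
  exists2 d : R, 0 < d & forall b, 0 <= b -> b <= a + d -> b ^+ 2 <= a ^+ 2 + e.
Proof.
move=> a0 e0; pose d := Num.min 1 (e / (2 * a + 1)).
have a1 : 0 < 2 * a + 1 by lra.
have d0 : 0 < d by rewrite lt_min ltr01 divr_gt0.
exists d => // b b0 bad.
have d1 : d <= 1 by rewrite ge_min lexx.
have d2 : d * (2 * a + 1) <= e by rewrite -ler_pdivlMr // ge_min lexx orbT.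
have : b ^+ 2 <= (a + d) ^+ 2 by rewrite ler_pXn2r ?nnegrE //; lra.
have : d ^+ 2 <= d by rewrite expr2 ger_pMr.
by lra.
Qed.

Lemma sqr_norm_perturb (p r : C) : nm p ^+ 2 - 2 * nm p * nm r <= nm (p + r) ^+ 2.
Proof.
have [pr|rp] := leP (nm p) (nm r).
  apply: (@le_trans _ _ 0); last by rewrite sqr_ge0.
  have : nm p * nm p <= nm p * nm r by rewrite ler_wpM2l ?nm_ge0.
  by have : 0 <= nm p * nm r; [rewrite mulr_ge0 ?nm_ge0|rewrite -expr2; lra].
have H := nm_triD p r.
have : (nm p - nm r) ^+ 2 <= nm (p + r) ^+ 2.
  by rewrite ler_pXn2r ?nnegrE ?nm_ge0 // subr_ge0 ltW.
by have := sqr_ge0 (nm r); lra.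
Qed.

(* At an interior maximum of |f|^2 + eps |z|^2 the average over z +- t, z +- it
   of this function exceeds its value at z, because the second-order terms of f
   cancel. *)
Lemma max_principle_taylor2 (K : C -> Prop) (f : C -> C) (M : R) : is_compact K -> 0 <= M ->
  (forall z, K z -> forall e : R, 0 < e -> exists2 d : R, 0 < d &
     forall w, K w -> nm (w - z) < d -> nm (f w - f z) <= e) ->
  (forall z, K z -> nm (f z) <= M \/
     (exists2 r : R, 0 < r & forall w, nm (w - z) < r -> K w) /\ taylor2 f z) ->
  forall z, K z -> nm (f z) <= M.
Proof.
move=> cK M0 fc fint z0 Kz0; rewrite leNgt; apply/negP => fz0.
have [[B0 BK0] _] := cK; pose B := `|B0|.
have B_0 : 0 <= B by rewrite normr_ge0.
have BK z : K z -> nm z ^+ 2 <= B ^+ 2.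
  move=> /BK0 zB; have := ler_norm B0; rewrite -/B => BB.
  by rewrite ler_pXn2r ?nnegrE ?nm_ge0 //; lra.
have B1 : 0 < B ^+ 2 + 1 by have := sqr_ge0 B; lra.
have gap : 0 < nm (f z0) ^+ 2 - M ^+ 2.
  by rewrite subr_gt0 ltr_pXn2r ?nnegrE // (le_trans M0) // ltW.
(* Small enough that a point with |f| <= M cannot maximise [phi], which is at most M^2 + ep B^2
   there. *)
pose ep := (nm (f z0) ^+ 2 - M ^+ 2) / (2 * (B ^+ 2 + 1)).
have ep0 : 0 < ep by rewrite divr_gt0 // mulr_gt0.
have epB : M ^+ 2 + ep * B ^+ 2 < nm (f z0) ^+ 2.
  have : ep * (2 * (B ^+ 2 + 1)) = nm (f z0) ^+ 2 - M ^+ 2.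
    by rewrite /ep divfK // lt0r_neq0 // mulr_gt0.
  have : 0 <= ep * B ^+ 2 by rewrite mulr_ge0 ?sqr_ge0 // ltW.
  by lra.
pose phi z := nm (f z) ^+ 2 + ep * nm z ^+ 2.
have [z1 Kz1 max1] : exists2 z1, K z1 & forall z, K z -> phi z <= phi z1.
  apply: (max_on_compact cK Kz0) => z Kz e e0.
  have [d1 d10 H1] := sqr_usc (nm_ge0 (f z)) (divr_gt0 e0 (ltr0Sn _ 1)).
  have e2 : 0 < e / (2 * ep) by rewrite divr_gt0 // mulr_gt0.
  have [d2 d20 H2] := sqr_usc (nm_ge0 z) e2.
  have [d3 d30 H3] := fc z Kz _ d10.
  exists (Num.min d2 d3); first by rewrite lt_min d20.
  move=> w Kw; rewrite lt_min => /andP[w2 w3].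
  have h3 := H3 w Kw w3; have t1 := nm_triB (f w) (f z); have t2 := nm_triB w z.
  have := H1 _ (nm_ge0 (f w)) (ltac:(lra)); have := H2 _ (nm_ge0 w) (ltac:(lra)).
  rewrite /phi => h1 h2.
  have : ep * nm w ^+ 2 <= ep * (nm z ^+ 2 + e / (2 * ep)) by rewrite ler_wpM2l // ltW.
  have -> : ep * (nm z ^+ 2 + e / (2 * ep)) = ep * nm z ^+ 2 + e / 2.
    by field; rewrite lt0r_neq0.
  by lra.
have phi01 := max1 z0 Kz0.
have [fM|[[r r0 rK] [f1 [f2 ft]]]] := fint z1 Kz1.
  have : nm (f z1) ^+ 2 <= M ^+ 2 by rewrite ler_pXn2r ?nnegrE ?nm_ge0.
  have : ep * nm z1 ^+ 2 <= ep * B ^+ 2 by rewrite ler_wpM2l ?BK // ltW.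
  have : 0 <= ep * nm z0 ^+ 2 by rewrite mulr_ge0 ?sqr_ge0 // ltW.
  by move: phi01; rewrite /phi; lra.
pose P := nm (f z1) + nm f1 + nm f2.
have P0 : 0 <= P by rewrite /P; have := nm_ge0 (f z1); have := nm_ge0 f1; have := nm_ge0 f2; lra.
(* The Taylor errors at the four points amount to at most 8 P e' t^2, which this choice keeps below
   the gain 4 ep t^2. *)
pose e' := ep / (4 * P + 4).
have e'0 : 0 < e' by rewrite divr_gt0 //; lra.
have e'P : e' * (4 * P + 4) = ep by rewrite /e' divfK // lt0r_neq0 //; lra.
have [d d0 dP] := ft e' e'0.
pose m := Num.min 1 (Num.min d r); pose t := m / 2.
have m0 : 0 < m by rewrite !lt_min ltr01 d0.
have t0 : 0 < t by rewrite divr_gt0.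
have tm : t < m by rewrite /t; lra.
have [t1 td tr] : [/\ t < 1, t < d & t < r].
  by move: tm; rewrite !lt_min => /and3P[].
have pt h : nm h = t -> nm (f z1 + f1 * h + f2 * (h * h)) ^+ 2 - 2 * P * e' * t ^+ 2 +
    ep * nm (z1 + 1 * h + 0 * (h * h)) ^+ 2 <= phi z1.
  move=> ht; have Kh : K (z1 + h) by apply: rK; rewrite addrC addKr ht.
  apply: le_trans (max1 _ Kh); rewrite /phi mul1r mul0r addr0 lerD2r.
  set p := f z1 + f1 * h + f2 * (h * h).
  pose rr := f (z1 + h) - p.
  have -> : f (z1 + h) = p + rr by rewrite /rr; ring.
  have := sqr_norm_perturb p rr.
  have rb : nm rr <= e' * t ^+ 2.
    have := dP h; rewrite ht => /(_ td).
    by have -> : f (z1 + h) - f z1 - f1 * h - f2 * (h * h) = rr by rewrite /rr /p; ring.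
  have pb : nm p <= P.
    apply: le_trans (nmD _ _) _; apply: le_trans (lerD (nmD _ _) (lexx _)) _.
    rewrite !nmM ht /P.
    have : nm f1 * t <= nm f1 * 1 by rewrite ler_wpM2l ?nm_ge0 // ltW.
    have : nm f2 * (t * t) <= nm f2 * 1.
      by rewrite ler_wpM2l ?nm_ge0 // mulr_ile1 // ltW.
    by lra.
  have : nm p * nm rr <= P * (e' * t ^+ 2) by apply: ler_pM; rewrite ?nm_ge0.
  by lra.
have n1 : nm (t%:C) = t by rewrite nm_real gtr0_norm.
have n2 : nm (t%:C * 'i%C) = t by rewrite nmM nm_i mulr1.
have A1 := pt _ n1; have A2 := pt (- t%:C); rewrite nmN in A2; have {}A2 := A2 n1.
have A3 := pt _ n2; have A4 := pt (- (t%:C * 'i%C)); rewrite nmN in A4; have {}A4 := A4 n2.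
have F1 := four_point_average (f z1) f1 f2 t.
have F2 := four_point_average z1 1 0 t.
rewrite nm1 nm0 expr1n expr0n /= mulr1 mulr0 addr0 in F2.
have G0 : 0 <= t ^+ 2 * nm f1 ^+ 2 by rewrite mulr_ge0 ?sqr_ge0.
have G1 : 0 <= t ^+ 4 * nm f2 ^+ 2 by rewrite mulr_ge0 ?sqr_ge0 // exprn_ge0 // ltW.
have T0 : 0 < t ^+ 2 by rewrite exprn_gt0.
have {F2} F2 : ep * (nm (z1 + 1 * t%:C + 0 * (t%:C * t%:C)) ^+ 2 +
     nm (z1 + 1 * - t%:C + 0 * (- t%:C * - t%:C)) ^+ 2 +
     (nm (z1 + 1 * (t%:C * 'i%C) + 0 * (t%:C * 'i%C * (t%:C * 'i%C))) ^+ 2 +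
      nm (z1 + 1 * - (t%:C * 'i%C) + 0 * (- (t%:C * 'i%C) * - (t%:C * 'i%C))) ^+ 2)) =
   ep * (4 * (nm z1 ^+ 2 + t ^+ 2)) by rewrite F2.
have main : 4 * ep * t ^+ 2 <= 8 * P * e' * t ^+ 2.
  rewrite /phi in A1 A2 A3 A4; clear - A1 A2 A3 A4 F1 F2 G0 G1.
  by lra.
have : 8 * P * e' * t ^+ 2 < 4 * ep * t ^+ 2.
  have Pe := mulr_ge0 P0 (ltW e'0).
  by rewrite ltr_pM2r // -e'P; clear - e'0 Pe; lra.
by lra.
Qed.

(** Mean value inequality for F minus the quadratic candidate, whose derivative f w - f z - l (w -
    z) is o(w - z). *)
Lemma taylor2_primitive (F f : C -> C) z l (r : R) : 0 < r ->
  (forall w, nm (w - z) < r -> cdiff F w (f w)) -> cdiff f z l -> taylor2 F z.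
Proof.
move=> r0 dF df; exists (f z), (l / 2) => e e0.
have [d d0 dP] := df e e0; exists (Num.min d r); first by rewrite lt_min d0.
move=> h; rewrite lt_min => /andP[hd hr].
pose G w := F w - (f z * (w - z) + l / 2 * ((w - z) * (w - z))).
have -> : F (z + h) - F z - f z * h - l / 2 * (h * h) = G (z + h) - G z by rewrite /G; ring.
rewrite expr2 mulrA; apply: mean_value_bound_seg => t /andP[t0 t1].
have th : nm (t%:C * h) <= nm h.
  rewrite nmM nm_real ger0_norm //.
  by have : t * nm h <= 1 * nm h; [rewrite ler_wpM2r ?nm_ge0|lra].
pose w := z + t%:C * h.
have wz : w - z = t%:C * h by rewrite /w; ring.
exists (f w - (f z * (1 - 0) + l / 2 * ((1 - 0) * (w - z) + (w - z) * (1 - 0)))).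
  have dz : cdiff (fun w => w - z) w (1 - 0) by exact: cdiffB (cdiff_id w) (cdiff_cst z w).
  apply: cdiffB; first by apply: dF; rewrite wz; exact: le_lt_trans hr.
  by apply: cdiffD; apply: cdiffZ => //; exact: cdiffM.
have -> : f w - (f z * (1 - 0) + l / 2 * ((1 - 0) * (w - z) + (w - z) * (1 - 0))) =
  f (z + (w - z)) - f z - l * (w - z).
  have -> : z + (w - z) = w by ring.
  by field.
rewrite wz; apply: le_trans (dP _ (le_lt_trans th hd)) _.
by rewrite ler_wpM2l // ltW.
Qed.

Lemma taylor2_diffquot (F : C -> C) z k : taylor2 F z -> taylor2 F (z + k) ->
  taylor2 (fun w => (F (w + k) - F w) / k) z.
Proof.
move=> [f1 [f2 H1]] [g1 [g2 H2]]; exists ((g1 - f1) / k), ((g2 - f2) / k) => e e0.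
have k1 : 0 < nm k^-1 + 1 by have := nm_ge0 k^-1; lra.
have e1 : 0 < e / (2 * (nm k^-1 + 1)) by rewrite divr_gt0 // mulr_gt0.
have [d1 d10 D1] := H1 _ e1; have [d2 d20 D2] := H2 _ e1.
exists (Num.min d1 d2); first by rewrite lt_min d10.
move=> h; rewrite lt_min => /andP[/D1 h1 /D2 h2].
set a := F (z + h) - _ - _ - _ in h1; set b := F (z + k + h) - _ - _ - _ in h2.
have -> : (F (z + h + k) - F (z + h)) / k - (F (z + k) - F z) / k - (g1 - f1) / k * h
   - (g2 - f2) / k * (h * h) = (b - a) * k^-1.
  have -> : z + h + k = z + k + h by ring.
  by rewrite /a /b; ring.
rewrite nmM; have ba := nmB b a.
have : nm (b - a) * nm k^-1 <= (2 * (e / (2 * (nm k^-1 + 1)) * nm h ^+ 2)) * (nm k^-1 + 1).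
  by apply: ler_pM; rewrite ?nm_ge0 //; lra.
have -> : 2 * (e / (2 * (nm k^-1 + 1)) * nm h ^+ 2) * (nm k^-1 + 1) = e * nm h ^+ 2.
  by field; rewrite lt0r_neq0.
by [].
Qed.

Lemma local_primitive (f : C -> C) (c : C) (s : R) : 0 < s ->
  (forall z, nm (z - c) <= 2 * s -> exists l, cdiff f z l) ->
  exists F, forall z, nm (z - c) < s -> cdiff F z (f z).
Proof.
move=> s0 df.
have [|F FP] := @square_primitive R (fun z => f (z + c)) s s0.
  move=> z zx zy; have [|l dl] := df (z + c); last by exists l; exact: cdiff_shift.
  by rewrite addrK; apply: le_trans (nm_ReIm _) _; lra.
exists (fun z => F (z - c)) => z zc; apply: cdiff_shift.
have -> : f z = f (z - c + c) by rewrite subrK.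
by apply: FP; apply: le_lt_trans zc; [exact: nm_Re|exact: nm_Im].
Qed.

Definition hold (f : C -> C) (c : C) (r : R) :=
  forall z, nm (z - c) < r -> exists l, cdiff f z l.

(** The radii: a primitive on radius 3/2 s requires f on radius 3 s, which lies inside r, and steps
    k < s / 4 keep w + k where the primitive is defined. The error e / 2 between Q and f occurs
    twice, on the circle and at z. *)
Lemma max_principle_disc (f : C -> C) (c : C) (s r M : R) : 0 < s -> 4 * s <= r ->
  hold f c r -> (forall z, nm (z - c) = s -> nm (f z) <= M) ->
  forall z, nm (z - c) <= s -> nm (f z) <= M.
Proof.
move=> s0 sr hf fM z zs.
have [F FP] : exists F, forall z, nm (z - c) < 3 / 2 * s -> cdiff F z (f z).
  by apply: local_primitive; [lra|move=> w wc; apply: hf; lra].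
have cK := compact_disc s c.
have M0 : 0 <= M.
  apply: le_trans (fM (c + s%:C) _); first exact: nm_ge0.
  by rewrite addrC addKr nm_real gtr0_norm.
apply/ler_addgt0Pr => e e0.
have [d d0 dP] : exists2 d : R, 0 < d & forall z h, nm (z - c) <= s -> nm h < d -> nm (f (z + h) - f z) <= e / 2.
  apply: (unif_cont_on_compact cK); last by rewrite divr_gt0.
  by move=> w wc; have [|l /cdiff_cont] := hf w; [lra|].
pose k := Num.min d (s / 4) / 2.
have m0 : 0 < Num.min d (s / 4) by rewrite lt_min d0 divr_gt0.
have k0 : 0 < k by rewrite divr_gt0.
have [kd ks] : k < d /\ k < s / 4.
  have : k < Num.min d (s / 4) by rewrite /k; lra.
  by rewrite lt_min => /andP[].
have nk : nm k%:C = k by rewrite nm_real gtr0_norm.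
have kC : k%:C != 0 by rewrite -nm_gt0 nk.
pose Q w := (F (w + k%:C) - F w) / k%:C.
have Qf w : nm (w - c) <= s -> nm (Q w - f w) <= e / 2.
  move=> ws.
  have -> : Q w - f w = ((F (w + k%:C) - f w * (w + k%:C)) - (F w - f w * w)) * (k%:C)^-1.
    by rewrite /Q; field.
  rewrite nmM nmV ler_pdivrMr ?nk // -[X in _ <= _ * X]nk.
  apply: (@mean_value_bound_seg _ (fun u => F u - f w * u)) => t /andP[t0 t1].
  have tk : nm (t%:C * k%:C) <= k.
    rewrite nmM nk nm_real ger0_norm //.
    by have : t * k <= 1 * k; [rewrite ler_wpM2r // ltW|lra].
  exists (f (w + t%:C * k%:C) - f w * 1); last by rewrite mulr1; apply: dP => //; lra.
  apply: cdiffB; last exact: cdiffZ (cdiff_id _).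
  apply: FP; have -> : w + t%:C * k%:C - c = (w - c) + t%:C * k%:C by ring.
  by apply: le_lt_trans (nmD _ _) _; lra.
have Qt w : nm (w - c) <= s -> taylor2 Q w.
  move=> ws; have tay u : nm (u - c) < 3 / 2 * s -> taylor2 F u.
    move=> us; have [|l dl] := hf u; first lra.
    apply: (@taylor2_primitive F f u l (3 / 2 * s - nm (u - c))) => //; first lra.
    move=> v vu; apply: FP; have -> : v - c = (v - u) + (u - c) by ring.
    by apply: le_lt_trans (nmD _ _) _; lra.
  apply: taylor2_diffquot; apply: tay; first lra.
  have -> : w + k%:C - c = (w - c) + k%:C by ring.
  by apply: le_lt_trans (nmD _ _) _; rewrite nk; lra.
suff H : nm (Q z) <= M + e / 2.
  have -> : f z = Q z - (Q z - f z) by ring.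
  by apply: le_trans (nmB _ _) _; have := Qf z zs; lra.
apply: (@max_principle_taylor2 _ Q (M + e / 2) cK _ _ _ z zs); first lra.
  move=> w ws e1 e10; have [q1 [q2 /(_ 1 ltr01)[d1 d10 D1]]] := Qt w ws.
  pose L := nm q1 + nm q2 + 1.
  have L0 : 0 < L by rewrite /L; have := nm_ge0 q1; have := nm_ge0 q2; lra.
  exists (Num.min 1 (Num.min d1 (e1 / L))); first by rewrite !lt_min ltr01 d10 divr_gt0.
  move=> u _; rewrite !lt_min => /and3P[u1 /D1 u2 u3].
  have uw : w + (u - w) = u by ring.
  rewrite uw in u2; set h := u - w in u1 u2 u3.
  have -> : Q u - Q w = (Q u - Q w - q1 * h - q2 * (h * h)) + q1 * h + q2 * (h * h) by ring.
  apply: le_trans (nmD _ _) _; apply: le_trans (lerD (nmD _ _) (lexx _)) _.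
  have H2 : nm h ^+ 2 <= nm h by rewrite expr2; apply: ler_piMr; [exact: nm_ge0|exact: ltW].
  rewrite !nmM -expr2; have : nm h * L <= e1 by have := ltW u3; rewrite ler_pdivlMr.
  have : nm q2 * nm h ^+ 2 <= nm q2 * nm h by rewrite ler_wpM2l ?nm_ge0.
  by rewrite /L; lra.
move=> w ws; have [wlt|wge] := ltP (nm (w - c)) s.
  right; split; last exact: Qt.
  exists (s - nm (w - c)); first lra.
  move=> u uw; have -> : u - c = (u - w) + (w - c) by ring.
  by apply: le_trans (nmD _ _) _; lra.
left; have -> : Q w = (Q w - f w) + f w by ring.
apply: le_trans (nmD _ _) _; have := Qf w ws.
by have := fM w (ltac:(apply/eqP; rewrite eq_le ws wge)); lra.
Qed.

End MaximumPrinciple.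

Section CauchyEstimates.
Variable R : realType.
Local Notation C := R[i].
Local Notation nm := (@Normc.normc R).
Local Notation Re := (@complex.Re R).
Local Notation Im := (@complex.Im R).

(** If y = B / x were below 1, the hypothesis a <= b y^n for all n would contradict Bernoulli's
    inequality in the form (1 + n (1 - y)) y^n <= 1. *)
Lemma le_of_geometric_bound (a b x B : R) : 0 < a -> 0 <= x -> 0 <= B ->
  (forall n, a * x ^+ n <= b * B ^+ n) -> x <= B.
Proof.
move=> a0 x0 B0 H; rewrite leNgt; apply/negP => Bx.
have xp : 0 < x by exact: le_lt_trans Bx.
pose y := B / x.
have y0 : 0 <= y by rewrite divr_ge0.
have y1 : y < 1 by rewrite ltr_pdivrMr // mul1r.
have yn n : a <= b * y ^+ n.
  by rewrite expr_div_n mulrA ler_pdivlMr ?exprn_gt0.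
have bern n : (1 + n%:R * (1 - y)) * y ^+ n <= 1.
  elim: n => [|n IH]; first by rewrite mul0r addr0 mul1r expr0.
  apply: le_trans IH; rewrite exprS mulrA ler_wpM2r ?exprn_ge0 //.
  rewrite -natr1; have n0 : (0 : R) <= n%:R by [].
  have : 0 <= (1 - y) * (1 - y) by rewrite -expr2 sqr_ge0.
  have : 0 <= n%:R * ((1 - y) * (1 - y)) by rewrite mulr_ge0 // -expr2 sqr_ge0.
  by lra.
have b0 : 0 < b by have := yn 0%N; rewrite expr0 mulr1; exact: lt_le_trans.
have bound n : a * (1 + n%:R * (1 - y)) <= b.
  have n1 : 0 <= 1 + n%:R * (1 - y) by rewrite addr_ge0 // mulr_ge0 // subr_ge0 ltW.
  apply: le_trans (ler_wpM2r n1 (yn n)) _.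
  rewrite -mulrA -[leRHS]mulr1 ler_wpM2l //; first exact: ltW.
  by rewrite mulrC.
have ay : 0 < a * (1 - y) by rewrite mulr_gt0 // subr_gt0.
have := archi_boundP (divr_ge0 (ltW b0) (ltW ay)).
rewrite ltr_pdivrMr //; have := bound (Num.bound (b / (a * (1 - y)))).
by lra.
Qed.

(* The maximum principle for (z - w) q^n, q the difference quotient of f at w,
   bounds q in the limit n -> oo; the factor z - w makes this function
   differentiable at w. *)
Lemma cauchy_lipschitz (f : C -> C) c (s r M : R) : 0 < s -> 4 * s <= r ->
  hold f c r -> (forall z, nm (z - c) = s -> nm (f z) <= M) ->
  forall z w, nm (z - c) <= s / 2 -> nm (w - c) <= s / 2 ->
  nm (f z - f w) <= 4 * M / s * nm (z - w).
Proof.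
move=> s0 sr hf fM z w zs ws.
have fM' := max_principle_disc s0 sr hf fM.
have M0 : 0 <= M by apply: le_trans (fM' c _); [exact: nm_ge0|rewrite subrr nm0 ltW].
have [->|zw] := eqVneq z w; first by rewrite !subrr nm0 mulr0.
have [l dl] := hf w (ltac:(lra)).
pose q u := if u == w then l else (f u - f w) / (u - w).
(* 2M bounds |f u - f w|, and s / 2 is a lower bound for the distance from w to the circle |u - c| =
   s. *)
pose B := 4 * M / s.
have B0 : 0 <= B by rewrite /B divr_ge0 ?mulr_ge0 // ltW.
have qz : q z = (f z - f w) / (z - w) by rewrite /q (negbTE zw).
have zw0 : 0 < nm (z - w) by rewrite nm_gt0 subr_eq0.
suff : nm (q z) <= B by rewrite qz nmM nmV ler_pdivrMr.
apply: (@le_of_geometric_bound (nm (z - w)) (2 * s) (nm (q z)) B) => //; first exact: nm_ge0.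
move=> n; rewrite -nmX -nmM.
have cq : ccont q w.
  move=> e e0; have [d d0 dP] := dl e e0; exists d => // h hd.
  have [->|h0] := eqVneq h 0; first by rewrite addr0 subrr nm0 ltW.
  have wh : w + h != w by rewrite -subr_eq0 addrC addKr.
  rewrite /q eqxx (negbTE wh).
  have -> : (f (w + h) - f w) / (w + h - w) - l = (f (w + h) - f w - l * h) / h.
    by rewrite [w + h]addrC addrK; field.
  by rewrite nmM nmV ler_pdivrMr ?nm_gt0 // dP.
apply: (@max_principle_disc R (fun u => (u - w) * q u ^+ n) c s r) => //; try lra.
- move=> u ur; have [->|uw] := eqVneq u w.
    exists (l ^+ n) => e e0; have [d d0 dP] := ccontX n cq e0; exists d => // h /dP.
    rewrite {2}/q eqxx subrr mul0r subr0 => H.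
    have -> : (w + h - w) * q (w + h) ^+ n - l ^+ n * h = (q (w + h) ^+ n - l ^+ n) * h by ring.
    by rewrite nmM ler_wpM2r ?nm_ge0.
  have [l' dl'] := hf u ur.
  have dw : cdiff (fun v => v - w) u (1 - 0) by exact: cdiffB (cdiff_id u) (cdiff_cst w u).
  have [m dm] : exists m, cdiff q u m.
    have uw' : u + - w != 0 by rewrite subr_eq0.
    have di := cdiff_shift (cdiff_inv uw').
    have := cdiffM (cdiffB dl' (cdiff_cst (f w) u)) di.
    set m := (X in cdiff _ _ X) => dm; exists m.
    have uw0 : 0 < nm (u - w) by rewrite nm_gt0 subr_eq0.
    apply: (cdiff_ext uw0 _ dm) => v; rewrite /q.
    by have [->|//] := eqVneq v w; rewrite nmBC ltxx.
  have [m' dm'] := cdiffX n dm.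
  by eexists; exact: cdiffM dw dm'.
- move=> u us.
  have us1 : s / 2 <= nm (u - w).
    have -> : u - w = (u - c) - (w - c) by ring.
    by apply: le_trans (nm_triB _ _); lra.
  have us2 : nm (u - w) <= 2 * s.
    have -> : u - w = (u - c) - (w - c) by ring.
    by apply: le_trans (nmB _ _) _; lra.
  have uw : u != w.
    by apply: contraTneq us1 => ->; rewrite subrr nm0 -ltNge divr_gt0.
  rewrite nmM nmX; apply: ler_pM => //; rewrite ?nm_ge0 ?exprn_ge0 ?nm_ge0 //.
  rewrite lerXn2r ?nnegrE ?nm_ge0 // /q (negbTE uw) nmM nmV ler_pdivrMr ?nm_gt0 ?subr_eq0 //.
  have : B * (s / 2) <= B * nm (u - w) by rewrite ler_wpM2l.
  have -> : B * (s / 2) = 2 * M by rewrite /B; field; rewrite lt0r_neq0.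
  by have := nmB (f u) (f w); have := fM u us; have := fM' w (ltac:(lra)); lra.
Qed.

Lemma le_derivative_bound (f : C -> C) z l (K : R) (d : R) : 0 < d -> cdiff f z l ->
  (forall k : R, 0 < k -> k < d -> nm (f (z + k%:C) - f z) <= K * k) -> nm l <= K.
Proof.
move=> d0 dl H; apply/ler_addgt0Pr => e e0; have [d1 d10 dP] := dl e e0.
pose k := Num.min d d1 / 2.
have m0 : 0 < Num.min d d1 by rewrite lt_min d0.
have k0 : 0 < k by rewrite divr_gt0.
have [kd kd1] : k < d /\ k < d1.
  have : k < Num.min d d1 by rewrite /k; lra.
  by rewrite lt_min => /andP[].
have nk : nm k%:C = k by rewrite nm_real gtr0_norm.
have := dP k%:C; rewrite nk => /(_ kd1) h1; have h2 := H k k0 kd.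
suff : nm l * k <= (K + e) * k by rewrite ler_pM2r.
rewrite -{1}nk -nmM.
have -> : l * k%:C = (f (z + k%:C) - f z) - (f (z + k%:C) - f z - l * k%:C) by ring.
by apply: le_trans (nmB _ _) _; lra.
Qed.

Lemma hold_diffquot (f : C -> C) c (r k : R) : 0 < k -> hold f c (r + k) ->
  hold (fun z => (f (z + k%:C) - f z) / k%:C) c r.
Proof.
move=> k0 hf z zr.
have [|l1 d1] := hf (z + k%:C).
  have -> : z + k%:C - c = (z - c) + k%:C by ring.
  by apply: le_lt_trans (nmD _ _) _; rewrite nm_real gtr0_norm //; lra.
have [|l2 d2] := hf z; first by lra.
by eexists; exact: (cdiffM (cdiffB (cdiff_shift d1) d2) (cdiff_cst (k%:C)^-1 z)).
Qed.

(** [cauchy_lipschitz] is used twice: difference quotients of f with real step k are at most 4M/s on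
    radius s/4, hence Lipschitz with constant 4 (4M/s) / (s/4) = 64 M/s^2. As k -> 0 this bounds the
    variation of f', and the mean value inequality concludes. *)
Lemma taylor_bound (f : C -> C) c (s M : R) l h : 0 < s -> hold f c (4 * s) ->
  (forall z, nm (z - c) <= s -> nm (f z) <= M) -> cdiff f c l -> nm h <= s / 8 ->
  nm (f (c + h) - f c - l * h) <= 64 * M / s ^+ 2 * nm h ^+ 2.
Proof.
move=> s0 hf fM dl hs.
have lip := cauchy_lipschitz s0 (lexx _) hf (fun z zs => fM z (ltac:(by rewrite zs))).
pose K := 64 * M / s ^+ 2.
have M0 : 0 <= M.
  by apply: le_trans (fM c _); [exact: nm_ge0|rewrite subrr nm0 ltW].
have K0 : 0 <= K by rewrite /K divr_ge0 ?mulr_ge0 ?exprn_ge0 // ltW.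
have lip2 z (k : R) : nm (z - c) <= s / 8 -> 0 < k -> k < s / 4 ->
    nm ((f (z + k%:C) - f z) - (f (c + k%:C) - f c)) <= K * nm (z - c) * k.
  move=> zs k0 ks; have nk : nm k%:C = k by rewrite nm_real gtr0_norm.
  have kC : k%:C != 0 by rewrite -nm_gt0 nk.
  have s4 : 0 < s / 4 by lra.
  have hq : hold (fun z => (f (z + k%:C) - f z) / k%:C) c s.
    by apply: hold_diffquot => // u us; apply: hf; lra.
  have := @cauchy_lipschitz _ c (s / 4) s (4 * M / s) s4 (ltac:(lra)) hq.
  have H : forall u, nm (u - c) = s / 4 -> nm ((f (u + k%:C) - f u) / k%:C) <= 4 * M / s.
    move=> u us; rewrite nmM nmV nk ler_pdivrMr //.
    have := lip (u + k%:C) u; rewrite [u + _]addrC addrK nk; apply; last by lra.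
    have -> : k%:C + u - c = (u - c) + k%:C by ring.
    by apply: le_trans (nmD _ _) _; rewrite nk; lra.
  move=> /(_ H z c); rewrite subrr nm0 => /(_ (ltac:(lra)) (ltac:(lra))).
  have -> : (f (z + k%:C) - f z) / k%:C - (f (c + k%:C) - f c) / k%:C =
    ((f (z + k%:C) - f z) - (f (c + k%:C) - f c)) / k%:C by ring.
  rewrite nmM nmV nk ler_pdivrMr //.
  by have -> : 4 * (4 * M / s) / (s / 4) = K by rewrite /K; field; rewrite lt0r_neq0.
have -> : f (c + h) - f c - l * h = (f (c + h) - l * (c + h)) - (f c - l * c) by ring.
rewrite expr2 mulrA; apply: (@mean_value_bound_seg _ (fun u => f u - l * u)) => t /andP[t0 t1].
have th : nm (t%:C * h) <= nm h.
  rewrite nmM nm_real ger0_norm //.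
  by have : t * nm h <= 1 * nm h; [rewrite ler_wpM2r ?nm_ge0|lra].
set z := c + t%:C * h.
have zc : z - c = t%:C * h by rewrite /z; ring.
have [|lz dz] := hf z; first by rewrite zc; lra.
exists (lz - l * 1); first by apply: cdiffB => //; exact: cdiffZ (cdiff_id _).
rewrite mulr1; apply: (@le_trans _ _ (K * nm (z - c))); last by rewrite zc ler_wpM2l.
have s4 : 0 < s / 4 by lra.
apply: (@le_derivative_bound (fun u => f (u + (z - c)) - f u) c _ _ _ s4).
  by apply: cdiffB => //; apply: cdiff_shift; rewrite subrKC.
move=> k k0 ks; have := lip2 z k; rewrite zc => /(_ (ltac:(lra)) k0 ks).
have -> : c + k%:C + t%:C * h = z + k%:C by rewrite /z; ring.
have -> : c + t%:C * h = z by [].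
have -> : f (z + k%:C) - f (c + k%:C) - (f z - f c) = f (z + k%:C) - f z - (f (c + k%:C) - f c) by ring.
by [].
Qed.

(** For each real part and imaginary part the limit is the supremum of the lower bounds v m - T m,
    which keeps the rate T; the factor 2 comes from adding the two parts. *)
Lemma complex_complete (u : nat -> C) (T : nat -> R) :
  (forall m k, (m <= k)%N -> nm (u k - u m) <= T m) ->
  exists l, forall m, nm (l - u m) <= 2 * T m.
Proof.
move=> H.
have T0 m : 0 <= T m by apply: le_trans (H m m (leqnn m)); exact: nm_ge0.
have real_lim (v : nat -> R) : (forall m k, (m <= k)%N -> `|v k - v m| <= T m) ->
    exists x, forall m, `|x - v m| <= T m.
  move=> vT; have cross m k : v m - T m <= v k + T k.
    have [mk|km] := leqP m k.
      by have := vT m k mk; rewrite ler_norml; have := T0 k; lra.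
    by have := vT k m (ltnW km); rewrite ler_norml; have := T0 m; lra.
  exists (sup (range (fun m => v m - T m))) => m.
  have h1 : sup (range (fun m => v m - T m)) <= v m + T m.
    by apply: ge_sup; [exists (v 0%N - T 0%N), 0%N|move=> _ [k _ <-]].
  have h2 : v m - T m <= sup (range (fun m => v m - T m)).
    by apply: ub_le_sup; [exists (v m + T m) => _ [k _ <-]|exists m].
  by rewrite ler_norml; lra.
have [|a aP] := real_lim (fun m => Re (u m)).
  by move=> m k mk; rewrite -ReB; apply: le_trans (nm_Re _) (H m k mk).
have [|b bP] := real_lim (fun m => Im (u m)).
  by move=> m k mk; rewrite -ImB; apply: le_trans (nm_Im _) (H m k mk).
exists (a +i* b) => m; apply: le_trans (nm_ReIm _) _; rewrite ReB ImB /=.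
by have := aP m; have := bP m; lra.
Qed.

Lemma inv_nat_lt (e : R) : 0 < e -> exists m : nat, (m.+1%:R : R)^-1 < e.
Proof.
move=> e0; have e1 : 0 < e^-1 by rewrite invr_gt0.
exists (Num.bound e^-1); rewrite invf_plt ?posrE // -natr1.
by have := archi_boundP (ltW e1); lra.
Qed.

Lemma bounded_on_disc (f : C -> C) c (s : R) :
  (forall z, nm (z - c) <= s -> exists l, cdiff f z l) ->
  exists M : R, forall z, nm (z - c) <= s -> nm (f z) <= M.
Proof.
move=> df; apply: (bounded_on_compact (compact_disc s c)) => z /df[l /cdiff_cont/(_ 1 ltr01)[d d0 dP]].
exists d => //; exists (nm (f z) + 1) => w _ wz; have := dP _ wz; rewrite subrKC => H.
have -> : f w = (f w - f z) + f z by ring.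
by apply: le_trans (nmD _ _) _; lra.
Qed.

(** Weierstrass's theorem. The constant K in the second-order estimate of the approximants is
    independent of m, and [cauchy_lipschitz] for their differences makes the derivatives at c a
    Cauchy sequence, so the estimate passes to the limit. *)
Lemma uniform_limit_cdiff (f : C -> C) c (s : R) : 0 < s ->
  (forall e : R, 0 < e -> exists2 g : C -> C, hold g c (5 * s) &
     forall z : C, nm (z - c) <= s -> nm (g z - f z) <= e) ->
  exists l, cdiff f c l.
Proof.
move=> s0 approx.
have [ei [ei0 ei1 eimono eismall]] : exists ei : nat -> R, [/\ forall m, 0 < ei m,
    forall m, ei m <= 1, forall m k, (m <= k)%N -> ei k <= ei m &
    forall e : R, 0 < e -> exists m, ei m < e].
  exists (fun m => (m.+1%:R)^-1); split => [m|m|m k mk|e /inv_nat_lt //].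
  - by rewrite invr_gt0.
  - by rewrite invf_le1 // ler1n.
  - by rewrite lef_pV2 ?posrE // ler_nat.
have approx' m : exists g : C -> C, hold g c (5 * s) /\
    forall z, nm (z - c) <= s -> nm (g z - f z) <= ei m.
  by have [g h1 h2] := approx _ (ei0 m); exists g.
have [g gP] := choice approx'.
have g1 m : hold (g m) c (5 * s) by have [] := gP m.
have g2 m z : nm (z - c) <= s -> nm (g m z - f z) <= ei m by have [_] := gP m; exact.
have cs z : z = c -> nm (z - c) < 5 * s by move=> ->; rewrite subrr nm0; lra.
have [l lP] := choice (fun m : nat => g1 m c (cs c erefl)).
have [M MP] : exists M : R, forall z, nm (z - c) <= s -> nm (g 0%N z) <= M.
  by apply: bounded_on_disc => z zs; apply: g1; lra.
have gM m z : nm (z - c) <= s -> nm (g m z) <= M + 2.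
  move=> zs; have Hm := g2 m z zs; have := MP z zs; have H0 := g2 0%N z zs.
  have m0 := ei1 0%N; have m1 := ei1 m.
  have -> : g m z = g 0%N z - (g 0%N z - f z) + (g m z - f z) by ring.
  by move=> H; apply: le_trans (nmD _ _) _; apply: le_trans (lerD (nmB _ _) (lexx _)) _; lra.
pose K := 64 * (M + 2) / s ^+ 2.
have tay m h : nm h <= s / 8 -> nm (g m (c + h) - g m c - l m * h) <= K * nm h ^+ 2.
  move=> hs; apply: taylor_bound => //; last exact: gM.
  by move=> z zs; apply: g1; lra.
have [lim limP] : exists lim, forall m, nm (lim - l m) <= 2 * (8 / s * ei m).
  apply: complex_complete => m k mk.
  have s2 : 0 < s / 2 by lra.
  apply: (@le_derivative_bound (fun z => g k z - g m z) c _ _ _ s2).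
    by apply: cdiffB; exact: lP.
  move=> t t0 ts; have nt : nm t%:C = t by rewrite nm_real gtr0_norm.
  have hgk : hold (fun z => g k z - g m z) c (4 * s).
    move=> z zs; have [|l1 d1] := g1 k z; first lra.
    by have [|l2 d2] := g1 m z; [lra|exists (l1 - l2); exact: cdiffB].
  have := @cauchy_lipschitz _ c s (4 * s) (2 * ei m) s0 (lexx _) hgk.
  have H : forall z, nm (z - c) = s -> nm (g k z - g m z) <= 2 * ei m.
    move=> z zs; have -> : g k z - g m z = (g k z - f z) - (g m z - f z) by ring.
    apply: le_trans (nmB _ _) _.
    have km := eimono m k mk.
    by have := g2 k z (ltac:(lra)); have := g2 m z (ltac:(lra)); lra.
  move=> /(_ H (c + t%:C) c); rewrite [c + _]addrC addrK subrr nm0 nt => /(_ (ltac:(lra)) (ltac:(lra))).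
  by have -> : 4 * (2 * ei m) / s = 8 / s * ei m by ring.
exists lim => e e0.
have K0 : 0 <= K.
  rewrite /K divr_ge0 ?exprn_ge0 ?mulr_ge0 ?(ltW s0) //.
  by apply: le_trans (gM 0%N c _); [exact: nm_ge0|rewrite subrr nm0 ltW].
exists (Num.min (s / 8) (e / (K + 1))).
  by rewrite lt_min !divr_gt0 //; lra.
move=> h; rewrite lt_min => /andP[hs he].
apply: (@le_trans _ _ (K * nm h ^+ 2)); last first.
  have : nm h * (K + 1) <= e by have := ltW he; rewrite ler_pdivlMr //; lra.
  move=> H; rewrite expr2 mulrA ler_wpM2r ?nm_ge0 //.
  by have := nm_ge0 h; lra.
apply/ler_addgt0Pr => e1 e10.
pose L := 2 + 16 / s * nm h.
have L0 : 0 < L.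
  by have : 0 <= 16 / s * nm h; [rewrite mulr_ge0 ?nm_ge0 ?divr_ge0 // ltW|rewrite /L; lra].
have [m mP] := eismall _ (divr_gt0 e10 L0).
have {}mP : ei m * L <= e1 by have := ltW mP; rewrite ler_pdivlMr.
have ch : nm (c + h - c) <= s by rewrite [c + h]addrC addrK; lra.
have cc : nm (c - c) <= s by rewrite subrr nm0 ltW.
have -> : f (c + h) - f c - lim * h = (g m (c + h) - g m c - l m * h)
  - (g m (c + h) - f (c + h)) + (g m c - f c) - (lim - l m) * h by ring.
apply: le_trans (nmB _ _) _; apply: le_trans (lerD (nmD _ _) (lexx _)) _.
apply: le_trans (lerD (lerD (nmB _ _) (lexx _)) (lexx _)) _.
have := tay m h (ltW hs); have := g2 m _ ch; have := g2 m _ cc.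
rewrite nmM; have : nm (lim - l m) * nm h <= 2 * (8 / s * ei m) * nm h.
  by rewrite ler_wpM2r ?nm_ge0.
by move: mP; rewrite /L; lra.
Qed.

(** By [taylor_bound] the difference quotients of f approach f' uniformly near c with error K k, so
    f' is a uniform limit of holomorphic functions. *)
Lemma derivative_cdiff (f f' : C -> C) c (r : R) : 0 < r ->
  (forall z, nm (z - c) < r -> cdiff f z (f' z)) -> exists l, cdiff f' c l.
Proof.
move=> r0 df.
(* 16 s leaves room for discs of radius 4 s about points within s of c, and for difference quotients
   holomorphic on radius 5 s. *)
have [s s0 sE] : exists2 s : R, 0 < s & r = 16 * s.
  by exists (r / 16); [rewrite divr_gt0|field].
have [M MP] : exists M : R, forall z, nm (z - c) <= 2 * s -> nm (f z) <= M.
  by apply: bounded_on_disc => z zs; exists (f' z); apply: df; lra.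
apply: (uniform_limit_cdiff s0) => e e0.
pose K := 64 * M / s ^+ 2.
have K0 : 0 <= K.
  rewrite /K divr_ge0 ?exprn_ge0 ?mulr_ge0 ?(ltW s0) //.
  by apply: le_trans (MP c _); [exact: nm_ge0|rewrite subrr nm0; lra].
pose k := Num.min (s / 8) (e / (K + 1)) / 2.
have m0 : 0 < Num.min (s / 8) (e / (K + 1)).
  by rewrite lt_min !divr_gt0 // ltr_wpDl.
have k0 : 0 < k by rewrite divr_gt0.
have [ks ke] : k < s / 8 /\ k < e / (K + 1).
  have : k < Num.min (s / 8) (e / (K + 1)) by rewrite /k; lra.
  by rewrite lt_min => /andP[].
have nk : nm k%:C = k by rewrite nm_real gtr0_norm.
have kC : k%:C != 0 by rewrite -nm_gt0 nk.
exists (fun z => (f (z + k%:C) - f z) / k%:C).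
  by apply: hold_diffquot => // z zs; exists (f' z); apply: df; lra.
move=> z zs.
have -> : (f (z + k%:C) - f z) / k%:C - f' z = (f (z + k%:C) - f z - f' z * k%:C) / k%:C by field.
rewrite nmM nmV nk ler_pdivrMr //.
have := @taylor_bound f z s M (f' z) k%:C s0; rewrite nk => H.
apply: le_trans (H _ _ _ (ltW ks)) _.
- move=> w ws; exists (f' w); apply: df; have -> : w - c = (w - z) + (z - c) by ring.
  by apply: le_lt_trans (nmD _ _) _; lra.
- move=> w ws; apply: MP; have -> : w - c = (w - z) + (z - c) by ring.
  by apply: le_trans (nmD _ _) _; lra.
- by apply: df; lra.
rewrite expr2 mulrA ler_wpM2r //; first exact: ltW.
have : k * (K + 1) <= e by have := ltW ke; rewrite ler_pdivlMr //; lra.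
by rewrite -/K; lra.
Qed.

End CauchyEstimates.

(** * Functions on the punctured disc *)

Section HolomorphicOnDisc.

Variable R : realType.
Local Notation C := R[i].
Local Notation nm := (@Normc.normc R).

Lemma seq_limP (u : nat -> C) (l : C) : seq_lim u l <->
  (forall e : R, 0 < e -> exists N, forall n, (N <= n)%N -> nm (u n - l) <= e).
Proof.
split=> [/cvgrPdist_le H e e0|H].
  have [|N _ NP] := H e%:C; first by rewrite ltcR.
  by exists N => n /NP /=; rewrite normE lecR nmBC.
apply/cvgrPdist_le => e /complex_gt0P[e' e'0 ->]; have [N NP] := H e' e'0.
by exists N => // n /NP; rewrite normE lecR nmBC.
Qed.

Lemma within_cvgP (A : C -> Prop) (f : C -> C) (z : C) :
  (f : C^o -> C^o) @ within A (nbhs (z : C^o)) --> (f z : C^o) <->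
  (forall e : R, 0 < e -> exists2 d : R, 0 < d &
    forall w, A w -> nm (w - z) < d -> nm (f w - f z) <= e).
Proof.
split=> [/cvgrPdist_le H e e0|H].
  have := H e%:C; rewrite ltcR near_withinE => /(_ e0)/nbhs_ballP[d' /= /complex_gt0P[d d0 ->] dP].
  exists d => // w Aw wz; have := dP w; rewrite /ball /= !normE ltcR lecR (nmBC z) (nmBC (f z)).
  by move=> /(_ wz Aw).
apply/cvgrPdist_le => e /complex_gt0P[e' e'0 ->]; have [d d0 dP] := H e' e'0.
rewrite near_withinE; apply/nbhs_ballP; exists d%:C => /=; first by rewrite ltcR.
by move=> w; rewrite /ball /= !normE ltcR lecR (nmBC z) (nmBC (f z)) => wz Aw; exact: dP.
Qed.

Lemma cont_on_eps (A : C -> Prop) (f : C -> C) (z : C) : cont_on A f -> A z ->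
  forall e : R, 0 < e -> exists2 d : R, 0 < d &
    forall w, A w -> nm (w - z) < d -> nm (f w - f z) <= e.
Proof. by move=> /subspace_continuousP cf /cf/within_cvgP. Qed.

Definition in_disc (z : C) := 0 < nm z <= 1.

Definition cont_at (f : C -> C) z := forall e : R, 0 < e -> exists2 d : R, 0 < d &
  forall w, in_disc w -> nm (w - z) < d -> nm (f w - f z) <= e.

(** No condition is put at 0: a Jost solution carries powers z^n of either sign, and its growth at
    the puncture is not prescribed. *)
Definition disc_fun (f : C -> C) :=
  (forall z, 0 < nm z < 1 -> exists l, cdiff f z l) /\
  (forall z, in_disc z -> cont_at f z).

Lemma ext_in_disc_fun (f : C -> C) : ext_in f -> disc_fun f.
Proof.
have D z : in_disc z -> cldisk_in z by rewrite /in_disc /cldisk_in /= normE -ltcR -lecR.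
case=> hf cf; split=> [z z01|z /D Dz e e0].
  by apply/derivable_cdiffP; apply: hf; move: z01; rewrite /disk_in /= normE -!ltcR.
by have [d d0 dP] := cont_on_eps cf Dz e0; exists d => // w /D; exact: dP.
Qed.

Lemma cont_at_ccont (f : C -> C) z : ccont f z -> cont_at f z.
Proof.
move=> cf e /cf[d d0 dP]; exists d => // w _ wz.
by have := dP _ wz; rewrite subrKC.
Qed.

Lemma disc_fun_cdiff (f : C -> C) : (forall z, in_disc z -> exists l, cdiff f z l) -> disc_fun f.
Proof.
move=> df; split=> z z01; first by apply: df; rewrite /in_disc; lra.
by have [l /cdiff_cont] := df z z01; exact: cont_at_ccont.
Qed.

Lemma disc_fun_ext (f g : C -> C) : (forall z, in_disc z -> f z = g z) -> disc_fun f -> disc_fun g.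
Proof.
move=> fg [df cf]; split.
  move=> z /andP[z0 z1]; have [l dl] := df z (ltac:(by rewrite z0)); exists l.
  apply: (@cdiff_ext _ f g z l (Num.min (nm z) (1 - nm z))) => //.
    by rewrite lt_min z0 subr_gt0.
  move=> w; rewrite lt_min => /andP[w0 w1]; apply: fg; rewrite /in_disc.
  by have := nm_triB z w; have := nm_triB w z; rewrite (nmBC z w); lra.
move=> z z01 e /(cf z z01)[d d0 dP]; exists d => // w w01.
by rewrite -!fg //; exact: dP.
Qed.

Lemma disc_funD (f g : C -> C) : disc_fun f -> disc_fun g -> disc_fun (fun z => f z + g z).
Proof.
move=> [df cf] [dg cg]; split=> z z01.
  by have [l dl] := df z z01; have [m dm] := dg z z01; exists (l + m); exact: cdiffD.
move/within_cvgP: (cf z z01) => cf'; move/within_cvgP: (cg z z01) => cg'.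
exact/within_cvgP/(cvgD cf' cg').
Qed.

Lemma disc_funM (f g : C -> C) : disc_fun f -> disc_fun g -> disc_fun (fun z => f z * g z).
Proof.
move=> [df cf] [dg cg]; split=> z z01.
  by have [l dl] := df z z01; have [m dm] := dg z z01; eexists; exact: cdiffM dl dm.
move/within_cvgP: (cf z z01) => cf'; move/within_cvgP: (cg z z01) => cg'.
exact/within_cvgP/(cvgM cf' cg').
Qed.

Lemma disc_fun_cst (c : C) : disc_fun (fun=> c).
Proof. by apply: disc_fun_cdiff => z _; exists 0; exact: cdiff_cst. Qed.

Lemma disc_fun_id : disc_fun id.
Proof. by apply: disc_fun_cdiff => z _; exists 1; exact: cdiff_id. Qed.

Lemma in_disc_neq0 z : in_disc z -> z != 0.
Proof. by case/andP; rewrite nm_gt0. Qed.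

Lemma disc_fun_inv : disc_fun (fun z => z^-1).
Proof.
by apply: disc_fun_cdiff => z /in_disc_neq0 z0; eexists; exact: cdiff_inv.
Qed.

Lemma disc_funN (f : C -> C) : disc_fun f -> disc_fun (fun z => - f z).
Proof.
move=> /(disc_funM (disc_fun_cst (-1))); apply: disc_fun_ext => z _.
by rewrite mulN1r.
Qed.

Lemma disc_funB (f g : C -> C) : disc_fun f -> disc_fun g -> disc_fun (fun z => f z - g z).
Proof. by move=> hf hg; exact: disc_funD hf (disc_funN hg). Qed.

Lemma disc_funX (f : C -> C) n : disc_fun f -> disc_fun (fun z => f z ^+ n).
Proof.
move=> hf; elim: n => [|n IH].
  by apply: (disc_fun_ext _ (disc_fun_cst 1)) => z _; rewrite expr0.
by apply: (disc_fun_ext _ (disc_funM hf IH)) => z _; rewrite exprS.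
Qed.

Lemma disc_funXz n : disc_fun (fun z => z ^ (n : int)).
Proof.
case: n => n; first by apply: (disc_funX n disc_fun_id).
apply: (disc_fun_ext _ (disc_funX n.+1 disc_fun_inv)) => z _.
by rewrite NegzE -exprnN exprVn.
Qed.

(** Once derivatives are differentiable, [max_principle_taylor2] applies to holomorphic functions
    themselves and on sets other than discs, in particular on annuli. *)
Lemma hold_taylor2 (f : C -> C) z (r : R) : 0 < r -> hold f z r -> taylor2 f z.
Proof.
move=> r0 hf; pose f' w : C := derive1 (f : C^o -> C^o) w.
have df w : nm (w - z) < r -> cdiff f w (f' w).
  by move=> /hf[l dl]; rewrite /f' (cdiff_derive1 dl).
have [l dl] := derivative_cdiff r0 df.
exact: taylor2_primitive r0 df dl.
Qed.

(* The maximum principle for z^k f on a <= |z| <= 1 gives |f z| <= M (a/|z|)^k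
   for every k. *)
Lemma disc_fun_unique (f : C -> C) : disc_fun f -> (forall z, nm z = 1 -> f z = 0) ->
  forall z, in_disc z -> f z = 0.
Proof.
move=> hf f0 w /andP[w0 w1].
pose a := nm w / 2; have a0 : 0 < a by rewrite divr_gt0.
have aw : a < nm w by rewrite /a; lra.
pose K (z : C) := is_true (a <= nm (z - 0) <= 1).
have cK : is_compact K by exact: compact_annulus.
have KP z : K z -> a <= nm z <= 1 by rewrite /K subr0.
have Kd z : K z -> in_disc z by move=> /KP /andP[? ?]; rewrite /in_disc; lra.
have [M0 MP0] : exists M, forall z, K z -> nm (f z) <= M.
  apply: (bounded_on_compact cK) => z Kz; have [d d0 dP] := hf.2 z (Kd z Kz) 1 ltr01.
  exists d => //; exists (nm (f z) + 1) => u Ku uz; have := dP u (Kd u Ku) uz.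
  have -> : nm (f u) = nm ((f u - f z) + f z) by rewrite subrK.
  by have := nmD (f u - f z) (f z); lra.
pose M := `|M0|.
have MP z : K z -> nm (f z) <= M by move=> /MP0; have := ler_norm M0; rewrite -/M; lra.
have M_0 : 0 <= M by rewrite /M normr_ge0.
have bound k : nm (f w) * nm w ^+ k <= M * a ^+ k.
  rewrite -nmX -nmM.
  have hg : disc_fun (fun z => f z * z ^+ k) by apply: disc_funM => //; exact: disc_funX disc_fun_id.
  apply: (@max_principle_taylor2 _ K (fun z => f z * z ^+ k) (M * a ^+ k) cK).
  - by rewrite mulr_ge0 // exprn_ge0 // ltW.
  - move=> z Kz e e0; have [d d0 dP] := hg.2 z (Kd z Kz) e e0.
    by exists d => // u Ku; apply: dP; exact: Kd.
  - move=> z Kz; have /andP[za z1] := KP z Kz.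
    have [z1'|z1'] := ltP (nm z) 1; last first.
      left; rewrite f0 ?mul0r ?nm0; last by apply/eqP; rewrite eq_le z1 z1'.
      by rewrite mulr_ge0 // exprn_ge0 // ltW.
    have [za'|za'] := ltP a (nm z); last first.
      left; have -> : a = nm z by apply/eqP; rewrite eq_le za za'.
      by rewrite nmM nmX ler_wpM2r ?exprn_ge0 ?nm_ge0 // MP.
    right; pose r := Num.min (nm z - a) (1 - nm z).
    have r0 : 0 < r by rewrite lt_min !subr_gt0 za'.
    have near u : nm (u - z) < r -> a < nm u < 1.
      rewrite lt_min => /andP[u1 u2].
      by have := nm_triB u z; have := nm_triB z u; rewrite (nmBC z); lra.
    split; first by exists r => // u /near; rewrite /K subr0; lra.
    apply: (hold_taylor2 r0) => u /near ua; apply: hg.1; lra.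
  - by rewrite /K subr0 w1 ltW.
apply/eqP; rewrite -nm_eq0; apply/negPn/negP => fw.
have fw0 : 0 < nm (f w) by rewrite lt_def fw nm_ge0.
have := le_of_geometric_bound fw0 (nm_ge0 w) (ltW a0) bound.
by lra.
Qed.

Lemma disc_fun_eq (f g : C -> C) : disc_fun f -> disc_fun g ->
  (forall z, nm z = 1 -> f z = g z) -> forall z, in_disc z -> f z = g z.
Proof.
move=> hf hg fg z z01; apply/eqP; rewrite -subr_eq0; apply/eqP.
apply: (disc_fun_unique (disc_funB hf hg)) => // u /fg ->.
by rewrite subrr.
Qed.

(** The exterior problem is moved to the punctured disc by z -> 1/z; the point at infinity becomes
    the puncture. *)
Lemma ext_out_disc_fun (f : C -> C) : ext_out f -> disc_fun (fun z => f z^-1).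
Proof.
have D z : in_disc z -> cldisk_out z^-1.
  by move=> /andP[z0 z1]; rewrite /cldisk_out /= normE -[X in X <= _]/(1%:C) lecR nmV invf_ge1.
case=> hf cf; split=> [z /andP[z0 z1]|z z01 e e0].
  have zn : z != 0 by rewrite -nm_gt0.
  have [|l dl] := (derivable_cdiffP f z^-1).1; last exact: cdiff_comp (cdiff_inv zn) dl.
  by apply: hf; rewrite /disk_out /= normE -[X in X < _]/(1%:C) ltcR nmV invf_gt1.
have [d d0 dP] := cont_on_eps cf (D _ z01) e0.
have [d1 d10 D1] := cdiff_cont (cdiff_inv (in_disc_neq0 z01)) (divr_gt0 d0 (ltr0Sn _ 1)).
exists d1 => // w w01 wz; apply: dP; first exact: D.
by have := D1 _ wz; rewrite subrKC; lra.
Qed.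

Lemma cderiv_holo (D : C -> Prop) (f : C -> C) :
  (forall z, D z -> exists2 r : R, 0 < r & forall w, nm (w - z) < r -> D w) ->
  (forall z, D z -> exists l, cdiff f z l) ->
  forall k z, D z -> cdiff (cderivn k f) z (cderivn k.+1 f z).
Proof.
move=> oD df.
have d0 : forall z, D z -> cdiff f z (cderivn 1 f z).
  move=> z /df[l dl]; rewrite /cderivn derive1nS derive1n0.
  by rewrite (cdiff_derive1 dl).
elim=> [|k IH] z Dz; first by have := d0 z Dz; rewrite {2}/cderivn derive1n0.
have [r r0 rD] := oD z Dz.
have [l dl] := @derivative_cdiff _ (cderivn k f) (cderivn k.+1 f) z r r0 (fun w wz => IH w (rD w wz)).
by rewrite {2}/cderivn derive1nS (cdiff_derive1 dl).
Qed.

Lemma cderivn_ext (D : C -> Prop) (f g : C -> C) :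
  (forall z, D z -> exists2 r : R, 0 < r & forall w, nm (w - z) < r -> D w) ->
  (forall z, D z -> exists l, cdiff f z l) ->
  (forall z, D z -> f z = g z) ->
  forall k z, D z -> cderivn k f z = cderivn k g z.
Proof.
move=> oD df fg; elim=> [|k IH] z Dz; first by rewrite /cderivn !derive1n0 fg.
have dk := cderiv_holo oD df k Dz.
have [r r0 rD] := oD z Dz.
have := cdiff_ext r0 (fun w wz => IH w (rD w wz)) dk.
move=> /cdiff_derive1 H; rewrite [in RHS]/cderivn derive1nS.
exact: esym H.
Qed.

End HolomorphicOnDisc.

(** * Summable perturbations *)

Section Summability.
Variable R : realType.
Local Notation C := R[i].
Local Notation nm := (@Normc.normc R).

(** A summable weight with telescoping sums. The sum from n on is at most 1/(n + 1), which serves as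
    the rate of convergence throughout. *)
Definition wt (n : nat) : R := (n.+1%:R * n.+2%:R)^-1.

Lemma wtE n : wt n = (n.+1%:R)^-1 - (n.+2%:R)^-1.
Proof.
have H (a : R) : 0 < a -> (a * (a + 1))^-1 = a^-1 - (a + 1)^-1.
  by move=> a0; field; apply/andP; split; rewrite lt0r_neq0 //; lra.
by rewrite /wt -(natr1 n.+1) H.
Qed.

Lemma wt_le1 n : wt n <= 1.
Proof. by rewrite invf_le1 ?mulr_gt0 // -natrM ler1n muln_gt0. Qed.

Lemma sum_wt n k : \sum_(i < k) wt (n + i) = (n.+1%:R)^-1 - ((n + k).+1%:R)^-1.
Proof.
elim: k => [|k IH]; first by rewrite big_ord0 addn0 subrr.
by rewrite big_ord_recr /= IH wtE addnS; ring.
Qed.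

Lemma sum_wt_le n k : \sum_(i < k) wt (n + i) <= (n.+1%:R)^-1.
Proof. by rewrite sum_wt gerBl invr_ge0. Qed.

Lemma invS_le1 n : (n.+1%:R : R)^-1 <= 1.
Proof. by rewrite invf_le1 // ler1n. Qed.

Lemma invS_small (K e : R) : 0 <= K -> 0 < e -> exists N : nat, forall n, (N <= n)%N ->
  K * (n.+1%:R)^-1 <= e.
Proof.
move=> K0 e0; have K1 : 0 < K + 1 by lra.
have [N NP] := inv_nat_lt (divr_gt0 e0 K1).
exists N => n Nn.
have le1 : (n.+1%:R : R)^-1 <= (N.+1%:R)^-1 by rewrite lef_pV2 ?posrE // ler_nat.
have : (n.+1%:R : R)^-1 <= e / (K + 1) by apply: le_trans le1 (ltW NP).
have : 0 <= (n.+1%:R : R)^-1 by rewrite invr_ge0.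
rewrite ler_pdivlMr //; move: ((n.+1%:R : R)^-1) => t t0 H.
by lra.
Qed.

Lemma bounded_from (x : nat -> R) (N : nat) (K : R) : (forall n, (N <= n)%N -> x n <= K) ->
  exists2 L : R, 0 <= L & forall n, x n <= L.
Proof.
elim: N K => [|N IH] K H.
  exists `|K|; first by rewrite normr_ge0.
  by move=> n; apply: le_trans (H n _) (ler_norm K).
apply: (IH (Num.max K (x N))) => n; rewrite leq_eqVlt => /orP[/eqP <-|Nn].
  by rewrite le_max lexx orbT.
by rewrite le_max H.
Qed.

Definition decays (x : nat -> R) := exists2 K : R, 0 <= K & forall n, x n <= K * wt n.

Lemma decaysD x y : decays x -> decays y -> decays (fun n => x n + y n).
Proof.
move=> [K K0 H] [L L0 G]; exists (K + L); first by lra.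
by move=> n; have := H n; have := G n; lra.
Qed.

Lemma decaysZ (c : R) x : 0 <= c -> decays x -> decays (fun n => c * x n).
Proof.
move=> c0 [K K0 H]; exists (c * K); first by rewrite mulr_ge0.
by move=> n; rewrite -mulrA ler_wpM2l.
Qed.

Lemma decays_le x y : (forall n, x n <= y n) -> decays y -> decays x.
Proof. by move=> xy [K K0 H]; exists K => // n; exact: le_trans (xy n) (H n). Qed.

Lemma decays_seq (f : int -> C) (g : nat -> int) :
  (forall n, `|g n|%N = n) ->
  (forall k, seq_lim (fun n => (g n)%:~R ^+ k * f (g n)) 0) ->
  decays (fun n => nm (f (g n))).
Proof.
move=> gn H.
have [N NP] := (seq_limP _ _).1 (H 2%N) 1 ltr01.
(* Eventually n^2 |f| <= 1, and (n + 1)(n + 2) <= 6 n^2 for n >= 1: hence the 6 and the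
   [maxn N 1]. *)
have [|L L0 LP] := @bounded_from (fun n => nm (f (g n)) * (n.+1%:R * n.+2%:R)) (maxn N 1) 6.
  move=> n; rewrite geq_max => /andP[/NP h n1]; rewrite subr0 nmM nmX in h.
  have gE : nm (g n)%:~R = n%:R.
    have -> : ((g n)%:~R : C) = ((g n)%:~R : R)%:C by rewrite rmorph_int.
    by rewrite nm_real -intr_norm -abszE gn.
  rewrite gE in h.
  have n1' : 1 <= n%:R :> R by rewrite ler1n.
  rewrite -(natr1 n.+1) -(natr1 n).
  have f0 := nm_ge0 (f (g n)).
  have P1 : (n%:R + 1) * (n%:R + 1 + 1) <= 6 * n%:R ^+ 2 :> R by nra.
  apply: le_trans (ler_wpM2l f0 P1) _.
  by lra.
exists L => // n; rewrite /wt ler_pdivlMr ?mulr_gt0 //; exact: LP.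
Qed.

Lemma decays_pinf (f : int -> C) : rapid_decay f -> decays (fun n => nm (f n%:Z)).
Proof. by move=> H; apply: decays_seq => // k; have [] := H k. Qed.

Lemma decays_minf (f : int -> C) : rapid_decay f -> decays (fun n => nm (f (- n%:Z))).
Proof.
move=> H; apply: (@decays_seq f (fun n => - n%:Z)) => [n|k]; first by rewrite abszN.
by have [] := H k.
Qed.

Lemma decays_shift (x : nat -> R) : (forall n, 0 <= x n) -> decays x -> decays (fun n => x n.+1).
Proof.
move=> x0 [K K0 H]; exists K => // n; apply: le_trans (H n.+1) _.
rewrite ler_wpM2l // /wt lef_pV2 ?posrE ?mulr_gt0 //.
by rewrite -!natrM ler_nat; lia.
Qed.

Lemma decays_unshift (x : nat -> R) : decays (fun n => x n.+1) -> decays x.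
Proof.
move=> [K K0 H].
have [|L L0 LP] := @bounded_from (fun n => x n * (n.+1%:R * n.+2%:R)) 1 (3 * K).
  case=> // n _; have W0 : 0 <= n.+2%:R * n.+3%:R :> R by rewrite mulr_ge0.
  apply: le_trans (ler_wpM2r W0 (H n)) _.
  have -> : K * wt n * (n.+2%:R * n.+3%:R) = K * (n.+3%:R / n.+1%:R).
    rewrite /wt; field; rewrite -?natr1; have n0 : 0 <= n%:R :> R by [].
    by apply/andP; split; rewrite lt0r_neq0 //; lra.
  rewrite mulrC ler_wpM2r // ler_pdivrMr //.
  by rewrite -natrM ler_nat; lia.
exists L => // n; rewrite /wt ler_pdivlMr ?mulr_gt0 //; exact: LP.
Qed.

Lemma decays_bounded (x : nat -> R) : decays x -> exists2 L : R, 0 <= L & forall n, x n <= L.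
Proof.
move=> [K K0 H]; exists K => // n; apply: le_trans (H n) _.
by rewrite ler_piMr // wt_le1.
Qed.

Lemma decaysM (x y : nat -> R) : (forall n, 0 <= x n) -> (forall n, 0 <= y n) ->
  decays x -> decays y -> decays (fun n => x n * y n).
Proof.
move=> x0 y0 dx /decays_bounded[L L0 yL].
apply: decays_le (decaysZ L0 dx) => n.
by rewrite mulrC ler_wpM2r.
Qed.

Lemma prod1D_bounded (K : R) (x : nat -> R) n k : 0 <= K -> (forall n, 0 <= x n) ->
  (forall n, x n <= K * wt n) -> \prod_(i < k) (1 + x (n + i)%N) <= expR K.
Proof.
move=> K0 x0 xK.
apply: (@le_trans _ _ (expR (\sum_(i < k) x (n + i)%N))).
  elim: k => [|k IH]; first by rewrite !big_ord0 expR0.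
  rewrite !big_ord_recr /= expRD; apply: ler_pM => //.
  - by apply: prodr_ge0 => i _; rewrite addr_ge0.
  - by rewrite addr_ge0.
  - exact: expR_ge1Dx.
rewrite ler_expR; apply: (@le_trans _ _ (\sum_(i < k) K * wt (n + i))).
  by apply: ler_sum => i _.
rewrite -mulr_sumr -[leRHS]mulr1 ler_wpM2l //.
exact: le_trans (sum_wt_le n k) (invS_le1 n).
Qed.

(** The form of the bound makes the induction close: since 1 + S/(1 - S) = 1/(1 - S), the step is (1
    + y)/(1 - S) <= 1/(1 - S - y). *)
Lemma prod1D_dist (y : nat -> C) k (s : R) : s < 1 -> \sum_(i < k) nm (y i) <= s ->
  nm (\prod_(i < k) (1 + y i) - 1) <= s / (1 - s).
Proof.
move=> s1 ys.
have s0 : 0 <= s by apply: le_trans ys; apply: sumr_ge0 => i _; exact: nm_ge0.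
pose S k := \sum_(i < k) nm (y i).
have S0 j : 0 <= S j by apply: sumr_ge0 => i _; exact: nm_ge0.
have H : forall j, S j <= s -> nm (\prod_(i < j) (1 + y i) - 1) <= S j / (1 - S j).
  elim=> [|j IH] js; first by rewrite /S !big_ord0 subrr nm0 mul0r.
  rewrite /S !big_ord_recr /= -/(S j) in js *; have yj := nm_ge0 (y j).
  set p := \prod_(i < j) _; have Sj : S j <= s by lra.
  have -> : p * (1 + y j) - 1 = (p - 1) * (1 + y j) + y j by ring.
  apply: le_trans (nmD _ _) _; rewrite nmM.
  have h1 : nm (1 + y j) <= 1 + nm (y j) by have := nmD 1 (y j); rewrite nm1.
  have d1 : 0 < 1 - S j by lra.
  have d2 : 0 < 1 - (S j + nm (y j)) by lra.
  have := ler_pM (nm_ge0 _) (nm_ge0 _) (IH Sj) h1.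
  move=> H; apply: le_trans (lerD H (lexx _)) _.
  rewrite ler_pdivlMr //.
  have -> : (S j / (1 - S j) * (1 + nm (y j)) + nm (y j)) * (1 - (S j + nm (y j))) =
    (S j * (1 + nm (y j)) + nm (y j) * (1 - S j)) * (1 - (S j + nm (y j))) / (1 - S j).
    by field; rewrite lt0r_neq0.
  rewrite ler_pdivrMr //; have Sj0 := S0 j.
  have : 0 <= nm (y j) * nm (y j) by rewrite mulr_ge0.
  by nra.
apply: le_trans (H k ys) _; have {}ys : S k <= s by [].
have d0 : 0 < 1 - S k by lra.
by rewrite ler_pdivlMr ?subr_gt0 // mulrAC ler_pdivrMr //; lra.
Qed.

Lemma seq_lim_uniq (u : nat -> C) (l m : C) : seq_lim u l -> seq_lim u m -> l = m.
Proof. exact: (@cvg_unique _ (@norm_hausdorff _ C^o)). Qed.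

Lemma seq_lim_ext (u v : nat -> C) (l : C) (N : nat) : (forall n, (N <= n)%N -> u n = v n) ->
  seq_lim u l -> seq_lim v l.
Proof.
move=> uv /seq_limP ul; apply/seq_limP => e /ul[M MP]; exists (maxn N M) => n.
by rewrite geq_max => /andP[Nn Mn]; rewrite -uv ?MP.
Qed.

Lemma seq_lim_cst (c : C) : seq_lim (fun=> c) c.
Proof. exact: cvg_cst. Qed.
Arguments seq_lim_cst c : clear implicits.

Lemma seq_limD (u v : nat -> C) (l m : C) : seq_lim u l -> seq_lim v m ->
  seq_lim (fun n => u n + v n) (l + m).
Proof. exact: cvgD. Qed.

Lemma seq_lim0_bounded (u v : nat -> C) (B : R) : 0 <= B -> (forall n, nm (u n) <= B) ->
  seq_lim v 0 -> seq_lim (fun n => u n * v n) 0.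
Proof.
move=> B0 uB /seq_limP v0; apply/seq_limP => e e0.
have B1 : 0 < B + 1 by lra.
have [N NP] := v0 _ (divr_gt0 e0 B1); exists N => n /NP; rewrite !subr0 nmM => h.
have := ler_pM (nm_ge0 _) (nm_ge0 _) (uB n) h.
have : B * (e / (B + 1)) <= e by rewrite mulrCA ger_pMr // ler_pdivrMr // mul1r; lra.
by move=> h1 h2; exact: le_trans h1.
Qed.

Lemma seq_limM (u v : nat -> C) (l m : C) : seq_lim u l -> seq_lim v m ->
  seq_lim (fun n => u n * v n) (l * m).
Proof. exact: cvgM. Qed.

Lemma seq_limV (u : nat -> C) (l : C) : l != 0 -> seq_lim u l -> seq_lim (fun n => (u n)^-1) l^-1.
Proof. exact: cvgV. Qed.

Lemma seq_lim_le (u : nat -> C) (l : C) (B : R) (N : nat) : seq_lim u l ->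
  (forall n, (N <= n)%N -> nm (u n) <= B) -> nm l <= B.
Proof.
move=> /seq_limP ul uB; apply/ler_addgt0Pr => e /ul[M MP].
have h1 := MP (maxn N M) (leq_maxr _ _); have h2 := uB (maxn N M) (leq_maxl _ _).
have -> : l = u (maxn N M) - (u (maxn N M) - l) by ring.
by apply: le_trans (nmB _ _) _; lra.
Qed.

Lemma decays_lim0 (u : nat -> C) : decays (fun n => nm (u n)) -> seq_lim u 0.
Proof.
move=> [K K0 H]; apply/seq_limP => e e0; have [N NP] := invS_small K0 e0.
exists N => n /NP h; rewrite subr0; apply: le_trans (H n) _; apply: le_trans h.
rewrite ler_wpM2l // wtE gerBl invr_ge0.
by [].
Qed.

End Summability.
Arguments seq_lim_cst {R} c.

(** * Infinite products: recursion, limits and non-vanishing *)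

Section InfiniteProduct.
Variable R : realType.
Local Notation C := R[i].
Local Notation nm := (@Normc.normc R).
Variables (y P : int -> C) (Pinf : C).
Hypothesis y1 : forall n, 1 + y n != 0.
Hypothesis yp : decays (fun n => nm (y n%:Z)).
Hypothesis ym : decays (fun n => nm (y (- n%:Z))).
Hypothesis Plim : forall n, seq_lim (fun m => \prod_(i < m) (1 + y (n - i%:Z))) (P n).
Hypothesis Pinflim : lim_pinf P Pinf.

Lemma infprod_rec n : P n = (1 + y n) * P (n - 1).
Proof.
refine (seq_lim_uniq (@Plim n) _).
have := seq_limM (seq_lim_cst (1 + y n)) (@Plim (n - 1)).
move=> /seq_limP H; apply/seq_limP => e /H[N NP]; exists N.+1 => -[//|m] Nm.
rewrite big_ord_recl subr0.
have -> : \prod_(i < m) (1 + y (n - (lift ord0 i)%:Z)) = \prod_(i < m) (1 + y (n - 1 - i%:Z)).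
  by apply: eq_bigr => i _; congr (1 + y _); rewrite lift0 -addn1 PoszD; ring.
exact: NP.
Qed.

Lemma infprod_minf_dist : exists2 K : R, 0 <= K & forall n : nat, K * (n.+1%:R)^-1 <= 1 / 2 ->
  nm (P (- n%:Z) - 1) <= 2 * (K * (n.+1%:R)^-1).
Proof.
have [K K0 KP] := ym; exists K => // n Kn.
have s0 : 0 <= K * (n.+1%:R)^-1 by rewrite mulr_ge0 ?invr_ge0.
set s := K * _ in Kn s0 *.
have b j : nm (\prod_(i < j) (1 + y (- n%:Z - i%:Z)) - 1) <= s / (1 - s).
  apply: (@prod1D_dist R (fun i => y (- n%:Z - i%:Z))); first by lra.
  apply: (@le_trans _ _ (\sum_(i < j) K * wt R (n + i))).
    by apply: ler_sum => i _; have := KP (n + i)%N; rewrite PoszD opprD.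
  by rewrite -mulr_sumr ler_wpM2l // sum_wt_le.
have l1 : seq_lim (fun m => \prod_(i < m) (1 + y (- n%:Z - i%:Z)) - 1) (P (- n%:Z) - 1).
  exact: seq_limD (@Plim _) (seq_lim_cst _).
apply: le_trans (seq_lim_le l1 (fun m _ => b m) (N := 0%N)) _.
clearbody s.
have s1 : 0 < 1 - s by lra.
have s2 : 0 <= 1 - 2 * s by lra.
by rewrite ler_pdivrMr //; have := mulr_ge0 s0 s2; lra.
Qed.

Lemma infprod_minf : lim_minf P 1.
Proof.
have [K K0 KP] := infprod_minf_dist; apply/seq_limP => e e0.
have [N1 H1] := @invS_small R K (1 / 2) K0 (ltac:(lra)).
have [N2 H2] := @invS_small R K (e / 2) K0 (ltac:(lra)).
exists (maxn N1 N2) => n; rewrite geq_max => /andP[/H1 h1 /H2 h2].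
apply: le_trans (KP n h1) _; have -> : e = 2 * (e / 2) by field.
by rewrite ler_pM2l.
Qed.

(** Far to the left P n is within 1/2 of 1, and the recursion then multiplies by factors 1 + y n,
    none of which is 0. *)
Lemma infprod_neq0 n : P n != 0.
Proof.
have [K K0 KP] := infprod_minf_dist.
have [N H] := @invS_small R K (1 / 4) K0 (ltac:(lra)).
have far k : (N <= k)%N -> P (- k%:Z) != 0.
  have q12 : 1 / 4 <= 1 / 2 :> R by lra.
  move=> /H h; have := KP k (le_trans h q12); apply: contraTneq => ->.
  rewrite sub0r nmN nm1 -ltNge; apply: (@le_lt_trans _ _ (2 * (1 / 4))); last by lra.
  by rewrite ler_pM2l.
have up m k : P m != 0 -> P (m + k%:Z) != 0.
  move=> m0; elim: k => [|k IH]; first by rewrite addr0.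
  rewrite infprod_rec mulf_neq0 //.
  by have -> : m + k.+1%:Z - 1 = m + k%:Z by rewrite -addn1 PoszD; ring.
have [nN|Nn] := leP n (- N%:Z).
  have E : n = - (absz n)%:Z by lia.
  by rewrite E; apply: far; lia.
have E : n = - N%:Z + (absz (n + N%:Z))%:Z by lia.
by rewrite E; exact: up (far N (leqnn N)).
Qed.

(** Beyond N the tail products stay within (1/4)/(3/4) = 1/3 of 1, so their limit Pinf / P N is not
    0. *)
Lemma infprod_pinf_neq0 : Pinf != 0.
Proof.
have [K K0 KP] := yp.
have [N H] := @invS_small R K (1 / 4) K0 (ltac:(lra)).
have ratio k : P (N%:Z + k%:Z) = P N%:Z * \prod_(i < k) (1 + y (N + i).+1%:Z).
  elim: k => [|k IH]; first by rewrite big_ord0 addr0 mulr1.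
  rewrite infprod_rec big_ord_recr /= mulrA -IH mulrC.
  by congr (P _ * (1 + y _)); lia.
have b k : nm (\prod_(i < k) (1 + y (N + i).+1%:Z) - 1) <= (1 / 4) / (1 - 1 / 4).
  apply: (@prod1D_dist R (fun i => y (N + i).+1%:Z)); first by lra.
  apply: (@le_trans _ _ (\sum_(i < k) K * wt R (N.+1 + i))).
    by apply: ler_sum => i _; have := KP (N.+1 + i)%N; rewrite addSn.
  rewrite -mulr_sumr; apply: le_trans (H N.+1 (leqnSn N)).
  by rewrite ler_wpM2l // sum_wt_le.
have PN := infprod_neq0 N%:Z.
have L : seq_lim (fun k => P (N%:Z + k%:Z)) Pinf.
  move/seq_limP: Pinflim => PL; apply/seq_limP => e /PL[M MP]; exists M => n Mn.
  by have := MP (N + n)%N; rewrite PoszD; apply; lia.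
have L2 : seq_lim (fun k => \prod_(i < k) (1 + y (N + i).+1%:Z) - 1) ((P N%:Z)^-1 * Pinf - 1).
  have := seq_limD (seq_limM (seq_lim_cst (P N%:Z)^-1) L) (seq_lim_cst (-1)).
  by apply: (@seq_lim_ext _ _ _ _ 0%N) => k _; rewrite ratio mulKf.
have := seq_lim_le L2 (fun m _ => b m) (N := 0%N).
apply: contraTneq => ->; rewrite mulr0 sub0r nmN nm1 -ltNge.
by rewrite ltr_pdivrMr; lra.
Qed.

End InfiniteProduct.

(** * Growth and uniqueness of solutions of (Q) on the circle *)

Section TransferBounds.
Variable R : realType.
Local Notation C := R[i].
Local Notation nm := (@Normc.normc R).
Implicit Types (v w : C * C) (M : mat2 R).

Definition vnorm v := nm v.1 + nm v.2.

Lemma vnorm_ge0 v : 0 <= vnorm v.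
Proof. by rewrite addr_ge0 ?nm_ge0. Qed.

Lemma vnormD v w : vnorm (v + w) <= vnorm v + vnorm w.
Proof.
have h1 := nmD v.1 w.1; have h2 := nmD v.2 w.2.
by rewrite /vnorm /=; lra.
Qed.

Lemma vnormN v : vnorm (- v) = vnorm v.
Proof. by rewrite /vnorm /= !nmN. Qed.

Lemma vnormB v w : vnorm (v - w) <= vnorm v + vnorm w.
Proof. by have := vnormD v (- w); rewrite vnormN. Qed.

Lemma vnormBC v w : vnorm (v - w) = vnorm (w - v).
Proof. by rewrite -vnormN opprB. Qed.

Lemma vnorm_eq0 v : vnorm v <= 0 -> v = 0.
Proof.
move=> v0; have a := nm_ge0 v.1; have b := nm_ge0 v.2.
have /eqP : nm v.1 = 0 by rewrite /vnorm in v0; lra.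
have /eqP : nm v.2 = 0 by rewrite /vnorm in v0; lra.
by rewrite !nm_eq0; case: v v0 a b => ? ? /= _ _ _ /eqP -> /eqP ->.
Qed.

Lemma vnorm0 : vnorm 0 = 0.
Proof. by apply/eqP; rewrite paddr_eq0 ?nm_ge0 // !nm_eq0 !eqxx. Qed.

Lemma mulvB M v w : mulv M (v - w) = mulv M v - mulv M w.
Proof.
apply/eqP; rewrite xpair_eqE /=; apply/andP; split; apply/eqP; ring.
Qed.

(** Discrete Gronwall inequality; the constant [expR K] does not depend on n and k because the
    weights sum to at most 1. *)
Lemma growth_down (x e : nat -> R) (K : R) : 0 <= K -> (forall n, 0 <= e n) ->
  (forall n, e n <= K * wt R n) -> (forall n, 0 <= x n) ->
  (forall n, x n <= (1 + e n) * x n.+1) -> forall n k, x n <= expR K * x (n + k)%N.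
Proof.
move=> K0 e0 eK x0 H n k.
have : x n <= \prod_(i < k) (1 + e (n + i)%N) * x (n + k)%N.
  elim: k => [|k IH]; first by rewrite big_ord0 mul1r addn0.
  rewrite big_ord_recr /= addnS; apply: le_trans IH _.
  rewrite -mulrA ler_wpM2l //.
  by apply: prodr_ge0 => i _; rewrite addr_ge0.
move=> h; apply: le_trans h _; rewrite ler_wpM2r //.
exact: prod1D_bounded.
Qed.

Lemma growth_up (x e : nat -> R) (K : R) : 0 <= K -> (forall n, 0 <= e n) ->
  (forall n, e n <= K * wt R n) -> (forall n, 0 <= x n) ->
  (forall n, x n.+1 <= (1 + e n) * x n) -> forall n k, x (n + k)%N <= expR K * x n.
Proof.
move=> K0 e0 eK x0 H n k.
have : x (n + k)%N <= \prod_(i < k) (1 + e (n + i)%N) * x n.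
  elim: k => [|k IH]; first by rewrite big_ord0 mul1r addn0.
  rewrite big_ord_recr /= addnS; apply: le_trans (H _) _.
  by rewrite [leRHS]mulrAC mulrC ler_wpM2r // addr_ge0.
move=> h; apply: le_trans h _; rewrite ler_wpM2r //.
exact: prod1D_bounded.
Qed.

Lemma growth_zero (x e : nat -> R) : decays e -> (forall n, 0 <= e n) -> (forall n, 0 <= x n) ->
  (forall n, x n <= (1 + e n) * x n.+1) ->
  (forall d : R, 0 < d -> exists N, forall n, (N <= n)%N -> x n <= d) -> forall n, x n = 0.
Proof.
move=> [K K0 eK] e0 x0 H x_0 n; apply/eqP; rewrite eq_le x0 andbT.
apply/ler_addgt0Pr => d d0; rewrite add0r.
have [N NP] := x_0 _ (divr_gt0 d0 (expR_gt0 K)).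
apply: le_trans (growth_down K0 e0 eK x0 H n N) _.
rewrite mulrC -ler_pdivlMr ?expR_gt0 //; apply: NP.
exact: leq_addl.
Qed.

Variables (q r : int -> C).

Definition eps n : R := 2 * nm (q n) + 2 * nm (r n) + 2 * (nm (q n) * nm (r n)).

Lemma eps_ge0 n : 0 <= eps n.
Proof.
have a := nm_ge0 (q n); have b := nm_ge0 (r n).
by rewrite /eps !addr_ge0 ?mulr_ge0.
Qed.

Lemma decays_eps_pinf : rapid_decay q -> rapid_decay r -> decays (fun n => eps n%:Z).
Proof.
move=> /decays_pinf dq /decays_pinf dr.
apply: decaysD; first by apply: decaysD; exact: decaysZ.
by apply: decaysZ => //; apply: decaysM => // n; exact: nm_ge0.
Qed.

Lemma decays_eps_minf : rapid_decay q -> rapid_decay r -> decays (fun n => eps (- n%:Z)).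
Proof.
move=> /decays_minf dq /decays_minf dr.
apply: decaysD; first by apply: decaysD; exact: decaysZ.
by apply: decaysZ => //; apply: decaysM => // n; exact: nm_ge0.
Qed.

(** One estimate for four matrices: the transfer matrix of (Q) on the circle, its inverse, and the
    rescaled matrices that serve for psi and psib on the whole disc. *)
Lemma step_bound (s t a b c d f v1 v2 : C) :
  nm a <= 1 -> nm b <= 2 -> nm c <= 2 -> nm d <= 1 -> nm f <= 2 ->
  nm (a * v1 + b * s * v2) + nm (c * t * v1 + (d + f * s * t) * v2) <=
  (1 + (2 * nm s + 2 * nm t + 2 * (nm s * nm t))) * (nm v1 + nm v2).
Proof.
move=> a1 b2 c2 d1 f2.
have q0 := nm_ge0 s; have r0 := nm_ge0 t.
have v10 := nm_ge0 v1; have v20 := nm_ge0 v2.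
have h1 : nm (a * v1 + b * s * v2) <= 1 * nm v1 + 2 * nm s * nm v2.
  apply: le_trans (nmD _ _) _; rewrite !nmM; apply: lerD; first by rewrite ler_wpM2r.
  by rewrite ler_wpM2r // ler_wpM2r.
have h2 : nm (c * t * v1 + (d + f * s * t) * v2) <=
    2 * nm t * nm v1 + (1 + 2 * nm s * nm t) * nm v2.
  apply: le_trans (nmD _ _) _; rewrite !nmM; apply: lerD.
    by rewrite ler_wpM2r // ler_wpM2r.
  rewrite ler_wpM2r //; apply: le_trans (nmD _ _) _; apply: lerD => //.
  by rewrite !nmM ler_wpM2r // ler_wpM2r.
apply: le_trans (lerD h1 h2) _.
set Q := nm s in q0 *; set S := nm t in r0 *.
set x := nm v1 in v10 *; set y := nm v2 in v20 *.
have := mulr_ge0 q0 v10; have := mulr_ge0 r0 v20.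
have := mulr_ge0 (mulr_ge0 q0 r0) v10.
by lra.
Qed.

Lemma nm_unit_inv z : nm z = 1 -> nm z^-1 = 1.
Proof. by move=> z1; rewrite nmV z1 invr1. Qed.

Lemma unit_neq0 z : nm z = 1 -> z != 0.
Proof. by move=> z1; rewrite -nm_gt0 z1. Qed.

Lemma nm_unit_diff z : nm z = 1 -> nm (z - z^-1) <= 2.
Proof.
by move=> z1; apply: le_trans (nmB _ _) _; rewrite nm_unit_inv // z1.
Qed.

Lemma transferQ_bound n z v : nm z = 1 ->
  vnorm (mulv (transferQ q r n z) v) <= (1 + eps n) * vnorm v.
Proof.
move=> z1; apply: step_bound; rewrite ?nm_unit_inv ?nm_unit_diff ?z1 //.
by rewrite ler1n.
Qed.

Lemma transferQ_inv_bound n z v : nm z = 1 ->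
  vnorm v <= (1 + eps n) * vnorm (mulv (transferQ q r n z) v).
Proof.
move=> z1; have z0 := unit_neq0 z1.
set w := mulv _ v.
(* The transfer matrix has determinant 1, and its inverse has the same shape with the components,
   and q and r, exchanged. *)
have v1 : v.1 = - (z - z^-1) * q n * w.2 + (z^-1 + (z - z^-1) * r n * q n) * w.1.
  by rewrite /w /=; field.
have v2 : v.2 = z * w.2 + - z * r n * w.1.
  by rewrite /w /=; field.
have -> : (1 + eps n) * vnorm w =
  (1 + (2 * nm (r n) + 2 * nm (q n) + 2 * (nm (r n) * nm (q n)))) * (nm w.2 + nm w.1).
  by rewrite /eps /vnorm; ring.
rewrite {1}/vnorm v1 v2 [leLHS]addrC; apply: step_bound; rewrite ?nmN ?nm_unit_inv ?nm_unit_diff ?z1 //.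
by rewrite ler1n.
Qed.

Hypothesis dq : rapid_decay q.
Hypothesis dr : rapid_decay r.

Lemma solQ_half_unique z (X : nat -> C * C) : nm z = 1 ->
  (forall n : nat, X n = mulv (transferQ q r n%:Z z) (X n.+1)) ->
  seq_lim (fun n => (X n).1) 0 -> seq_lim (fun n => (X n).2) 0 -> forall n, X n = 0.
Proof.
move=> z1 HX /seq_limP X1 /seq_limP X2 n; apply: vnorm_eq0.
suff H : vnorm (X n) = 0 by rewrite H.
apply: (@growth_zero (fun n => vnorm (X n)) (fun n => eps n%:Z)) => //.
- exact: decays_eps_pinf.
- by move=> k; exact: eps_ge0.
- by move=> k; exact: vnorm_ge0.
- by move=> k; rewrite {1}HX; exact: transferQ_bound.
- move=> d d0; have [N1 H1] := X1 _ (divr_gt0 d0 (ltr0Sn _ 1)).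
  have [N2 H2] := X2 _ (divr_gt0 d0 (ltr0Sn _ 1)).
  exists (maxn N1 N2) => k; rewrite geq_max => /andP[/H1 h1 /H2 h2].
  by rewrite !subr0 in h1 h2; rewrite /vnorm; lra.
Qed.

Lemma solQ_zero z (X : int -> C * C) m : nm z = 1 -> is_sol (transferQ q r) z X ->
  X m = 0 -> forall n, X n = 0.
Proof.
move=> z1 sX Xm.
have step n : X n = 0 <-> X (n + 1) = 0.
  split=> H; last first.
    rewrite sX H; apply/eqP; rewrite xpair_eqE /= !mulr0 addr0 eqxx //.
  apply: vnorm_eq0; have := transferQ_inv_bound n (X (n + 1)) z1; rewrite -sX H.
  by rewrite vnorm0 mulr0.
have up k n : X n = 0 <-> X (n + k%:Z) = 0.
  elim: k => [|k IH]; first by rewrite addr0.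
  apply: (iff_trans IH); have -> : n + k.+1%:Z = n + k%:Z + 1 by rewrite -addn1 PoszD addrA.
  exact: step.
move=> n; have [mn|mn] := leP m n.
  have E : n = m + (absz (n - m))%:Z by lia.
  by rewrite E; exact: (up _ m).1 Xm.
have E : n + (absz (m - n))%:Z = m by lia.
by apply: (up (absz (m - n)) n).2; rewrite E.
Qed.

Lemma solQ_zero_pinf z (X : int -> C * C) : nm z = 1 -> is_sol (transferQ q r) z X ->
  lim_pinf (fun n => (X n).1) 0 -> lim_pinf (fun n => (X n).2) 0 -> forall n, X n = 0.
Proof.
move=> z1 sX X1 X2; apply: (@solQ_zero z X 0) => //.
apply: (@solQ_half_unique z (fun n => X n%:Z) z1 _ X1 X2 0%N) => n.
by rewrite sX -addn1 PoszD.
Qed.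

Lemma solQ_zero_minf z (X : int -> C * C) : nm z = 1 -> is_sol (transferQ q r) z X ->
  lim_minf (fun n => (X n).1) 0 -> lim_minf (fun n => (X n).2) 0 -> forall n, X n = 0.
Proof.
move=> z1 sX /seq_limP X1 /seq_limP X2; apply: (@solQ_zero z X 0) => //.
apply: vnorm_eq0; suff H : vnorm (X 0) = 0 by rewrite H.
apply: (@growth_zero (fun n => vnorm (X (- n%:Z))) (fun n => eps (- n.+1%:Z)) _ _ _ _ _ 0%N).
- apply: (@decays_shift _ (fun n => eps (- n%:Z))); last exact: decays_eps_minf.
  by move=> k; exact: eps_ge0.
- by move=> k; exact: eps_ge0.
- by move=> k; exact: vnorm_ge0.
- move=> k; have := transferQ_inv_bound (- k.+1%:Z) (X (- k%:Z)) z1.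
  by rewrite [X (- k.+1%:Z)]sX (_ : - k.+1%:Z + 1 = - k%:Z) //; lia.
- move=> d d0; have [N1 H1] := X1 _ (divr_gt0 d0 (ltr0Sn _ 1)).
  have [N2 H2] := X2 _ (divr_gt0 d0 (ltr0Sn _ 1)).
  exists (maxn N1 N2) => k; rewrite geq_max => /andP[/H1 h1 /H2 h2].
  by rewrite !subr0 in h1 h2; rewrite /vnorm; lra.
Qed.

(** Controls at +oo the component of phi about which the definition of the transmission coefficient
    says nothing. *)
Lemma solQ_bounded z (X : int -> C * C) : nm z = 1 -> is_sol (transferQ q r) z X ->
  exists2 B : R, 0 <= B & forall n : nat, nm (X n%:Z).1 <= B /\ nm (X n%:Z).2 <= B.
Proof.
move=> z1 sX; have [K K0 KP] := decays_eps_pinf dq dr.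
exists (expR K * vnorm (X 0)); first by rewrite mulr_ge0 ?expR_ge0 ?vnorm_ge0.
move=> n; have H : vnorm (X n%:Z) <= expR K * vnorm (X 0).
  have := @growth_up (fun n => vnorm (X n%:Z)) (fun n => eps n%:Z) K K0
    (fun k => eps_ge0 k%:Z) KP (fun k => vnorm_ge0 _) _ 0%N n.
  rewrite add0n; apply => k.
  have := transferQ_inv_bound k%:Z (X k.+1%:Z) z1.
  by rewrite [X k%:Z]sX (_ : k%:Z + 1 = k.+1%:Z) //; lia.
have := nm_ge0 (X n%:Z).1; have := nm_ge0 (X n%:Z).2; move: H; rewrite /vnorm.
by split; lra.
Qed.

End TransferBounds.

(** * The Jost solutions of (Q) do not vanish *)

Section JostConstruction.
Variable R : realType.
Local Notation C := R[i].
Local Notation nm := (@Normc.normc R).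

Lemma disc_fun_uniform_limit (f : C -> C) :
  (forall e : R, 0 < e -> exists2 g, disc_fun g & forall z, in_disc z -> nm (g z - f z) <= e) ->
  disc_fun f.
Proof.
move=> approx; split.
  move=> z /andP[z0 z1]; pose s := Num.min (nm z) (1 - nm z) / 5.
  have m0 : 0 < Num.min (nm z) (1 - nm z) by rewrite lt_min z0 subr_gt0.
  have s0 : 0 < s by rewrite divr_gt0.
  have sE : 5 * s = Num.min (nm z) (1 - nm z) by rewrite /s; field.
  have near w : nm (w - z) < 5 * s -> 0 < nm w < 1.
    rewrite sE lt_min => /andP[w1 w2].
    by have := nm_triB z w; have := nm_triB w z; rewrite (nmBC z w); lra.
  apply: (uniform_limit_cdiff s0) => e /approx[g hg gf]; exists g.
    by move=> w /near w01; exact: hg.1.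
  by move=> w ws; apply: gf; have := near w (ltac:(lra)); rewrite /in_disc; lra.
move=> z z01 e e0; have e3 : 0 < e / 3 by lra.
have [g hg gf] := approx _ e3; have [d d0 dP] := hg.2 z z01 _ e3.
exists d => // w w01 wz.
have -> : f w - f z = (g w - g z) - (g w - f w) + (g z - f z) by ring.
apply: le_trans (nmD _ _) _; apply: le_trans (lerD (nmB _ _) (lexx _)) _.
by have := gf w w01; have := gf z z01; have := dP w w01 wz; lra.
Qed.

Variables (P : nat -> C -> mat2 R) (e0 : C * C) (e : nat -> R).
Hypothesis decay_e : decays e.
Hypothesis e_ge0 : forall n, 0 <= e n.
Hypothesis P11 : forall n, disc_fun (fun z => (P n z).1.1).
Hypothesis P12 : forall n, disc_fun (fun z => (P n z).1.2).
Hypothesis P21 : forall n, disc_fun (fun z => (P n z).2.1).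
Hypothesis P22 : forall n, disc_fun (fun z => (P n z).2.2).
Hypothesis P_bound : forall n z v, in_disc z -> vnorm (mulv (P n z) v) <= (1 + e n) * vnorm v.
Hypothesis P_e0 : forall n z, in_disc z -> vnorm (mulv (P n z) e0 - e0) <= e n.

(** The solution started from [e0] at index n + k, that is the product P n ... P (n + k - 1) applied
    to [e0]. *)
Fixpoint iterP (k n : nat) (z : C) : C * C :=
  if k is k'.+1 then mulv (P n z) (iterP k' n.+1 z) else e0.

Lemma iterP_disc_fun k n :
  disc_fun (fun z => (iterP k n z).1) /\ disc_fun (fun z => (iterP k n z).2).
Proof.
elim: k n => [|k IH] n; first by split; exact: disc_fun_cst.
have [I1 I2] := IH n.+1.
by split => /=; apply: disc_funD; apply: disc_funM.
Qed.

Lemma iterP_cauchy : exists2 K : R, 0 <= K & forall n k j z, in_disc z -> (k <= j)%N ->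
  vnorm (iterP j n z - iterP k n z) <= K * ((n + k).+1%:R)^-1.
Proof.
have [K K0 KP] := decay_e; exists (expR K * K); first by rewrite mulr_ge0 ?expR_ge0.
(* Consecutive iterates differ by a product of k matrices applied to P (n + k) e0 - e0, which [P_e0]
   bounds by e (n + k). *)
have step k n z : in_disc z -> vnorm (iterP k.+1 n z - iterP k n z) <=
    \prod_(i < k) (1 + e (n + i)%N) * e (n + k)%N.
  move=> z01; elim: k n => [|k IH] n.
    by rewrite big_ord0 mul1r addn0; exact: P_e0.
  rewrite [iterP k.+2 n z]/= [iterP k.+1 n z]/= -mulvB.
  apply: le_trans (P_bound _ _ z01) _; rewrite big_ord_recl addn0 -mulrA.
  apply: ler_wpM2l; first by rewrite addr_ge0.
  apply: le_trans (IH n.+1) _; rewrite addSnnS.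
  rewrite (eq_bigr (fun i : 'I_k => 1 + e (n + lift ord0 i)%N)) // => i _.
  by rewrite lift0 addSnnS.
have step' k n z : in_disc z -> vnorm (iterP k.+1 n z - iterP k n z) <= expR K * K * wt R (n + k).
  move=> z01; apply: le_trans (step k n z z01) _; rewrite -mulrA; apply: ler_pM => //.
  - by apply: prodr_ge0 => i _; rewrite addr_ge0.
  - exact: prod1D_bounded.
move=> n k j z z01 kj.
have H i : vnorm (iterP (k + i) n z - iterP k n z) <= expR K * K * \sum_(l < i) wt R (n + k + l).
  elim: i => [|i IH]; first by rewrite addn0 subrr vnorm0 big_ord0 mulr0.
  rewrite big_ord_recr /= mulrDr addnS.
  have -> : iterP (k + i).+1 n z - iterP k n z = (iterP (k + i).+1 n z - iterP (k + i) n z)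
    + (iterP (k + i) n z - iterP k n z) by rewrite addrA subrK.
  apply: le_trans (vnormD _ _) _; rewrite addrC; apply: lerD => //.
  by rewrite -addnA; exact: step'.
have := H (j - k)%N; rewrite subnKC // => h; apply: le_trans h _.
rewrite ler_wpM2l ?sum_wt_le // mulr_ge0 ?expR_ge0 //.
Qed.

Lemma jost_construction : exists y : nat -> C -> C * C,
  [/\ forall n, disc_fun (fun z => (y n z).1) /\ disc_fun (fun z => (y n z).2),
      forall n z, in_disc z -> y n z = mulv (P n z) (y n.+1 z) &
      exists2 K : R, 0 <= K & forall n z, in_disc z -> vnorm (y n z - e0) <= K * (n.+1%:R)^-1].
Proof.
have [K K0 KP] := iterP_cauchy.
have lim n z : exists l : C * C, in_disc z ->
    forall k, vnorm (l - iterP k n z) <= 4 * (K * ((n + k).+1%:R)^-1).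
  have [z01|nz] := pselect (in_disc z); last by exists 0.
  have [|l1 L1] := @complex_complete R (fun k => (iterP k n z).1) (fun k => K * ((n + k).+1%:R)^-1).
    move=> k j kj; apply: le_trans (KP n k j z z01 kj).
    by rewrite /vnorm lerDl nm_ge0.
  have [|l2 L2] := @complex_complete R (fun k => (iterP k n z).2) (fun k => K * ((n + k).+1%:R)^-1).
    move=> k j kj; apply: le_trans (KP n k j z z01 kj).
    by rewrite /vnorm lerDr nm_ge0.
  exists (l1, l2) => _ k; have := L1 k; have := L2 k; rewrite /vnorm /=.
  by move: (K * _) => t; lra.
have [y yP] := choice (fun nz : nat * C => lim nz.1 nz.2).
exists (fun n z => y (n, z)); split.
- have approx n (d : R) : 0 < d -> exists k, forall z, in_disc z -> vnorm (y (n, z) - iterP k n z) <= d.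
    move=> d0; have [k kP] := @invS_small R (4 * K) d (mulr_ge0 (ler0n _ 4) K0) d0.
    exists k => z z01; apply: le_trans (yP (n, z) z01 k) _; rewrite mulrA.
    by apply: kP; exact: leq_addl.
  move=> n; split; apply: disc_fun_uniform_limit => d /(approx n)[k kP].
    exists (fun z => (iterP k n z).1); first by have [] := iterP_disc_fun k n.
    move=> z /kP; rewrite vnormBC; apply: le_trans.
    by rewrite /vnorm lerDl nm_ge0.
  exists (fun z => (iterP k n z).2); first by have [] := iterP_disc_fun k n.
  move=> z /kP; rewrite vnormBC; apply: le_trans.
  by rewrite /vnorm lerDr nm_ge0.
- move=> n z z01; apply/eqP; rewrite -subr_eq0; apply/eqP; apply: vnorm_eq0.
  apply/ler_addgt0Pr => d d0; rewrite add0r.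
  pose L := 4 * K * (2 + e n).
  have L0 : 0 <= L by rewrite /L !mulr_ge0 // addr_ge0.
  have [k kP] := invS_small L0 d0; have := kP (n + k.+1)%N (ltac:(lia)).
  have h1 := yP (n, z) z01 k.+1; have h2 := yP (n.+1, z) z01 k.
  rewrite /= addSnnS in h2; rewrite /= in h1.
  have -> : y (n, z) - mulv (P n z) (y (n.+1, z)) = (y (n, z) - mulv (P n z) (iterP k n.+1 z))
     - mulv (P n z) (y (n.+1, z) - iterP k n.+1 z).
    by rewrite mulvB opprB addrA subrK.
  move=> H; apply: le_trans (vnormB _ _) _; apply: le_trans H.
  have h3 := P_bound n (y (n.+1, z) - iterP k n.+1 z) z01.
  have h4 := ler_wpM2l (addr_ge0 ler01 (e_ge0 n)) h2.
  move: h1 h3 h4; rewrite /L; move: (_^-1) => t h1 h3 h4.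
  by lra.
(* The case k = 0 of the limit estimate, in which [iterP] is [e0] itself. *)
- exists (4 * K); first by rewrite mulr_ge0.
  by move=> n z z01; have := yP (n, z) z01 0%N; rewrite /= addn0 mulrA.
Qed.

End JostConstruction.

Section JostNonvanishing.
Variable R : realType.
Local Notation C := R[i].
Local Notation nm := (@Normc.normc R).
Variables (q r : int -> C).
Hypothesis dq : rapid_decay q.
Hypothesis dr : rapid_decay r.

Lemma normc_lt_disc (z : C) : 0 < `|z| < 1 -> 0 < nm z < 1.
Proof. by rewrite normE -!ltcR. Qed.

Lemma normc_eq1 (z : C) : nm z = 1 -> `|z| = 1.
Proof. by rewrite normE => ->. Qed.

Lemma unit_exprz (z : C) n : nm z = 1 -> nm (z ^ n) = 1.
Proof. by move=> z1; rewrite nmXz z1 exp1rz. Qed.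

Lemma nm_le2B (a b : C) : nm a <= 1 -> nm b <= 1 -> nm (a - b) <= 2.
Proof. by move=> a1 b1; apply: le_trans (nmB _ _) _; lra. Qed.

(* psi n z is z^n times the uniform limit y of the polynomials of
   jost_construction, and y stays close to e0 on the whole disc. *)
Lemma jost_nonzero (sigma : C -> C) (P : nat -> C -> mat2 R) (e0 : C * C)
    (psi : nat -> C -> C * C) : vnorm e0 = 1 ->
  (forall z, nm z = 1 -> nm (sigma z) = 1) ->
  (forall n, disc_fun (fun z => (P n z).1.1)) -> (forall n, disc_fun (fun z => (P n z).1.2)) ->
  (forall n, disc_fun (fun z => (P n z).2.1)) -> (forall n, disc_fun (fun z => (P n z).2.2)) ->
  (forall n z v, in_disc z -> vnorm (mulv (P n z) v) <= (1 + eps q r n%:Z) * vnorm v) ->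
  (forall n z, in_disc z -> vnorm (mulv (P n z) e0 - e0) <= eps q r n%:Z) ->
  (forall n z v, nm z = 1 -> mulv (P n z) v = (z * (mulv (transferQ q r n%:Z (sigma z)) v).1,
                                               z * (mulv (transferQ q r n%:Z (sigma z)) v).2)) ->
  (forall n, disc_fun (fun z => (psi n z).1)) -> (forall n, disc_fun (fun z => (psi n z).2)) ->
  (forall n z, nm z = 1 -> psi n z = mulv (transferQ q r n%:Z (sigma z)) (psi n.+1 z)) ->
  (forall z, nm z = 1 -> seq_lim (fun n => (psi n z).1 * z ^ (- n%:Z) - e0.1) 0) ->
  (forall z, nm z = 1 -> seq_lim (fun n => (psi n z).2 * z ^ (- n%:Z) - e0.2) 0) ->
  forall w, 0 < nm w < 1 -> exists n, psi n w <> 0.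
Proof.
move=> e01 sig1 P11 P12 P21 P22 Pb Pe0 PQ psi1 psi2 sol l1 l2 w w01.
have [y [yd ystep [K K0 yK]]] := jost_construction (decays_eps_pinf dq dr)
  (fun n => eps_ge0 q r n%:Z) P11 P12 P21 P22 Pb Pe0.
pose g (n : nat) (z : C) : C * C := (z ^ n%:Z * (y n z).1, z ^ n%:Z * (y n z).2).
have gcircle n z : nm z = 1 -> psi n z = g n z.
  move=> z1; have z01 : in_disc z by rewrite /in_disc z1 ltr01 lexx.
  have z0 := unit_neq0 z1.
  apply/eqP; rewrite -subr_eq0; apply/eqP.
  have zk k : nm (z ^ k) <= 1 by rewrite unit_exprz.
  have zz k : z ^ k%:Z * z ^ (- k%:Z) = 1 by rewrite -expfzDr // subrr expr0z.
  have small (x : nat -> C) : (forall k, nm (x k) <= vnorm (y k z - e0)) -> seq_lim x 0.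
    move=> xy; apply/seq_limP => d d0; have [N NP] := invS_small K0 d0; exists N => k /NP h.
    by rewrite subr0; apply: le_trans h; apply: le_trans (xy k) (yK k z z01).
  have y1 : seq_lim (fun k => (y k z).1 - e0.1) 0.
    by apply: small => k; rewrite /vnorm lerDl nm_ge0.
  have y2 : seq_lim (fun k => (y k z).2 - e0.2) 0.
    by apply: small => k; rewrite /vnorm lerDr nm_ge0.
  have diff (a b : nat -> C) (c : C) : seq_lim (fun k => a k * z ^ (- k%:Z) - c) 0 ->
      seq_lim (fun k => b k - c) 0 -> seq_lim (fun k => a k - z ^ k%:Z * b k) 0.
    move=> ha hb; have hb' := seq_limM (seq_lim_cst (-1)) hb; rewrite mulr0 in hb'.
    have l0 := seq_limD ha hb'; rewrite addr0 in l0.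
    have := seq_lim0_bounded ler01 (fun k => zk k%:Z) l0.
    apply: (@seq_lim_ext _ _ _ _ 0%N) => k _.
    have -> : z ^ k%:Z * (a k * z ^ (- k%:Z) - c + -1 * (b k - c)) =
      a k * (z ^ k%:Z * z ^ (- k%:Z)) - z ^ k%:Z * b k by ring.
    by rewrite zz mulr1.
  apply: (@solQ_half_unique R q r dq dr (sigma z) (fun k : nat => psi k z - g k z) (sig1 z z1)).
  - move=> k; rewrite mulvB [psi k z]sol //; congr (_ - _); rewrite /g [y k z]ystep // PQ //.
    have zS : z ^ k.+1%:Z = z * z ^ k%:Z by rewrite -exprSz.
    by apply/eqP; rewrite xpair_eqE /= zS; apply/andP; split; apply/eqP; ring.
  - exact: diff (l1 z z1) y1.
  - exact: diff (l2 z z1) y2.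
have win : in_disc w by rewrite /in_disc; lra.
have gdisc n : psi n w = g n w.
  have [y1 y2] := yd n.
  have h1 : (psi n w).1 = (g n w).1.
    apply: (disc_fun_eq (psi1 n) (disc_funM (@disc_funXz R n%:Z) y1)) => // z z1.
    by rewrite gcircle.
  have h2 : (psi n w).2 = (g n w).2.
    apply: (disc_fun_eq (psi2 n) (disc_funM (@disc_funXz R n%:Z) y2)) => // z z1.
    by rewrite gcircle.
  by rewrite [LHS]surjective_pairing h1 h2.
have [N NP] := @invS_small R K (1 / 2) K0 (ltac:(lra)).
exists N; rewrite gdisc => gN.
have wN := expfz_neq0 N%:Z (in_disc_neq0 win).
have y1 : (y N w).1 = 0.
  by move/(congr1 fst) : gN => /= /eqP; rewrite mulf_eq0 (negbTE wN) => /eqP.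
have y2 : (y N w).2 = 0.
  by move/(congr1 snd) : gN => /= /eqP; rewrite mulf_eq0 (negbTE wN) => /eqP.
have := le_trans (yK N w win) (NP N (leqnn N)); rewrite /vnorm /= y1 y2 !sub0r !nmN.
by rewrite -/(vnorm e0) e01; lra.
Qed.

Lemma psi_nonzero (psi : int -> C -> C * C) : jost_psi (transferQ q r) psi ->
  forall w, 0 < `|w| < 1 -> exists n, psi n w <> 0.
Proof.
move=> [psi_circle psi_ext] w /normc_lt_disc w01.
(* z times the transfer matrix, which governs the recursion of z^-n psi_n. Being polynomial in z^2,
   it is bounded up to the puncture. *)
pose P (n : nat) (z : C) : mat2 R := ((z ^+ 2, (z ^+ 2 - 1) * q n%:Z),
  (z ^+ 2 * r n%:Z, 1 + (z ^+ 2 - 1) * q n%:Z * r n%:Z)).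
have sq z : in_disc z -> nm (z ^+ 2) <= 1.
  by case/andP=> _ z1; rewrite nmX exprn_ile1 ?nm_ge0.
have d2 : disc_fun (fun z : C => z ^+ 2) by exact: disc_funX (disc_fun_id R).
have d21 : disc_fun (fun z : C => z ^+ 2 - 1) by exact: disc_funB d2 (disc_fun_cst 1).
have cst (c : C) : disc_fun (fun=> c) by exact: disc_fun_cst.
have one2 : (1 : R) <= 2 by rewrite ler1n.
have H := @jost_nonzero id P (0, 1) (fun n => psi n%:Z).
have [n pn] : exists n : nat, psi n%:Z w <> 0; last by exists n%:Z.
apply: H => //.
- by rewrite -[LHS]/(nm 0 + nm 1) nm0 nm1 add0r.
- by move=> n; exact: disc_funM d21 (cst _).
- by move=> n; exact: disc_funM d2 (cst _).
- by move=> n; apply: disc_funD (cst 1) _; exact: disc_funM (disc_funM d21 (cst _)) (cst _).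
- move=> n z v z01; have z2 := sq z z01; apply: step_bound => //.
  + by apply: nm_le2B => //; rewrite nm1.
  + exact: le_trans z2 one2.
  + by rewrite nm1.
  + by apply: nm_le2B => //; rewrite nm1.
- move=> n z z01; have z2 : nm (z ^+ 2 - 1) <= 2 by apply: nm_le2B; rewrite ?nm1 ?sq.
  have -> : mulv (P n z) (0, 1) - (0, 1) = ((z ^+ 2 - 1) * q n%:Z, (z ^+ 2 - 1) * (q n%:Z * r n%:Z)).
    by apply/eqP; rewrite xpair_eqE /=; apply/andP; split; apply/eqP; ring.
  rewrite /vnorm /= !nmM /eps; have q0 := nm_ge0 (q n%:Z); have r0 := nm_ge0 (r n%:Z).
  have := ler_wpM2r q0 z2; have := ler_wpM2r (mulr_ge0 q0 r0) z2.
  by lra.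
- move=> n z v z1; have z0 := unit_neq0 z1.
  by apply/eqP; rewrite xpair_eqE /=; apply/andP; split; apply/eqP; field.
- by move=> n; have [/ext_in_disc_fun] := psi_ext n%:Z.
- by move=> n; have [_ /ext_in_disc_fun] := psi_ext n%:Z.
- move=> n z z1; have [sol _ _] := psi_circle z (normc_eq1 z1).
  by rewrite [LHS]sol (_ : n%:Z + 1 = n.+1%:Z) //; lia.
- move=> z z1; have [_ l1 _] := psi_circle z (normc_eq1 z1).
  have zk k : nm (z ^ (- k%:Z)) <= 1 by rewrite unit_exprz.
  have := seq_lim0_bounded ler01 zk l1.
  by apply: (@seq_lim_ext _ _ _ _ 0%N) => k _ /=; rewrite subr0 mulrC.
- move=> z z1; have [_ _ l2] := psi_circle z (normc_eq1 z1).
  by have := seq_limD l2 (seq_lim_cst (-1)); rewrite subrr.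
Qed.

Lemma psib_nonzero (psib : int -> C -> C * C) : jost_psib (transferQ q r) psib ->
  forall w, 1 < `|w| -> exists n, psib n w <> 0.
Proof.
move=> [psi_circle psi_ext] w w1.
have {}w1 : 1 < nm w by rewrite -ltcR.
have w0 : w != 0 by rewrite -nm_gt0; exact: lt_trans w1.
(* z times the transfer matrix at 1/z: in this variable psib_n behaves like z^n (1, 0). *)
pose P (n : nat) (z : C) : mat2 R := ((1, (1 - z ^+ 2) * q n%:Z),
  (1 * r n%:Z, z ^+ 2 + (1 - z ^+ 2) * q n%:Z * r n%:Z)).
have sq z : in_disc z -> nm (z ^+ 2) <= 1.
  by case/andP=> _ z1; rewrite nmX exprn_ile1 ?nm_ge0.
have d2 : disc_fun (fun z : C => z ^+ 2) by exact: disc_funX (disc_fun_id R).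
have d21 : disc_fun (fun z : C => 1 - z ^+ 2) by exact: disc_funB (disc_fun_cst 1) d2.
have cst (c : C) : disc_fun (fun=> c) by exact: disc_fun_cst.
have one2 : (1 : R) <= 2 by rewrite ler1n.
have := @jost_nonzero (fun z => z^-1) P (1, 0) (fun n z => psib n%:Z z^-1).
move=> H; have [n pn] : exists n : nat, psib n%:Z (w^-1)^-1 <> 0; last first.
  by exists n%:Z; rewrite invrK in pn.
apply: H.
- by rewrite -[LHS]/(nm 1 + nm 0) nm0 nm1 addr0.
- by move=> z z1; exact: nm_unit_inv.
- by move=> n; exact: cst.
- by move=> n; exact: disc_funM d21 (cst _).
- by move=> n; exact: disc_funM (cst 1) (cst _).
- by move=> n; apply: disc_funD d2 _; exact: disc_funM (disc_funM d21 (cst _)) (cst _).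
- move=> n z v z01; have z2 := sq z z01; apply: step_bound => //; rewrite ?nm1 //.
  + by apply: nm_le2B => //; rewrite nm1.
  + by apply: nm_le2B => //; rewrite nm1.
- move=> n z z01.
  have -> : mulv (P n z) (1, 0) - (1, 0) = (0, r n%:Z).
    by apply/eqP; rewrite xpair_eqE /=; apply/andP; split; apply/eqP; ring.
  rewrite -[leLHS]/(nm 0 + nm (r n%:Z)) nm0 /eps; have q0 := nm_ge0 (q n%:Z); have r0 := nm_ge0 (r n%:Z).
  by have := mulr_ge0 q0 r0; lra.
- move=> n z v z1; have z0 := unit_neq0 z1.
  by apply/eqP; rewrite xpair_eqE /=; apply/andP; split; apply/eqP; field.
- by move=> n; have [/ext_out_disc_fun] := psi_ext n%:Z.
- by move=> n; have [_ /ext_out_disc_fun] := psi_ext n%:Z.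
- move=> n z z1; have [sol _ _] := psi_circle z^-1 (normc_eq1 (nm_unit_inv z1)).
  by rewrite [LHS]sol (_ : n%:Z + 1 = n.+1%:Z) //; lia.
- move=> z z1; have [_ l1 _] := psi_circle z^-1 (normc_eq1 (nm_unit_inv z1)).
  have := seq_limD l1 (seq_lim_cst (-1)); rewrite subrr.
  by apply: (@seq_lim_ext _ _ _ _ 0%N) => k _ /=; rewrite exprz_inv.
- move=> z z1; have [_ _ l2] := psi_circle z^-1 (normc_eq1 (nm_unit_inv z1)).
  have zk k : nm (z ^ (- k%:Z)) <= 1 by rewrite unit_exprz.
  have := seq_lim0_bounded ler01 zk l2.
  by apply: (@seq_lim_ext _ _ _ _ 0%N) => k _ /=; rewrite subr0 mulrC.
by rewrite nmV invr_gt0 invf_lt1 ?w1 ?andbT //; exact: lt_trans w1.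
Qed.

End JostNonvanishing.

(** * Jets as Toeplitz matrices *)

Section Toeplitz.
Variable F : fieldType.
Implicit Types (s t : nat -> F).

Definition convol s t k := \sum_(l < k.+1) s (k - l)%N * t l.

(** The truncated power series with coefficients s, evaluated at the nilpotent shift; products
    become convolutions and all such matrices commute. *)
Definition toep m s : 'M[F]_m := \matrix_(i < m, k < m) (if (i <= k)%N then s (k - i)%N else 0).

Lemma convolC s t k : convol s t k = convol t s k.
Proof.
rewrite /convol (reindex_inj rev_ord_inj) /=; apply: eq_bigr => l _.
by rewrite subSS subKn 1?mulrC // -ltnS.
Qed.

Lemma toepM m s t : toep m s *m toep m t = toep m (convol s t).
Proof.
apply/matrixP => i k; rewrite !mxE.
pose f (j : nat) := (if (i <= j)%N then s (j - i)%N else 0) *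
  (if (j <= k)%N then t (k - j)%N else 0).
transitivity (\sum_(0 <= j < m) f j).
  by rewrite big_mkord; apply: eq_bigr => j _; rewrite !mxE.
have im := ltnW (ltn_ord i); have km := ltn_ord k.
rewrite (big_cat_nat (leq0n i) im) /= big_nat_cond big1 ?add0r; last first.
  by move=> j /andP[/andP[_ ji] _]; rewrite /f leqNgt ji mul0r.
have [ik|ki] := leqP i k; last first.
  rewrite big_nat_cond big1 // => j /andP[/andP[ij _] _].
  by rewrite /f [(j <= k)%N]leqNgt (leq_trans ki ij) mulr0.
rewrite (big_cat_nat (leqW ik) km) /= [X in _ + X]big_nat_cond [X in _ + X]big1 ?addr0; last first.
  by move=> j /andP[/andP[kj _] _]; rewrite /f [(j <= k)%N]leqNgt kj mulr0.
rewrite convolC /convol -{1}[i : nat]add0n big_addn subSn // big_mkord.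
apply: eq_bigr => l _; rewrite /f leq_addl addnK mulrC.
have lk : (l + i <= k)%N by have := ltn_ord l; lia.
by rewrite lk addnC subnDA.
Qed.

Lemma toep_comm m s t : toep m s *m toep m t = toep m t *m toep m s.
Proof. by rewrite !toepM; apply/matrixP => i k; rewrite !mxE convolC. Qed.

Lemma eq_toep m s t : (forall k, (k < m)%N -> s k = t k) -> toep m s = toep m t.
Proof.
move=> st; apply/matrixP => i k; rewrite !mxE; case: leqP => // _.
by apply: st; apply: leq_ltn_trans (leq_subr _ _) (ltn_ord k).
Qed.

Lemma toepD m s t : toep m s + toep m t = toep m (fun k => s k + t k).
Proof. by apply/matrixP => i k; rewrite !mxE; case: leqP; rewrite ?addr0. Qed.

Lemma toepZ m (a : F) s : a *: toep m s = toep m (fun k => a * s k).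
Proof. by apply/matrixP => i k; rewrite !mxE; case: leqP; rewrite ?mulr0. Qed.

Lemma det_toep m s : \det (toep m s) = s 0%N ^+ m.
Proof.
rewrite -det_tr det_trig.
  rewrite (eq_bigr (fun=> s 0%N)) ?prodr_const ?card_ord // => i _.
  by rewrite !mxE leqnn subnn.
by apply/is_trig_mxP => i k ik; rewrite !mxE leqNgt ik.
Qed.

Lemma toep_unit m s : s 0%N != 0 -> toep m s \in unitmx.
Proof. by move=> s0; rewrite unitmxE unitfE det_toep expf_neq0. Qed.

End Toeplitz.

Section Jets.
Variable R : realType.
Local Notation C := R[i].
Local Notation nm := (@Normc.normc R).

Definition jet (f : C -> C) (w : C) (k : nat) : C := cderivn k f w / (k`!)%:R.

Variable D : C -> Prop.
Hypothesis openD : forall z, D z -> exists2 r : R, 0 < r & forall w, nm (w - z) < r -> D w.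

Definition holoD (f : C -> C) := forall z, D z -> exists l, cdiff f z l.

Lemma cderivn_rec (f : C -> C) k z l : cdiff (cderivn k f) z l -> cderivn k.+1 f z = l.
Proof. by move=> H; rewrite /cderivn derive1nS; exact: cdiff_derive1 H. Qed.

(** Iterated derivatives are found by exhibiting candidates of all orders at once, each the
    derivative of the preceding one; the rules for sums, multiples and multiplication by z are
    instances. *)
Lemma cderivn_seq (h : nat -> C -> C) :
  (forall k z, D z -> cdiff (h k) z (h k.+1 z)) ->
  forall k z, D z -> cderivn k (h 0%N) z = h k z.
Proof.
move=> H; elim=> [//|k IH] z Dz; have [r r0 rD] := openD Dz.
apply: cderivn_rec; apply: (cdiff_ext r0 _ (H k z Dz)) => w /rD Dw.
by rewrite IH.
Qed.

Lemma cderivnD (f g : C -> C) k z : holoD f -> holoD g -> D z ->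
  cderivn k (fun w => f w + g w) z = cderivn k f z + cderivn k g z.
Proof.
move=> hf hg Dz.
have := @cderivn_seq (fun k z => cderivn k f z + cderivn k g z) _ k z Dz; apply.
by move=> j u Du; apply: cdiffD; exact: (cderiv_holo openD).
Qed.

Lemma cderivnZ (c : C) (f : C -> C) k z : holoD f -> D z ->
  cderivn k (fun w => c * f w) z = c * cderivn k f z.
Proof.
move=> hf Dz.
have := @cderivn_seq (fun k z => c * cderivn k f z) _ k z Dz; apply.
by move=> j u Du; apply: cdiffZ; exact: (cderiv_holo openD).
Qed.

(** At k = 0 the predecessor [k.-1] is 0 rather than -1, but its coefficient vanishes. *)
Lemma cderivn_mulid (f : C -> C) k z : holoD f -> D z ->
  cderivn k (fun w => w * f w) z = z * cderivn k f z + k%:R * cderivn k.-1 f z.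
Proof.
move=> hf Dz.
have := @cderivn_seq (fun k z => z * cderivn k f z + k%:R * cderivn k.-1 f z).
move=> /(_ _ k z Dz); rewrite /=.
have -> : (fun z0 => z0 * cderivn 0 f z0 + 0 * cderivn 0 f z0) = (fun w => w * f w).
  by apply/funext => w; rewrite mul0r addr0.
apply; move=> j u Du; case: j => [|j].
  have d0 := cdiffM (cdiff_id u) (cderiv_holo openD hf 0 Du).
  have := cdiffD d0 (cdiff_cst 0 u).
  rewrite addr0 mul1r addrC; apply: (cdiff_ext ltr01) => v _.
  by rewrite mul0r.
have d0 := cdiffM (cdiff_id u) (cderiv_holo openD hf j.+1 Du).
have d1 := cdiffZ (j.+1%:R) (cderiv_holo openD hf j Du).
have E (A B n : C) : 1 * A + u * B + n * A = u * B + (n + 1) * A by ring.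
have := cdiffD d0 d1.
by rewrite E natr1.
Qed.

Lemma jetD f g z k : holoD f -> holoD g -> D z ->
  jet (fun w => f w + g w) z k = jet f z k + jet g z k.
Proof. by move=> hf hg Dz; rewrite /jet cderivnD // mulrDl. Qed.

Lemma jetZ c f z k : holoD f -> D z -> jet (fun w => c * f w) z k = c * jet f z k.
Proof. by move=> hf Dz; rewrite /jet cderivnZ // mulrA. Qed.

(** The Taylor coefficients at w of the function z. *)
Definition jshift (w : C) : nat -> C := fun k => if k == 0%N then w else if k == 1%N then 1 else 0.

Lemma jet_mulid f z k : holoD f -> D z ->
  jet (fun w => w * f w) z k = convol (jshift z) (jet f z) k.
Proof.
move=> hf Dz; rewrite /jet cderivn_mulid // /convol.
have fact0 j : (j`!)%:R != 0 :> C by rewrite pnatr_eq0 -lt0n fact_gt0.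
case: k => [|k]; first by rewrite mul0r addr0 big_ord_recl big_ord0 addr0 -mulrA.
rewrite !big_ord_recr /= subnn subSnn big1 ?add0r => [|l _].
  rewrite /jshift /= mul1r mulrDl addrC mulrA; congr (_ + _).
  have E (A F n : C) : n != 0 -> F != 0 -> n * A / (n * F) = A / F by move=> *; field; apply/andP.
  by rewrite factS natrM E ?fact0 ?pnatr_eq0.
have lk := ltn_ord l; rewrite /jshift.
have -> : (k.+1 - l == 0)%N = false by apply/eqP; lia.
have -> : (k.+1 - l == 1)%N = false by apply/eqP; lia.
by rewrite mul0r.
Qed.

Lemma jordanE w m : jordan w m = toep m (jshift w).
Proof.
apply/matrixP => i k; rewrite !mxE /jshift.
case: (ltngtP i k) => ik.
- have -> : (k - i == 0)%N = false by apply/eqP; lia.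
  by congr (if _ then _ else _); apply/eqP/eqP; lia.
- by case: eqP => //; lia.
- by rewrite ik subnn.
Qed.

Lemma jet_ext f g z k : holoD f -> (forall w, D w -> f w = g w) -> D z -> jet f z k = jet g z k.
Proof. by move=> hf fg Dz; rewrite /jet (cderivn_ext openD hf fg). Qed.

Definition tjet m f z := toep m (jet f z).

Lemma tjetD m f g z : holoD f -> holoD g -> D z ->
  tjet m (fun w => f w + g w) z = tjet m f z + tjet m g z.
Proof. by move=> hf hg Dz; rewrite /tjet toepD; apply: eq_toep => k _; exact: jetD. Qed.

Lemma tjetZ m c f z : holoD f -> D z -> tjet m (fun w => c * f w) z = c *: tjet m f z.
Proof. by move=> hf Dz; rewrite /tjet toepZ; apply: eq_toep => k _; exact: jetZ. Qed.

Lemma tjet_mulid m f z : holoD f -> D z ->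
  tjet m (fun w => w * f w) z = jordan z m *m tjet m f z.
Proof.
by move=> hf Dz; rewrite /tjet jordanE toepM; apply: eq_toep => k _; exact: jet_mulid.
Qed.

Lemma tjet_ext m f g z : holoD f -> (forall w, D w -> f w = g w) -> D z -> tjet m f z = tjet m g z.
Proof. by move=> hf fg Dz; apply: eq_toep => k _; exact: jet_ext. Qed.

Lemma holoD_add f g : holoD f -> holoD g -> holoD (fun w => f w + g w).
Proof.
by move=> hf hg z Dz; have [l dl] := hf z Dz; have [m dm] := hg z Dz; exists (l + m); exact: cdiffD.
Qed.

Lemma holoD_scale c f : holoD f -> holoD (fun w => c * f w).
Proof. by move=> hf z Dz; have [l dl] := hf z Dz; exists (c * l); exact: cdiffZ. Qed.

Lemma holoD_mulid f : holoD f -> holoD (fun w => w * f w).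
Proof.
by move=> hf z Dz; have [l dl] := hf z Dz; eexists; exact: cdiffM (cdiff_id z) dl.
Qed.

Lemma holoD_quad a b f : holoD f -> holoD (fun w => (a + b * w ^+ 2) * f w).
Proof.
move=> hf z Dz; have [l dl] := hf z Dz; have [m dm] := cdiffX 2 (cdiff_id z).
by eexists; exact: cdiffM (cdiffD (cdiff_cst a z) (cdiffZ b dm)) dl.
Qed.

Definition quadJ m (a b z : C) : 'M[C]_m := a%:M + b *: (jordan z m *m jordan z m).

Lemma tjet_quad m a b f z : holoD f -> D z ->
  tjet m (fun w => (a + b * w ^+ 2) * f w) z = quadJ m a b z *m tjet m f z.
Proof.
move=> hf Dz.
have h2 := holoD_mulid (holoD_mulid hf).
rewrite (@tjet_ext m _ (fun w => a * f w + b * (w * (w * f w))) z (holoD_quad a b hf) _ Dz); last first.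
  by move=> w _; ring.
rewrite tjetD //; [|exact: holoD_scale|exact: holoD_scale].
rewrite !tjetZ // !tjet_mulid //; last exact: holoD_mulid.
by rewrite /quadJ mulmxDl mul_scalar_mx -scalemxAl mulmxA.
Qed.

Lemma quadJ_comm_toep m a b z s : quadJ m a b z *m toep m s = toep m s *m quadJ m a b z.
Proof.
rewrite /quadJ mulmxDl mulmxDr scalar_mxC -scalemxAl -scalemxAr; congr (_ + _ *: _).
by rewrite jordanE toepM toep_comm.
Qed.

End Jets.

(** * Dependency constants, principal parts and norming rows *)

Section DependencyAndPoles.
Variable R : realType.
Local Notation C := R[i].
Local Notation nm := (@Normc.normc R).

Definition ghat (g : nat -> C) k : C := g k / (k`!)%:R.

(** The binomial sums have the shape of Leibniz's rule; division by k! turns them into Cauchy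
    products with the coefficients g k / k!. *)
Lemma depend_tjet (phi psi : int -> C -> C * C) w m g : depend phi psi w m g -> forall n,
  tjet m (fun z => (phi n z).1) w = toep m (ghat g) *m tjet m (fun z => (psi n z).1) w /\
  tjet m (fun z => (phi n z).2) w = toep m (ghat g) *m tjet m (fun z => (psi n z).2) w.
Proof.
move=> dep n.
have fact0 j : (j`!)%:R != 0 :> C by rewrite pnatr_eq0 -lt0n fact_gt0.
have coef k (x : nat -> C) :
    (\sum_(l < k.+1) 'C(k, l)%:R * g (k - l)%N * x l) / (k`!)%:R =
    convol (ghat g) (fun l => x l / (l`!)%:R) k.
  rewrite /convol mulr_suml; apply: eq_bigr => l _.
  have lk : (l <= k)%N by rewrite -ltnS.
  rewrite /ghat -(bin_fact lk) !natrM; field.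
  by rewrite !fact0 pnatr_eq0 -lt0n bin_gt0 lk.
by split; rewrite /tjet toepM; apply: eq_toep => k km; rewrite /jet -coef;
  have [h1 h2] := dep k km n; [rewrite h1|rewrite h2].
Qed.

(** Multiplication by x^(m+1) and x -> 0 isolate the coefficient of highest order, which must be 0;
    induction removes the others. This makes the coefficients in [pole_order] unique. *)
Lemma principal_part_zero m (s : nat -> C) (d K : R) : 0 < d ->
  (forall x : C, 0 < nm x < d -> nm (\sum_(1 <= k < m.+1) s k / x ^+ k) <= K) ->
  forall k, (1 <= k <= m)%N -> s k = 0.
Proof.
move=> d0; elim: m K => [|m IH] K H k; first by lia.
suff sm : s m.+1 = 0.
  case/andP=> k1; rewrite leq_eqVlt => /orP[/eqP -> //|km].
  apply: (IH K) => [x xd|]; last by rewrite k1.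
  by have := H x xd; rewrite big_nat_recr //= sm mul0r addr0.
clear k IH.
pose L := \sum_(1 <= k < m.+1) nm (s k).
have L0 : 0 <= L by apply: sumr_ge0 => i _; exact: nm_ge0.
have K0 : 0 <= K.
  have hd : 0 < nm (d / 2)%:C < d by rewrite nm_real gtr0_norm; lra.
  by apply: le_trans (H _ hd); exact: nm_ge0.
apply/eqP; rewrite -nm_eq0 eq_le nm_ge0 andbT; apply/ler_addgt0Pr => e e0; rewrite add0r.
have KL0 : 0 < K + L + 1 by lra.
(* At |x| = t the leading coefficient is at most (K + L) t, which is below e. *)
pose t := Num.min (Num.min 1 d) (e / (K + L + 1)) / 2.
have m0 : 0 < Num.min (Num.min 1 d) (e / (K + L + 1)) by rewrite !lt_min ltr01 d0 divr_gt0.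
have t0 : 0 < t by rewrite divr_gt0.
have [t1 td te] : [/\ t < 1, t < d & t < e / (K + L + 1)].
  have : t < Num.min (Num.min 1 d) (e / (K + L + 1)) by rewrite /t; lra.
  by rewrite !lt_min => /andP[/andP[]].
have nt : nm t%:C = t by rewrite nm_real gtr0_norm.
have tC : t%:C != 0 by rewrite -nm_gt0 nt.
have := H t%:C; rewrite nt t0 td => /(_ isT).
rewrite big_nat_recr //=; set A := \sum_(1 <= k < m.+1) _ => B.
have Ab : nm (A * t%:C ^+ m.+1) <= L * t.
  rewrite mulr_suml big_nat_cond.
  have le_sum (F : nat -> C) (G : nat -> R) : (forall k, (1 <= k < m.+1)%N -> nm (F k) <= G k) ->
      nm (\sum_(1 <= k < m.+1 | (1 <= k < m.+1)%N && true) F k) <= \sum_(1 <= k < m.+1 | (1 <= k < m.+1)%N && true) G k.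
    move=> FG; apply: (big_ind2 (fun x y => nm x <= y)) => [|x1 y1 x2 y2 h1 h2|k].
    - by rewrite nm0.
    - by apply: le_trans (nmD _ _) _; lra.
    - by rewrite andbT => /FG.
  rewrite /L mulr_suml [leRHS]big_nat_cond; apply: le_sum => k /andP[k1 km].
  have xE : t%:C ^+ m.+1 = t%:C ^+ k * t%:C ^+ (m - k).+1.
    by rewrite -exprD addnS subnKC // -ltnS.
  rewrite xE mulrA divfK ?expf_neq0 // nmM nmX nt ler_wpM2l ?nm_ge0 // exprS.
  by apply: ler_piMr; [exact: ltW|apply: exprn_ile1; exact: ltW].
have sE : s m.+1 = (A + s m.+1 / t%:C ^+ m.+1) * t%:C ^+ m.+1 - A * t%:C ^+ m.+1.
  by field; rewrite expf_neq0.
rewrite sE; apply: le_trans (nmB _ _) _; rewrite nmM nmX nt.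
have tm : t ^+ m.+1 <= t.
  by rewrite exprS; apply: ler_piMr; [exact: ltW|apply: exprn_ile1; exact: ltW].
have h1 : nm (A + s m.+1 / t%:C ^+ m.+1) * t ^+ m.+1 <= K * t.
  by apply: ler_pM => //; rewrite ?nm_ge0 ?exprn_ge0 // ltW.
have : t * (K + L + 1) <= e by have := ltW te; rewrite ler_pdivlMr.
by lra.
Qed.

(** Near w the difference of the two principal parts is bounded, because 1/b = (1/a)/c. *)
Lemma pole_order_scale (a b : C -> C) (c w : C) m t s : c != 0 ->
  (exists2 r : R, 0 < r & forall z, nm (z - w) < r -> b z = c * a z) ->
  pole_order a w m t -> pole_order b w m s -> forall k, (1 <= k <= m)%N -> s k = t k / c.
Proof.
move=> c0 [r r0 ab] [m0 _ [d1 [K1 [d10 H1]]]] [_ _ [d2 [K2 [d20 H2]]]] k km.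
have [e1 e10 E1] := complex_gt0P d10; have [e2 e20 E2] := complex_gt0P d20.
pose d := Num.min r (Num.min e1 e2).
have d0 : 0 < d by rewrite !lt_min r0 e10.
suff H : forall k, (1 <= k <= m)%N -> s k - t k / c = 0.
  by apply/eqP; rewrite -subr_eq0 H.
apply: (@principal_part_zero m (fun k => s k - t k / c) d
  (complex.Re K2 + complex.Re K1 * nm c^-1) d0) => x /andP[x0].
rewrite !lt_min => /and3P[xr x1 x2].
have xE : w + x - w = x by rewrite addrC addKr.
have n1 : 0 < `|w + x - w| < d1 by rewrite xE E1 normE !ltcR x0.
have n2 : 0 < `|w + x - w| < d2 by rewrite xE E2 normE !ltcR x0.
have [a0 b1] := H1 _ n1; have [b0 b2] := H2 _ n2.
have le_Re (X K : C) : `|X| <= K -> nm X <= complex.Re K.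
  by rewrite normE lecE => /andP[].
have {}b1 := le_Re _ _ b1; have {}b2 := le_Re _ _ b2; rewrite xE in b1 b2.
have bE : (b (w + x))^-1 = (a (w + x))^-1 / c by rewrite ab ?xE // invfM mulrC.
set X := \sum_(1 <= k < m.+1) t k / x ^+ k in b1.
set Y := \sum_(1 <= k < m.+1) s k / x ^+ k in b2.
have -> : \sum_(1 <= k < m.+1) (s k - t k / c) / x ^+ k =
   ((a (w + x))^-1 - X) * c^-1 - ((b (w + x))^-1 - Y).
  have -> : \sum_(1 <= k < m.+1) (s k - t k / c) / x ^+ k = Y - X / c.
    rewrite /X mulr_suml -sumrB; apply: eq_bigr => j _.
    by rewrite mulrBl; congr (_ - _); rewrite mulrAC.
  by rewrite bE; ring.
apply: le_trans (nmB _ _) _; rewrite nmM addrC; apply: lerD => //.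
by rewrite ler_wpM2r ?nm_ge0.
Qed.

(** Since [Crow] lists c_jk with k decreasing, its entry i is the sum over l <= i of t_(m - (i - l))
    g_l / l!, a convolution, hence an entry in the first row of a Toeplitz product. *)
Lemma Crow_toep N (ms : 'I_N -> nat) (c : 'I_N -> nat -> C) (j : 'I_N) (sg : C)
    (t g : nat -> C) (i0 : 'I_(ms j)) : (i0 : nat) = 0%N ->
  (forall k, (k < ms j)%N ->
     c j k = sg * \sum_(l < ms j - k) t (k + 1 + l)%N * g l / (l`!)%:R) ->
  Crow ms c j = row i0 (toep (ms j) (fun k => sg * t (ms j - k)%N) *m toep (ms j) (ghat g)).
Proof.
move=> i00 cE; rewrite toepM; apply/rowP => i; rewrite !mxE i00 leq0n subn0.
have im := ltn_ord i.
rewrite cE; last by lia.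
have -> : (ms j - (ms j - 1 - i) = i.+1)%N by lia.
rewrite mulr_sumr /convol; apply: eq_bigr => l _; rewrite /ghat -!mulrA; congr (_ * (t _ * _)).
by have := ltn_ord l; lia.
Qed.

End DependencyAndPoles.

(** * Gauge transformations *)

Section Scattering.
Variable R : realType.
Local Notation C := R[i].
Local Notation nm := (@Normc.normc R).

(* The interior (o = false) and exterior (o = true) scattering problems are
   treated together. *)
Definition dom (o : bool) (z : C) : Prop := if o then 1 < nm z else 0 < nm z < 1.
Definition toin (o : bool) (z : C) : C := if o then z^-1 else z.
Definition domfun o (f : C -> C) := disc_fun (fun z => f (toin o z)) /\ holoD (dom o) f.
Definition idx (b : bool) (k : nat) : int := if b then k%:Z else - k%:Z.
(** psi at n = k and phi at n = -k have the same leading power of z, so one exponent normalises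
    both; [expo (~~ o)] belongs to phi at n = k, where the transmission coefficient is read off. *)
Definition expo (o : bool) (k : nat) : int := if o then k%:Z else - k%:Z.
Definition comp (o : bool) (v : C * C) := if o then v.2 else v.1.
Definition ind (b : bool) : C := if b then 1 else 0.

(** The o(1) components are multiplied by the power of z as well, which changes nothing on |z| = 1
    and gives both components the same form. *)
Definition jostP o (M : int -> C -> mat2 R) (psi phi : int -> C -> C * C) : Prop :=
  [/\ forall z, nm z = 1 -> is_sol M z (psi^~ z) /\ is_sol M z (phi^~ z),
      forall z, nm z = 1 ->
        seq_lim (fun k => (psi (idx true k) z).1 * z ^ expo o k) (ind o) /\
        seq_lim (fun k => (psi (idx true k) z).2 * z ^ expo o k) (ind (~~ o)),
      forall z, nm z = 1 ->
        seq_lim (fun k => (phi (idx false k) z).1 * z ^ expo o k) (ind (~~ o)) /\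
        seq_lim (fun k => (phi (idx false k) z).2 * z ^ expo o k) (ind o),
      forall n, domfun o (fun z => (psi n z).1) /\ domfun o (fun z => (psi n z).2) &
      forall n, domfun o (fun z => (phi n z).1) /\ domfun o (fun z => (phi n z).2)].

(** [NV] carries a property of psi that the existential would hide: non-vanishing for (Q), [True]
    for (U). *)
Definition scatt o (NV : (int -> C -> C * C) -> Prop) M N (zs : 'I_N -> C) (ms : 'I_N -> nat) (c : 'I_N -> nat -> C) :=
  exists psi phi a t g, NV psi /\
    [/\ jostP o M psi phi,
        domfun o a /\ (forall z, nm z = 1 ->
          seq_lim (fun k => comp o (phi k%:Z z) * z ^ expo (~~ o) k) (a z)),
        forall j, pole_order a (zs j) (ms j) (t j),
        forall j, depend phi psi (zs j) (ms j) (g j) &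
        forall j k, (k < ms j)%N -> c j k = (if o then 2 else -2) *
          \sum_(l < ms j - k) t j (k + 1 + l)%N * g j l / (l`!)%:R].

Lemma ext_in_domfun (f : C -> C) : ext_in f -> domfun false f.
Proof. by move=> /ext_in_disc_fun hf; split => // z; exact: hf.1. Qed.

Lemma ext_out_domfun (f : C -> C) : ext_out f -> domfun true f.
Proof.
move=> hf; split; first exact: ext_out_disc_fun.
case: hf => hf _ z z1; apply/derivable_cdiffP; apply: hf.
have E1 (x : R) : (1 < x%:C) = (1 < x) by rewrite -ltcR.
by rewrite /disk_out /= normE E1.
Qed.

Lemma seq_lim_unit (u : nat -> C) z (g : nat -> int) : nm z = 1 -> seq_lim u 0 ->
  seq_lim (fun k => u k * z ^ g k) 0.
Proof.
move=> z1 u0; have zk k : nm (z ^ g k) <= 1 by rewrite unit_exprz.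
have := seq_lim0_bounded ler01 zk u0.
by apply: (@seq_lim_ext _ _ _ _ 0%N) => k _; rewrite mulrC.
Qed.

Lemma norming_in_scatt (NV : _ -> Prop) M N (zs : 'I_N -> C) ms c :
  (forall psi, jost_psi M psi -> NV psi) ->
  norming_in M zs ms c -> scatt false NV M zs ms c.
Proof.
move=> hNV [psi [phi [a [t [g [[jp [cphi ephi]] [ea la] [_ pa _] dep cE]]]]]].
have := hNV psi jp; case: jp => cpsi epsi nv.
exists psi, phi, a, t, g; split => //; split => //; last first.
  split; first exact: ext_in_domfun.
  by move=> z z1; exact: la (normc_eq1 z1).
split.
- by move=> z /normc_eq1 z1; have [? _ _] := cpsi z z1; have [? _ _] := cphi z z1.
- move=> z z1; have [_ l1 l2] := cpsi z (normc_eq1 z1).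
  by split; [exact: (@seq_lim_unit _ z (expo false) z1 l1)|exact: l2].
- move=> z z1; have [_ l1 l2] := cphi z (normc_eq1 z1).
  by split; [exact: l1|exact: (@seq_lim_unit _ z (expo false) z1 l2)].
- by move=> n; have [/ext_in_domfun ? /ext_in_domfun ?] := epsi n.
- by move=> n; have [/ext_in_domfun ? /ext_in_domfun ?] := ephi n.
Qed.

Lemma norming_out_scatt (NV : _ -> Prop) M N (zs : 'I_N -> C) ms c :
  (forall psi, jost_psib M psi -> NV psi) ->
  norming_out M zs ms c -> scatt true NV M zs ms c.
Proof.
move=> hNV [psi [phi [a [t [g [[jp [cphi ephi]] [ea la] [_ pa _] dep cE]]]]]].
have := hNV psi jp; case: jp => cpsi epsi nv.
exists psi, phi, a, t, g; split => //; split => //; last first.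
  split; first exact: ext_out_domfun.
  by move=> z z1; exact: la (normc_eq1 z1).
split.
- by move=> z /normc_eq1 z1; have [? _ _] := cpsi z z1; have [? _ _] := cphi z z1.
- move=> z z1; have [_ l1 l2] := cpsi z (normc_eq1 z1).
  by split; [exact: l1|exact: (@seq_lim_unit _ z (expo true) z1 l2)].
- move=> z z1; have [_ l1 l2] := cphi z (normc_eq1 z1).
  split; first exact: (@seq_lim_unit _ z (expo true) z1 l1).
  by move: l2; apply: (@seq_lim_ext _ _ _ _ 0%N) => k _ /=; rewrite opprK.
- by move=> n; have [/ext_out_domfun ? /ext_out_domfun ?] := epsi n.
- by move=> n; have [/ext_out_domfun ? /ext_out_domfun ?] := ephi n.
Qed.

Lemma normc_dom_in (z : C) : dom false z -> 0 < `|z| < 1.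
Proof. by rewrite /dom normE -!ltcR. Qed.

Lemma normc_dom_out (z : C) : dom true z -> 1 < `|z|.
Proof. by rewrite /dom normE -ltcR. Qed.

Lemma dom_open o z : dom o z -> exists2 d : R, 0 < d & forall w, nm (w - z) < d -> dom o w.
Proof.
rewrite /dom; case: o => H.
  exists (nm z - 1); first by rewrite subr_gt0.
  by move=> w wz; have := nm_triB z w; rewrite (nmBC z w); lra.
exists (Num.min (nm z) (1 - nm z)); first by rewrite lt_min; lra.
move=> w; rewrite lt_min => /andP[] /=.
by have := nm_triB z w; have := nm_triB w z; rewrite (nmBC z w); lra.
Qed.

Lemma dom_neq0 o z : dom o z -> z != 0.
Proof. by rewrite /dom; case: o => H; rewrite -nm_gt0; lra. Qed.

Lemma dom_sqr_neq1 o z : dom o z -> z ^+ 2 != 1.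
Proof.
move=> H; apply: contraPneq H => z2; have : nm z ^+ 2 = 1 by rewrite -nmX z2 nm1.
move=> n2; have /eqP : nm z = 1.
  by apply/eqP; rewrite -(eqrXn2 (ltn0Sn 1)) ?nm_ge0 // n2 expr1n.
by rewrite /dom; case: o => /eqP ->; rewrite ltxx ?andbF.
Qed.

Lemma domfun_eq o (f g : C -> C) : disc_fun (fun z => f (toin o z)) ->
  disc_fun (fun z => g (toin o z)) -> (forall z, nm z = 1 -> f z = g z) ->
  forall z, dom o z -> f z = g z.
Proof.
move=> hf hg fg z zd.
have H := disc_fun_eq hf hg _; have := H _ (toin o z).
rewrite (_ : toin o (toin o z) = z); last by case: (o) => //=; rewrite invrK.
apply.
  by move=> w w1; apply: fg; case: (o) => //=; rewrite nmV w1 invr1.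
rewrite /dom /toin in zd *; case: (o) zd => zd; last by rewrite /in_disc; lra.
have z0 : 0 < nm z by lra.
by rewrite /in_disc nmV invr_gt0 z0 /= invf_le1 // ltW.
Qed.

Lemma toin_quad o (a b : C) : disc_fun (fun z => a + b * toin o z ^+ 2).
Proof.
apply: disc_funD; first exact: disc_fun_cst.
apply: disc_funM; first exact: disc_fun_cst.
apply: disc_funX; case: o; [exact: disc_fun_inv|exact: disc_fun_id].
Qed.

Section Gauge.
Variables (q r : int -> C).
Hypothesis dq : rapid_decay q.
Hypothesis dr : rapid_decay r.
Variables (MS : int -> C -> mat2 R) (A B : int -> mat2 R).
Variables (a1 b1 a2 b2 : C) (Dinf Einf : C).
Hypothesis D0 : Dinf != 0.
Hypothesis E0 : Einf != 0.

Definition gauge n z : mat2 R :=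
  (((A n).1.1 + (B n).1.1 * z ^+ 2, (A n).1.2 + (B n).1.2 * z ^+ 2),
   ((A n).2.1 + (B n).2.1 * z ^+ 2, (A n).2.2 + (B n).2.2 * z ^+ 2)).

(** The diagonal entries of a gauge matrix contain inverses of D and E, which tend to 1 at -oo and
    to Dinf, Einf at +oo. *)
Definition endc (b : bool) (c : C) : C := if b then c^-1 else 1.

Hypothesis limA11 : forall b, seq_lim (fun k => (A (idx b k)).1.1) (endc b Einf * a1).
Hypothesis limB11 : forall b, seq_lim (fun k => (B (idx b k)).1.1) (endc b Einf * b1).
Hypothesis limA22 : forall b, seq_lim (fun k => (A (idx b k)).2.2) (endc b Dinf * a2).
Hypothesis limB22 : forall b, seq_lim (fun k => (B (idx b k)).2.2) (endc b Dinf * b2).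
Hypothesis limA12 : forall b, seq_lim (fun k => (A (idx b k)).1.2) 0.
Hypothesis limB12 : forall b, seq_lim (fun k => (B (idx b k)).1.2) 0.
Hypothesis limA21 : forall b, seq_lim (fun k => (A (idx b k)).2.1) 0.
Hypothesis limB21 : forall b, seq_lim (fun k => (B (idx b k)).2.1) 0.
Hypothesis intertwine : forall n z v, z != 0 ->
  mulv (gauge n z) (mulv (MS n z) v) = mulv (transferQ q r n z) (mulv (gauge (n + 1) z) v).

Definition P1 z := a1 + b1 * z ^+ 2.
Definition P2 z := a2 + b2 * z ^+ 2.

Hypothesis P1_neq0 : forall z, z != 0 -> z ^+ 2 != 1 -> P1 z != 0.
Hypothesis P2_neq0 : forall z, z != 0 -> z ^+ 2 != 1 -> P2 z != 0.

Lemma gauge_lim b z : [/\ seq_lim (fun k => (gauge (idx b k) z).1.1) (endc b Einf * P1 z),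
  seq_lim (fun k => (gauge (idx b k) z).1.2) 0,
  seq_lim (fun k => (gauge (idx b k) z).2.1) 0 &
  seq_lim (fun k => (gauge (idx b k) z).2.2) (endc b Dinf * P2 z)].
Proof.
have quad (u v : nat -> C) x y l : seq_lim u x -> seq_lim v y -> x + y * z ^+ 2 = l ->
    seq_lim (fun k => u k + v k * z ^+ 2) l.
  by move=> hu hv <-; exact: seq_limD hu (seq_limM hv (seq_lim_cst _)).
split; [apply: (quad _ _ _ _ _ (@limA11 b) (@limB11 b))|apply: (quad _ _ _ _ _ (@limA12 b) (@limB12 b))
  |apply: (quad _ _ _ _ _ (@limA21 b) (@limB21 b))|apply: (quad _ _ _ _ _ (@limA22 b) (@limB22 b))];
  rewrite /P1 /P2; ring.
Qed.

(** The difference a X - c G Y solves (Q), and the two scalar conditions on the limits make it tend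
    to 0 at the end b. The factor a stays on the left because the limits P1 and P2 may vanish on the
    circle. *)
Lemma gauge_eq b z (w : nat -> int) X Y (x1 x2 y1 y2 a c : C) : nm z = 1 ->
  is_sol (transferQ q r) z X -> is_sol MS z Y ->
  seq_lim (fun k => (X (idx b k)).1 * z ^ w k) x1 ->
  seq_lim (fun k => (X (idx b k)).2 * z ^ w k) x2 ->
  seq_lim (fun k => (Y (idx b k)).1 * z ^ w k) y1 ->
  seq_lim (fun k => (Y (idx b k)).2 * z ^ w k) y2 ->
  a * x1 = c * (endc b Einf * P1 z * y1) -> a * x2 = c * (endc b Dinf * P2 z * y2) ->
  forall n, a * (X n).1 = c * (mulv (gauge n z) (Y n)).1 /\
            a * (X n).2 = c * (mulv (gauge n z) (Y n)).2.
Proof.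
move=> z1 sX sY X1 X2 Y1 Y2 e1 e2.
have z0 := unit_neq0 z1.
pose W n : C * C := (a * (X n).1 - c * (mulv (gauge n z) (Y n)).1,
                     a * (X n).2 - c * (mulv (gauge n z) (Y n)).2).
have sW : is_sol (transferQ q r) z W.
  move=> n; rewrite /W sY intertwine // [X n]sX.
  set U := mulv (gauge _ _) _.
  by apply/eqP; rewrite xpair_eqE /=; apply/andP; split; apply/eqP; ring.
have [l11 l12 l21 l22] := gauge_lim b z.
have lG1 := seq_limD (seq_limM l11 Y1) (seq_limM l12 Y2).
have lG2 := seq_limD (seq_limM l21 Y1) (seq_limM l22 Y2).
have lW1 := seq_limD (seq_limM (seq_lim_cst a) X1) (seq_limM (seq_lim_cst (- c)) lG1).
have lW2 := seq_limD (seq_limM (seq_lim_cst a) X2) (seq_limM (seq_lim_cst (- c)) lG2).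
have zz k : z ^ w k * z ^ (- w k) = 1 by rewrite -expfzDr // subrr expr0z.
have unscale (X0 U1 U2 G1 G2 : nat -> C) : seq_lim (fun k => a * (X0 k * z ^ w k) +
    - c * (G1 k * (U1 k * z ^ w k) + G2 k * (U2 k * z ^ w k))) 0 ->
    seq_lim (fun k => a * X0 k - c * (G1 k * U1 k + G2 k * U2 k)) 0.
  move=> /(seq_lim_unit (fun k => - w k) z1); apply: (@seq_lim_ext _ _ _ _ 0%N) => k _.
  have -> : (a * (X0 k * z ^ w k) + - c * (G1 k * (U1 k * z ^ w k) + G2 k * (U2 k * z ^ w k))) *
    z ^ (- w k) = (a * X0 k - c * (G1 k * U1 k + G2 k * U2 k)) * (z ^ w k * z ^ (- w k)) by ring.
  by rewrite zz mulr1.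
have W1 : seq_lim (fun k => (W (idx b k)).1) 0.
  by apply: unscale; rewrite e1 mul0r addr0 mulNr subrr in lW1.
have W2 : seq_lim (fun k => (W (idx b k)).2) 0.
  by apply: unscale; rewrite e2 mul0r add0r mulNr subrr in lW2.
have W0 : forall n, W n = 0.
  by case: b {X1 X2 Y1 Y2 e1 e2 l11 l12 l21 l22 lG1 lG2 lW1 lW2} W1 W2 => W1 W2;
    [exact: (solQ_zero_pinf dq dr z1 sW)|exact: (solQ_zero_minf dq dr z1 sW)].
move=> n; have := W0 n; rewrite /W => -[/eqP h1 /eqP h2].
by move: h1 h2; rewrite !subr_eq0 => /eqP h1 /eqP h2.
Qed.

Definition Pphi (o : bool) := if o then P2 else P1.
Definition Ppsi (o : bool) := if o then P1 else P2.
Definition cpsi (o : bool) := if o then Einf else Dinf.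

Lemma PphiE o z : Pphi o z = (if o then a2 else a1) + (if o then b2 else b1) * z ^+ 2.
Proof. by case: o. Qed.

Lemma PpsiE o z : Ppsi o z = (if o then a1 else a2) + (if o then b1 else b2) * z ^+ 2.
Proof. by case: o. Qed.

Lemma quad_relation_ext o (f g h : C -> C) (s t x x' y y' c : C) :
  domfun o f -> domfun o g -> domfun o h ->
  (forall z, nm z = 1 -> (s + t * z ^+ 2) * f z =
     c * ((x + x' * z ^+ 2) * g z + (y + y' * z ^+ 2) * h z)) ->
  forall z, dom o z -> (s + t * z ^+ 2) * f z =
     c * ((x + x' * z ^+ 2) * g z + (y + y' * z ^+ 2) * h z).
Proof.
move=> [hf _] [hg _] [hh _].
apply: (@domfun_eq o (fun z => (s + t * z ^+ 2) * f z)
  (fun z => c * ((x + x' * z ^+ 2) * g z + (y + y' * z ^+ 2) * h z))).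
  exact: disc_funM (toin_quad _ _ _) hf.
apply: disc_funM; first exact: disc_fun_cst.
by apply: disc_funD; apply: disc_funM => //; exact: toin_quad.
Qed.

(** phi is compared at -oo, where D and E tend to 1, and psi at +oo; hence the constant [cpsi] in
    the second relation only. *)
Lemma jost_relation o psiQ phiQ psiS phiS :
  jostP o (transferQ q r) psiQ phiQ -> jostP o MS psiS phiS ->
  (forall z, nm z = 1 \/ dom o z -> forall n,
     Pphi o z * (phiQ n z).1 = (mulv (gauge n z) (phiS n z)).1 /\
     Pphi o z * (phiQ n z).2 = (mulv (gauge n z) (phiS n z)).2) /\
  (forall z, nm z = 1 \/ dom o z -> forall n,
     Ppsi o z * (psiQ n z).1 = cpsi o * (mulv (gauge n z) (psiS n z)).1 /\
     Ppsi o z * (psiQ n z).2 = cpsi o * (mulv (gauge n z) (psiS n z)).2).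
Proof.
move=> [sQ psiQl phiQl psiQe phiQe] [sS psiSl phiSl psiSe phiSe].
have phi1 z : nm z = 1 -> forall n, Pphi o z * (phiQ n z).1 = (mulv (gauge n z) (phiS n z)).1 /\
     Pphi o z * (phiQ n z).2 = (mulv (gauge n z) (phiS n z)).2.
  move=> z1 n; have [_ sp] := sQ z z1; have [_ sp'] := sS z z1.
  have [q1 q2] := phiQl z z1; have [s1 s2] := phiSl z z1.
  have := @gauge_eq false z (expo o) _ _ _ _ _ _ (Pphi o z) 1 z1 sp sp' q1 q2 s1 s2 _ _ n.
  by rewrite !mul1r; apply; rewrite /Pphi /=; case: (o) => /=; ring.
have psi1 z : nm z = 1 -> forall n, Ppsi o z * (psiQ n z).1 = cpsi o * (mulv (gauge n z) (psiS n z)).1 /\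
     Ppsi o z * (psiQ n z).2 = cpsi o * (mulv (gauge n z) (psiS n z)).2.
  move=> z1 n; have [sp _] := sQ z z1; have [sp' _] := sS z z1.
  have [q1 q2] := psiQl z z1; have [s1 s2] := psiSl z z1.
  apply: (@gauge_eq true z (expo o) _ _ _ _ _ _ (Ppsi o z) (cpsi o) z1 sp sp' q1 q2 s1 s2);
    by rewrite /Ppsi /cpsi /=; case: (o) => /=; field.
split => z [z1|zd] n; [exact: phi1| |exact: psi1|].
- have [Q1 Q2] := phiQe n; have [S1 S2] := phiSe n.
  rewrite PphiE -[(mulv _ _).1]mul1r -[(mulv _ _).2]mul1r.
  split; [apply: (quad_relation_ext Q1 S1 S2 _ zd)|apply: (quad_relation_ext Q2 S1 S2 _ zd)] => w w1;
    by rewrite mul1r -PphiE; have [] := phi1 w w1 n.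
- have [Q1 Q2] := psiQe n; have [S1 S2] := psiSe n; rewrite PpsiE.
  split; [apply: (quad_relation_ext Q1 S1 S2 _ zd)|apply: (quad_relation_ext Q2 S1 S2 _ zd)] => w w1;
    by rewrite -PpsiE; have [] := psi1 w w1 n.
Qed.

Definition cT (o : bool) := if o then Dinf else Einf.

(** Cramer's rule eliminates eta, whose growth is unknown: det G xi = G22 P al - G12 P be. Here be w
    is bounded and G12 tends to 0, so that term disappears. *)
Lemma cramer_limit (G11 G12 G21 G22 al be xi eta w : nat -> C) (g1 g2 P aQ aS : C) (L : R) :
  seq_lim G11 g1 -> seq_lim G12 0 -> seq_lim G21 0 -> seq_lim G22 g2 ->
  0 <= L -> (forall k, nm (be k * w k) <= L) ->
  (forall k, P * al k = G11 k * xi k + G12 k * eta k) ->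
  (forall k, P * be k = G21 k * xi k + G22 k * eta k) ->
  seq_lim (fun k => al k * w k) aQ -> seq_lim (fun k => xi k * w k) aS ->
  g1 * g2 * aS = g2 * (P * aQ).
Proof.
move=> l11 l12 l21 l22 L0 beL r1 r2 lQ lS.
have det0 := seq_limD (seq_limM l11 l22) (seq_limM (seq_lim_cst (-1)) (seq_limM l12 l21)).
have lim1 := seq_limM det0 lS; rewrite mulr0 mulr0 addr0 in lim1.
have b0 := seq_limM (seq_lim_cst (- P)) (seq_lim0_bounded L0 beL l12); rewrite mulr0 in b0.
have lim2 := seq_limD (seq_limM l22 (seq_limM (seq_lim_cst P) lQ)) b0; rewrite addr0 in lim2.
refine (seq_lim_uniq lim1 _); move: lim2; apply: (@seq_lim_ext _ _ _ _ 0%N) => k _.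
have -> : G22 k * (P * (al k * w k)) + - P * (be k * w k * G12 k) =
  (G22 k * (P * al k) - G12 k * (P * be k)) * w k by ring.
by rewrite r1 r2; ring.
Qed.

Lemma transmission_relation o psiQ phiQ psiS phiS (aQ aS : C -> C) :
  jostP o (transferQ q r) psiQ phiQ -> jostP o MS psiS phiS ->
  domfun o aQ -> domfun o aS ->
  (forall z, nm z = 1 -> seq_lim (fun k => comp o (phiQ k%:Z z) * z ^ expo (~~ o) k) (aQ z)) ->
  (forall z, nm z = 1 -> seq_lim (fun k => comp o (phiS k%:Z z) * z ^ expo (~~ o) k) (aS z)) ->
  forall z, dom o z -> aS z = cT o * aQ z.
Proof.
move=> jQ jS dQ dS lQ lS.
have [rel _] := jost_relation jQ jS; have [sQ _ _ _ _] := jQ.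
(* P1 P2 is kept as a factor, since it may vanish on the circle; it is cancelled after the extension
   to the domain, where it does not. *)
have circle z : nm z = 1 -> P1 z * P2 z * aS z = cT o * (P1 z * P2 z * aQ z).
  move=> z1; have [_ sp] := sQ z z1; have {}rel := rel z (or_introl z1).
  have [L L0 LP] := solQ_bounded dq dr z1 sp.
  have [g11 g12 g21 g22] := gauge_lim true z.
  have bw (u : nat -> C) b : (forall k, nm (u k) <= L) -> forall k, nm (u k * z ^ expo b k) <= L.
    by move=> ub k; rewrite nmM unit_exprz ?mulr1.
  have {}lQ := lQ z z1; have {}lS := lS z z1.
  rewrite /cT; case: (o) rel lS lQ => rel lS' lQ'.
  (* For the exterior problem the second component carries the transmission coefficient, so rows and
     columns of the gauge matrix are exchanged. *)
  - have := cramer_limit g22 g21 g12 g11 L0 (bw _ (~~ true) (fun k => (LP k).1)) _ _ lQ' lS'.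
    move=> /(_ (fun k => (phiS k%:Z z).1) (P2 z)) H.
    have {}H := H (fun k => etrans (rel k%:Z).2 (addrC _ _)) (fun k => etrans (rel k%:Z).1 (addrC _ _)).
    apply: (mulfI (invr_neq0 (mulf_neq0 D0 E0))).
    rewrite /endc in H.
    have -> : (Dinf * Einf)^-1 * (P1 z * P2 z * aS z) = Dinf^-1 * P2 z * (Einf^-1 * P1 z) * aS z.
      by field; rewrite D0 E0.
    by rewrite H; field; rewrite D0 E0.
  - have := cramer_limit g11 g12 g21 g22 L0 (bw _ (~~ false) (fun k => (LP k).2)) _ _ lQ' lS'.
    move=> /(_ (fun k => (phiS k%:Z z).2) (P1 z)) H.
    have {}H := H (fun k => (rel k%:Z).1) (fun k => (rel k%:Z).2).
    apply: (mulfI (invr_neq0 (mulf_neq0 D0 E0))).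
    rewrite /endc in H.
    have -> : (Dinf * Einf)^-1 * (P1 z * P2 z * aS z) = Einf^-1 * P1 z * (Dinf^-1 * P2 z) * aS z.
      by field; rewrite D0 E0.
    by rewrite H; field; rewrite D0 E0.
move=> z zd.
have z0 := dom_neq0 zd; have z2 := dom_sqr_neq1 zd.
apply: (mulfI (mulf_neq0 (P1_neq0 z0 z2) (P2_neq0 z0 z2))).
rewrite [RHS]mulrCA.
have dP : disc_fun (fun z => P1 (toin o z) * P2 (toin o z)).
  by apply: disc_funM; exact: toin_quad.
apply: (@domfun_eq o (fun z => P1 z * P2 z * aS z) (fun z => cT o * (P1 z * P2 z * aQ z)) _ _ circle z zd).
  exact: disc_funM dP dS.1.
exact: disc_funM (disc_fun_cst _) (disc_funM dP dQ.1).
Qed.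

Definition quadphi o m w := if o then quadJ m a2 b2 w else quadJ m a1 b1 w.
Definition quadpsi o m w := if o then quadJ m a1 b1 w else quadJ m a2 b2 w.

(** Polynomials in the Jordan block commute with Toeplitz matrices, so the gauge relations for phi
    and psi combine to the claim multiplied by the jets of psiQ. A component with nonzero value at w
    has an invertible jet, as that value is the diagonal of its triangular Toeplitz matrix. *)
Lemma dependency_relation o psiQ phiQ psiS phiS w m gQ gS :
  jostP o (transferQ q r) psiQ phiQ -> jostP o MS psiS phiS -> dom o w ->
  (exists n, psiQ n w <> 0) ->
  depend phiQ psiQ w m gQ -> depend phiS psiS w m gS ->
  cpsi o *: (toep m (ghat gQ) *m quadphi o m w) = toep m (ghat gS) *m quadpsi o m w.
Proof.
move=> jQ jS wd [n0 psi0] depQ depS.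
have [relphi relpsi] := jost_relation jQ jS.
have [_ _ _ ePsiQ ePhiQ] := jQ; have [_ _ _ ePsiS ePhiS] := jS.
have oD := @dom_open o.
pose lhs := cpsi o *: (toep m (ghat gQ) *m quadphi o m w).
pose rhs := toep m (ghat gS) *m quadpsi o m w.
have quad_ext (x y x1 y1 x2 y2 : C) (f f1 f2 : C -> C) (c : C) :
    holoD (dom o) f -> holoD (dom o) f1 -> holoD (dom o) f2 ->
    (forall z, dom o z -> (x + y * z ^+ 2) * f z =
       c * ((x1 + y1 * z ^+ 2) * f1 z + (x2 + y2 * z ^+ 2) * f2 z)) ->
    quadJ m x y w *m tjet m f w =
    c *: (quadJ m x1 y1 w *m tjet m f1 w + quadJ m x2 y2 w *m tjet m f2 w).
  move=> hf hf1 hf2 E.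
  have h1 := @holoD_quad _ (dom o) x1 y1 f1 hf1; have h2 := @holoD_quad _ (dom o) x2 y2 f2 hf2.
  rewrite -(tjet_quad oD m x y hf wd) -(tjet_quad oD m x1 y1 hf1 wd) -(tjet_quad oD m x2 y2 hf2 wd).
  rewrite -(tjetD oD m h1 h2 wd) -(tjetZ oD m c (holoD_add h1 h2) wd).
  by apply: (tjet_ext oD m _ E wd); exact: holoD_quad.
have quadphiE : quadphi o m w = quadJ m (if o then a2 else a1) (if o then b2 else b1) w.
  by rewrite /quadphi; case: (o).
have quadpsiE : quadpsi o m w = quadJ m (if o then a1 else a2) (if o then b1 else b2) w.
  by rewrite /quadpsi; case: (o).
have key n : lhs *m tjet m (fun z => (psiQ n z).1) w = rhs *m tjet m (fun z => (psiQ n z).1) w /\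
             lhs *m tjet m (fun z => (psiQ n z).2) w = rhs *m tjet m (fun z => (psiQ n z).2) w.
  have [[_ hq1] [_ hq2]] := ePhiQ n; have [[_ hp1] [_ hp2]] := ePsiQ n.
  have [[_ sq1] [_ sq2]] := ePhiS n; have [[_ sp1] [_ sp2]] := ePsiS n.
  have [dQ1 dQ2] := depend_tjet depQ n; have [dS1 dS2] := depend_tjet depS n.
  (* The argument is the same for both rows of the gauge matrix; x1 + y1 z^2 and x2 + y2 z^2 stand
     for the entries of a row. *)
  have comb (x1 y1 x2 y2 : C) (fQ pQ : C -> C) :
      holoD (dom o) fQ -> holoD (dom o) pQ ->
      (forall z, dom o z -> Pphi o z * fQ z =
         (x1 + y1 * z ^+ 2) * (phiS n z).1 + (x2 + y2 * z ^+ 2) * (phiS n z).2) ->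
      (forall z, dom o z -> Ppsi o z * pQ z = cpsi o *
         ((x1 + y1 * z ^+ 2) * (psiS n z).1 + (x2 + y2 * z ^+ 2) * (psiS n z).2)) ->
      tjet m fQ w = toep m (ghat gQ) *m tjet m pQ w ->
      lhs *m tjet m pQ w = rhs *m tjet m pQ w.
    move=> hf hp Ef Ep dep.
    have Ef' z : dom o z -> ((if o then a2 else a1) + (if o then b2 else b1) * z ^+ 2) * fQ z =
        1 * ((x1 + y1 * z ^+ 2) * (phiS n z).1 + (x2 + y2 * z ^+ 2) * (phiS n z).2).
      by move=> zd; rewrite mul1r -Ef // PphiE.
    have Ep' z : dom o z -> ((if o then a1 else a2) + (if o then b1 else b2) * z ^+ 2) * pQ z =
        cpsi o * ((x1 + y1 * z ^+ 2) * (psiS n z).1 + (x2 + y2 * z ^+ 2) * (psiS n z).2).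
      by move=> zd; rewrite -Ep // PpsiE.
    have Jf := quad_ext _ _ _ _ _ _ _ _ _ _ hf sq1 sq2 Ef'.
    have Jp := quad_ext _ _ _ _ _ _ _ _ _ _ hp sp1 sp2 Ep'.
    have S1 a b (p : 'M[C]_m) : quadJ m a b w *m (toep m (ghat gS) *m p) =
        toep m (ghat gS) *m (quadJ m a b w *m p).
      by rewrite mulmxA quadJ_comm_toep -mulmxA.
    have -> : rhs *m tjet m pQ w = toep m (ghat gS) *m (quadpsi o m w *m tjet m pQ w).
      by rewrite mulmxA.
    rewrite quadpsiE Jp.
    have -> : lhs *m tjet m pQ w = cpsi o *: (quadphi o m w *m tjet m fQ w).
      by rewrite /lhs -scalemxAl dep quadphiE mulmxA quadJ_comm_toep.
    rewrite quadphiE Jf dS1 dS2 2!S1 scale1r -mulmxDr.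
    by rewrite scalemxAr.
  split; [apply: (comb _ _ _ _ _ _ hq1 hp1 _ _ dQ1)|apply: (comb _ _ _ _ _ _ hq2 hp2 _ _ dQ2)] => z zd.
  - by have [h _] := relphi z (or_intror zd) n; exact: h.
  - by have [h _] := relpsi z (or_intror zd) n; exact: h.
  - by have [_ h] := relphi z (or_intror zd) n; exact: h.
  - by have [_ h] := relpsi z (or_intror zd) n; exact: h.
have jet0 (f : C -> C) : jet f w 0%N = f w.
  by rewrite /jet /cderivn derive1n0 fact0 divr1.
have [k1 k2] := key n0.
have [p1|p1] := eqVneq (psiQ n0 w).1 0; last first.
  have U : tjet m (fun z => (psiQ n0 z).1) w \in unitmx by rewrite toep_unit ?jet0.
  by rewrite -/lhs -/rhs -[LHS](mulmxK U) k1 mulmxK.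
have [p2|p2] := eqVneq (psiQ n0 w).2 0; last first.
  have U : tjet m (fun z => (psiQ n0 z).2) w \in unitmx by rewrite toep_unit ?jet0.
  by rewrite -/lhs -/rhs -[LHS](mulmxK U) k2 mulmxK.
by case: psi0; rewrite [LHS]surjective_pairing p1 p2.
Qed.

(** The residues contribute 1/cT and the dependency constants cpsi. The factor [quadpsi] is left
    uninverted on the side of (U), to be treated for each gauge. *)
Lemma norming_relation o NV N (zs : 'I_N -> C) (ms : 'I_N -> nat) cQ cS :
  scatt o (fun psi => forall w, dom o w -> exists n, psi n w <> 0) (transferQ q r) zs ms cQ ->
  scatt o NV MS zs ms cS -> (forall j, dom o (zs j)) -> forall j,
  Crow ms cS j *m quadpsi o (ms j) (zs j) =
  (cpsi o / cT o) *: (Crow ms cQ j *m quadphi o (ms j) (zs j)).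
Proof.
move=> [psiQ [phiQ [aQ [tQ [gQ [nvQ [jQ [dQ lQ] poQ depQ cQE]]]]]]].
move=> [psiS [phiS [aS [tS [gS [_ [jS [dS lS] poS depS cSE]]]]]]] zd j.
have [m0 _ _] := poQ j.
pose i0 : 'I_(ms j) := Ordinal m0.
have c0 : cT o != 0 by rewrite /cT; case: (o).
have aE := transmission_relation jQ jS dQ dS lQ lS.
have [d d0 dP] := dom_open (zd j).
have tE := pole_order_scale c0 (ex_intro2 _ _ d d0 (fun z zz => aE z (dP z zz))) (poQ j) (poS j).
have gE := dependency_relation jQ jS (zd j) (nvQ _ (zd j)) (depQ j) (depS j).
rewrite (Crow_toep (i0 := i0) erefl (fun k km => cQE j k km)).
rewrite (Crow_toep (i0 := i0) erefl (fun k km => cSE j k km)).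
have -> : toep (ms j) (fun k => (if o then 2 else -2) * tS j (ms j - k)%N) =
  (cT o)^-1 *: toep (ms j) (fun k => (if o then 2 else -2) * tQ j (ms j - k)%N).
  rewrite toepZ; apply: eq_toep => k km; rewrite tE; last by lia.
  by rewrite mulrA mulrC.
rewrite -!row_mul.
set T := toep _ (ghat (gS j)) in gE *; set G := toep _ (ghat (gQ j)) in gE *; set TQ := toep _ _.
have -> : (cT o)^-1 *: TQ *m T *m quadpsi o (ms j) (zs j) =
    (cpsi o / cT o) *: (TQ *m G *m quadphi o (ms j) (zs j)).
  by rewrite -mulmxA -gE -scalemxAl -scalemxAr scalerA mulmxA mulrC.
by apply/rowP => k; rewrite !mxE.
Qed.

End Gauge.
End Scattering.

(** * The two gauge matrices *)

Section Instances.
Variable R : realType.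
Local Notation C := R[i].
Local Notation nm := (@Normc.normc R).
Variables (q r D E : int -> C) (Dinf Einf : C).
Hypothesis dq : rapid_decay q.
Hypothesis dr : rapid_decay r.
Hypothesis D1 : forall n, 1 - q n * r n != 0.
Hypothesis E1 : forall n, 1 + q n * r (n + 1) != 0.
Hypothesis Dlim : is_Dseq q r D.
Hypothesis Elim : is_Eseq q r E.
Hypothesis Dinflim : lim_pinf D Dinf.
Hypothesis Einflim : lim_pinf E Einf.

Lemma decay_qr (b : bool) : decays (fun n => nm (- (q (idx b n) * r (idx b n)))).
Proof.
apply: (@decays_le _ _ (fun n => nm (q (idx b n)) * nm (r (idx b n)))).
  by move=> n; rewrite nmN nmM.
by apply: decaysM; try (by move=> n; exact: nm_ge0); case: b;
  [exact: decays_pinf|exact: decays_minf|exact: decays_pinf|exact: decays_minf].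
Qed.

Lemma decay_rS (b : bool) : decays (fun n => nm (r (idx b n + 1))).
Proof.
case: b => /=.
  apply: (@decays_le _ _ (fun n => nm (r n.+1%:Z))).
    by move=> n; rewrite (_ : n%:Z + 1 = n.+1%:Z) //; lia.
  by apply: (@decays_shift _ (fun n => nm (r n%:Z))); [move=> n; exact: nm_ge0|exact: decays_pinf].
apply: decays_unshift; apply: (@decays_le _ _ (fun n => nm (r (- n%:Z)))).
  by move=> n; rewrite (_ : - n.+1%:Z + 1 = - n%:Z) //; lia.
exact: decays_minf.
Qed.

Lemma decay_qrS (b : bool) : decays (fun n => nm (q (idx b n) * r (idx b n + 1))).
Proof.
apply: (@decays_le _ _ (fun n => nm (q (idx b n)) * nm (r (idx b n + 1)))).
  by move=> n; rewrite nmM.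
apply: decaysM; try (by move=> n; exact: nm_ge0); last exact: decay_rS.
by case: b; [exact: decays_pinf|exact: decays_minf].
Qed.

Lemma D_rec n : D n = (1 - q n * r n) * D (n - 1).
Proof. exact: (@infprod_rec R (fun n => - (q n * r n)) D Dlim). Qed.

Lemma E_rec n : E n = (1 + q n * r (n + 1)) * E (n - 1).
Proof. exact: (@infprod_rec R (fun n => q n * r (n + 1)) E Elim). Qed.

Lemma D_neq0 n : D n != 0.
Proof. exact: (@infprod_neq0 R (fun n => - (q n * r n)) D D1 (decay_qr false) Dlim). Qed.

Lemma E_neq0 n : E n != 0.
Proof. exact: (@infprod_neq0 R (fun n => q n * r (n + 1)) E E1 (decay_qrS false) Elim). Qed.

Lemma Dinf_neq0 : Dinf != 0.
Proof.
exact: (@infprod_pinf_neq0 R (fun n => - (q n * r n)) D Dinf D1 (decay_qr true) (decay_qr false) Dlim Dinflim).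
Qed.

Lemma Einf_neq0 : Einf != 0.
Proof.
exact: (@infprod_pinf_neq0 R (fun n => q n * r (n + 1)) E Einf E1 (decay_qrS true) (decay_qrS false) Elim Einflim).
Qed.

Lemma lim_shift (P : int -> C) (Pinf : C) : lim_pinf P Pinf -> lim_minf P 1 ->
  forall b, seq_lim (fun k => P (idx b k - 1)) (if b then Pinf else 1).
Proof.
move=> /seq_limP lp /seq_limP lm; case; apply/seq_limP => e e0.
  have [N NP] := lp e e0; exists N.+1 => -[//|n] Nn.
  by have := NP n Nn; rewrite /= (_ : n.+1%:Z - 1 = n%:Z) //; lia.
have [N NP] := lm e e0; exists N => n Nn.
have := NP n.+1 (leqW Nn); rewrite /= (_ : - n%:Z - 1 = - n.+1%:Z) //; lia.
Qed.

Lemma limD b : seq_lim (fun k => (D (idx b k))^-1) (endc b Dinf).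
Proof.
case: b => /=; first exact: seq_limV Dinf_neq0 Dinflim.
rewrite -invr1; apply: (seq_limV (oner_neq0 _)).
exact: (@infprod_minf R (fun n => - (q n * r n)) D (decay_qr false) Dlim).
Qed.

Lemma limD1 b : seq_lim (fun k => (D (idx b k - 1))^-1) (endc b Dinf).
Proof.
have H := @lim_shift D Dinf Dinflim (@infprod_minf R (fun n => - (q n * r n)) D (decay_qr false) Dlim) b.
case: b H => /= H; first exact: seq_limV Dinf_neq0 H.
by rewrite -invr1; apply: (seq_limV (oner_neq0 _)).
Qed.

Lemma limE1 b : seq_lim (fun k => (E (idx b k - 1))^-1) (endc b Einf).
Proof.
have H := @lim_shift E Einf Einflim (@infprod_minf R (fun n => q n * r (n + 1)) E (decay_qrS false) Elim) b.
case: b H => /= H; first exact: seq_limV Einf_neq0 H.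
by rewrite -invr1; apply: (seq_limV (oner_neq0 _)).
Qed.

Lemma limq b : seq_lim (fun k => q (idx b k)) 0.
Proof. by apply: decays_lim0; case: b; [exact: decays_pinf|exact: decays_minf]. Qed.

Lemma limr b : seq_lim (fun k => r (idx b k)) 0.
Proof. by apply: decays_lim0; case: b; [exact: decays_pinf|exact: decays_minf]. Qed.

(** Independent of z, with determinant 1/(E_(n-1) D_n): the products answer to 1 - p_n s_n = 1/((1 +
    q_n r_(n+1)) (1 - q_(n+1) r_(n+1))). The last entry equals 1/D_(n-1), written so that all
    entries involve D_n. *)
Definition gPS n : mat2 R := (((E (n - 1))^-1, - q n / D n), (r n / E (n - 1), (1 - q n * r n) / D n)).
Definition z2 : mat2 R := ((0, 0), (0, 0)).

(** With [gUV2] this gives a lower triangular gauge with diagonal (z^2 - 1)/E_(n-1), z^2/D_(n-1).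
    The quotient (z^2 - 1)/z^2 of the diagonal factors is the origin of I - A^-2. *)
Definition gUV0 n : mat2 R := ((- (E (n - 1))^-1, 0), (0, 0)).
Definition gUV2 n : mat2 R := (((E (n - 1))^-1, 0), (r n / E (n - 1), (D (n - 1))^-1)).

Lemma intertwinePS n z v : z != 0 ->
  mulv (gauge gPS (fun=> z2) n z) (mulv (transferU (pseq q r D E) (sseq q r D E) n z) v) =
  mulv (transferQ q r n z) (mulv (gauge gPS (fun=> z2) (n + 1) z) v).
Proof.
move=> z0; rewrite /gauge /mulv /transferU /transferQ /pseq /sseq /gPS /=.
rewrite (D_rec (n + 1)) addrK (E_rec n).
have d0 := D_neq0 n; have e0 := E_neq0 (n - 1); have dn := D1 (n + 1); have en := E1 n.
(* After the recursions for D and E the values are treated as independent variables, and a rational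
   identity remains. *)
move: (D n) (E (n - 1)) (q n) (r n) (q (n + 1)) (r (n + 1)) v.1 v.2 d0 e0 dn en.
move=> d e a b a' b' v1 v2 d0 e0 dn en.
by apply/eqP; rewrite xpair_eqE /=; apply/andP; split; apply/eqP; field; rewrite ?d0 ?e0 ?dn ?en ?z0.
Qed.

Lemma intertwineUV n z v : z != 0 ->
  mulv (gauge gUV0 gUV2 n z) (mulv (transferU (useq q r D E) (vseq q r D E) n z) v) =
  mulv (transferQ q r n z) (mulv (gauge gUV0 gUV2 (n + 1) z) v).
Proof.
move=> z0; rewrite /gauge /mulv /transferU /transferQ /useq /vseq /gUV0 /gUV2 /=.
rewrite addrK (D_rec n) (E_rec n).
have d0 := D_neq0 (n - 1); have e0 := E_neq0 (n - 1); have dn := D1 n; have en := E1 n.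
move: (D (n - 1)) (E (n - 1)) (q n) (r n) (r (n + 1)) v.1 v.2 d0 e0 dn en.
move=> d e a b b' v1 v2 d0 e0 dn en.
by apply/eqP; rewrite xpair_eqE /=; apply/andP; split; apply/eqP; field; rewrite ?d0 ?e0 ?dn ?en ?z0.
Qed.

Lemma norming_relationPS o NV N (zs : 'I_N -> C) (ms : 'I_N -> nat) cQ cS :
  scatt o (fun psi => forall w, dom o w -> exists n, psi n w <> 0) (transferQ q r) zs ms cQ ->
  scatt o NV (transferU (pseq q r D E) (sseq q r D E)) zs ms cS -> (forall j, dom o (zs j)) ->
  forall j, Crow ms cS j *m quadpsi 1 0 1 0 o (ms j) (zs j) =
  (cpsi Dinf Einf o / cT Dinf Einf o) *: (Crow ms cQ j *m quadphi 1 0 1 0 o (ms j) (zs j)).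
Proof.
have qr0 b := seq_limM (@limq b) (@limr b).
apply: (@norming_relation R q r dq dr _ gPS (fun=> z2) 1 0 1 0 Dinf Einf Dinf_neq0 Einf_neq0).
- by move=> b; rewrite mulr1; exact: limE1.
- by move=> b; rewrite mulr0; exact: seq_lim_cst.
- move=> b; have H := seq_limM (seq_limD (seq_lim_cst 1) (seq_limM (seq_lim_cst (-1)) (qr0 b))) (@limD b).
  have EQ : (1 + -1 * (0 * 0)) * endc b Dinf = endc b Dinf * 1 :> C by ring.
  rewrite EQ in H; move: H; apply: (@seq_lim_ext _ _ _ _ 0%N) => k _.
  by rewrite /= mulN1r.
- by move=> b; rewrite mulr0; exact: seq_lim_cst.
- move=> b; have H := seq_limM (seq_limM (seq_lim_cst (-1)) (@limq b)) (@limD b).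
  have EQ : -1 * 0 * endc b Dinf = 0 :> C by ring.
  rewrite EQ in H; move: H; apply: (@seq_lim_ext _ _ _ _ 0%N) => k _.
  by rewrite /= mulN1r.
- by move=> b; exact: seq_lim_cst.
- move=> b; have H := seq_limM (@limr b) (@limE1 b).
  by rewrite mul0r in H.
- by move=> b; exact: seq_lim_cst.
- exact: intertwinePS.
- by move=> z _ _; rewrite /P1 mul0r addr0 oner_neq0.
- by move=> z _ _; rewrite /P2 mul0r addr0 oner_neq0.
Qed.

Lemma norming_relationUV o NV N (zs : 'I_N -> C) (ms : 'I_N -> nat) cQ cS :
  scatt o (fun psi => forall w, dom o w -> exists n, psi n w <> 0) (transferQ q r) zs ms cQ ->
  scatt o NV (transferU (useq q r D E) (vseq q r D E)) zs ms cS -> (forall j, dom o (zs j)) ->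
  forall j, Crow ms cS j *m quadpsi (-1) 1 0 1 o (ms j) (zs j) =
  (cpsi Dinf Einf o / cT Dinf Einf o) *: (Crow ms cQ j *m quadphi (-1) 1 0 1 o (ms j) (zs j)).
Proof.
apply: (@norming_relation R q r dq dr _ gUV0 gUV2 (-1) 1 0 1 Dinf Einf Dinf_neq0 Einf_neq0).
- move=> b; have H := seq_limM (seq_lim_cst (-1)) (@limE1 b); rewrite mulrC in H.
  by move: H; apply: (@seq_lim_ext _ _ _ _ 0%N) => k _; rewrite /= mulN1r.
- by move=> b; rewrite mulr1; exact: limE1.
- by move=> b; rewrite mulr0; exact: seq_lim_cst.
- by move=> b; rewrite mulr1; exact: limD1.
- by move=> b; exact: seq_lim_cst.
- by move=> b; exact: seq_lim_cst.
- by move=> b; exact: seq_lim_cst.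
- move=> b; have H := seq_limM (@limr b) (@limE1 b).
  by rewrite mul0r in H.
- exact: intertwineUV.
- by move=> z _ zz; rewrite /P1 mul1r addrC subr_eq0.
- by move=> z z0 _; rewrite /P2 mul1r add0r expf_neq0.
Qed.

End Instances.

(** * Block diagonal matrices and polynomials in a Jordan block *)

Section BlockMatrices.
Variable F : fieldType.

Lemma mul_mxdiag N (ms : 'I_N -> nat) (X Y : forall j, 'M[F]_(ms j)) :
  \mxdiag_j X j *m \mxdiag_j Y j = \mxdiag_j (X j *m Y j).
Proof.
rewrite {2}/mxdiag mul_mxdiag_mxblock; apply/eq_mxblock => i j.
by case: eqVneq => [->|_]; rewrite ?conform_mx_id ?mulmx0.
Qed.

Lemma invmx_eq m (X Y : 'M[F]_m) : X *m Y = 1%:M -> invmx X = Y.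
Proof.
move=> XY; have [uX _] := mulmx1_unit XY.
by rewrite -[LHS]mulmx1 -XY mulKmx.
Qed.

Lemma invmx_mxdiag N (ms : 'I_N -> nat) (X : forall j, 'M[F]_(ms j)) :
  (forall j, X j \in unitmx) -> invmx (\mxdiag_j X j) = \mxdiag_j invmx (X j).
Proof.
move=> uX; apply: invmx_eq; rewrite mul_mxdiag -mxdiagZ.
by apply/eq_mxdiag => j; rewrite mulmxV.
Qed.

Lemma scale_mxrow N (ms : 'I_N -> nat) m (c : F) (X : forall j, 'M[F]_(m, ms j)) :
  c *: (\mxrow_j X j) = \mxrow_j (c *: X j).
Proof. by apply/matrixP => i k; rewrite !mxE. Qed.

End BlockMatrices.

Section JordanAlgebra.
Variable R : realType.
Local Notation C := R[i].

Lemma jordan_sqr_unit (w : C) m : w != 0 -> jordan w m *m jordan w m \in unitmx.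
Proof.
by move=> w0; rewrite jordanE toepM toep_unit // /convol big_ord_recl big_ord0 addr0 mulf_neq0.
Qed.

Lemma quadJ10 m (w : C) : quadJ m 1 0 w = 1%:M.
Proof. by rewrite /quadJ scale0r addr0. Qed.

Lemma quadJ01 m (w : C) : quadJ m 0 1 w = jordan w m *m jordan w m.
Proof. by rewrite /quadJ scale1r raddf0 add0r. Qed.

(** J^2 - I is factored as (I - J^-2) J^2 so that J^2, which also stands on the other side of the
    norming relation, can be cancelled on the right. *)
Lemma quadJN1 m (w : C) : w != 0 ->
  quadJ m (-1) 1 w = IminusAinv2 (jordan w m) *m (jordan w m *m jordan w m).
Proof.
move=> w0; rewrite /quadJ /IminusAinv2 scale1r mulmxBl mul1mx mulVmx ?jordan_sqr_unit //.
by rewrite raddfN /= addrC.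
Qed.

Lemma quadJN1_unit m (w : C) : w ^+ 2 != 1 -> quadJ m (-1) 1 w \in unitmx.
Proof.
move=> w1; rewrite /quadJ scale1r jordanE toepM.
have -> : (-1)%:M = toep m (fun k => if k == 0%N then -1 else 0 : C).
  apply/matrixP => i k; rewrite !mxE -val_eqE /=; case: (ltngtP i k) => ik.
  - have -> : (k - i == 0)%N = false by apply/eqP; lia.
    by rewrite mulr0n.
  - by rewrite mulr0n.
  - by rewrite ik subnn eqxx mulr1n.
rewrite toepD toep_unit // /convol big_ord_recl big_ord0 addr0 /= -expr2 addrC subr_eq0.
by [].
Qed.

Lemma IminusAinv2_unit m (w : C) : w != 0 -> w ^+ 2 != 1 -> IminusAinv2 (jordan w m) \in unitmx.
Proof.
move=> w0 w1; have := quadJN1_unit m w1.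
by rewrite quadJN1 // unitmx_mul => /andP[].
Qed.

Lemma IminusAinv2_Afull N (zs : 'I_N -> C) (ms : 'I_N -> nat) : (forall j, zs j != 0) ->
  IminusAinv2 (Afull zs ms) = \mxdiag_(j < N) IminusAinv2 (jordan (zs j) (ms j)).
Proof.
move=> z0; rewrite /IminusAinv2 /Afull mul_mxdiag invmx_mxdiag; last first.
  by move=> j; exact: jordan_sqr_unit.
by rewrite mxdiagB mxdiagZ.
Qed.

End JordanAlgebra.

Unset Implicit Arguments.
Set Strict Implicit.
Set Printing Implicit Defensive.

Theorem theorem4p6 (R : realType) (q r : int -> R[i])
    (D E : int -> R[i]) (Dinf Einf : R[i])
    (N Nb : nat) (zs : 'I_N -> R[i]) (ms : 'I_N -> nat)
    (zbs : 'I_Nb -> R[i]) (mbs : 'I_Nb -> nat)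
    (cQ cUV cPS : 'I_N -> nat -> R[i]) (cbQ cbUV cbPS : 'I_Nb -> nat -> R[i]) :
  rapid_decay q -> rapid_decay r ->
  (forall n, 1 - q n * r n != 0) ->
  (forall n, 1 + q n * r (n + 1) != 0) ->
  is_Dseq q r D -> is_Eseq q r E ->
  lim_pinf D Dinf -> lim_pinf E Einf ->
  (forall j, 0 < `|zs j| < 1) -> injective zs -> (forall j k, zs j != - zs k) ->
  (forall j, 1 < `|zbs j|) -> injective zbs -> (forall j k, zbs j != - zbs k) ->
  norming_in (transferQ q r) zs ms cQ ->
  norming_in (transferU (useq q r D E) (vseq q r D E)) zs ms cUV ->
  norming_in (transferU (pseq q r D E) (sseq q r D E)) zs ms cPS ->
  norming_out (transferQ q r) zbs mbs cbQ ->
  norming_out (transferU (useq q r D E) (vseq q r D E)) zbs mbs cbUV ->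
  norming_out (transferU (pseq q r D E) (sseq q r D E)) zbs mbs cbPS ->
  (* C_j^{(u,v)} = C_j^{(p,s)} (I - A_j^{-2}),  Cbar_j'^{(p,s)} = Cbar_j'^{(u,v)} (I - Abar_j'^{-2}) *)
  ((forall j, Crow ms cUV j = Crow ms cPS j *m IminusAinv2 (jordan (zs j) (ms j))) /\
   (forall j', Crow mbs cbPS j' = Crow mbs cbUV j' *m IminusAinv2 (jordan (zbs j') (mbs j')))) /\
  (* C^{(u,v)} = C^{(p,s)} (I - A^{-2}),  Cbar^{(p,s)} = Cbar^{(u,v)} (I - Abar^{-2}) *)
  (Cfull ms cUV = Cfull ms cPS *m IminusAinv2 (Afull zs ms) /\
   Cfull mbs cbPS = Cfull mbs cbUV *m IminusAinv2 (Afull zbs mbs)) /\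
  (* C_j^{(q,r)} = (E/D) C_j^{(p,s)},  Cbar_j'^{(q,r)} = (D/E) Cbar_j'^{(p,s)} *)
  ((forall j, Crow ms cQ j = (Einf / Dinf) *: Crow ms cPS j) /\
   (forall j', Crow mbs cbQ j' = (Dinf / Einf) *: Crow mbs cbPS j')) /\
  (* C^{(p,s)} = (D/E) C^{(q,r)},  Cbar^{(p,s)} = (E/D) Cbar^{(q,r)} *)
  (Cfull ms cPS = (Dinf / Einf) *: Cfull ms cQ /\
   Cfull mbs cbPS = (Einf / Dinf) *: Cfull mbs cbQ) /\
  (* C^{(u,v)} = (D/E) C^{(q,r)} (I - A^{-2}),
     Cbar^{(u,v)} = (E/D) Cbar^{(q,r)} (I - Abar^{-2})^{-1} *)
  (Cfull ms cUV = ((Dinf / Einf) *: Cfull ms cQ) *m IminusAinv2 (Afull zs ms) /\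
   Cfull mbs cbUV =
     ((Einf / Dinf) *: Cfull mbs cbQ) *m invmx (IminusAinv2 (Afull zbs mbs))).
Proof.
move=> dq dr D1 E1 Dlim Elim Dl El z01 _ _ w1 _ _ nQ nUV nPS oQ oUV oPS.
have D0 := Dinf_neq0 dq dr D1 Dlim Dl.
have E0 := Einf_neq0 dq dr E1 Elim El.
have zd j : dom false (zs j) := normc_lt_disc (z01 j).
have wd j : dom true (zbs j).
  by have := w1 j; rewrite normE -[1]/(1%:C) ltcR.
have zs0 j := dom_neq0 (zd j); have zbs0 j := dom_neq0 (wd j).
have zbs1 j := dom_sqr_neq1 (wd j).
have sQ : scatt false (fun psi => forall w, dom false w -> exists n, psi n w <> 0)
    (transferQ q r) zs ms cQ.
  by apply: norming_in_scatt nQ => psi jp w /normc_dom_in; exact: (psi_nonzero dq dr jp).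
have tQ : scatt true (fun psi => forall w, dom true w -> exists n, psi n w <> 0)
    (transferQ q r) zbs mbs cbQ.
  by apply: norming_out_scatt oQ => psi jp w /normc_dom_out; exact: (psib_nonzero dq dr jp).
have sUV := norming_in_scatt (NV := fun=> True) (fun _ _ => I) nUV.
have sPS := norming_in_scatt (NV := fun=> True) (fun _ _ => I) nPS.
have tUV := norming_out_scatt (NV := fun=> True) (fun _ _ => I) oUV.
have tPS := norming_out_scatt (NV := fun=> True) (fun _ _ => I) oPS.
have rPS j : Crow ms cPS j = (Dinf / Einf) *: Crow ms cQ j.
  have := norming_relationPS dq dr D1 E1 Dlim Elim Dl El sQ sPS zd j.
  by rewrite /quadpsi /quadphi /= quadJ10 !mulmx1.
have rbPS j : Crow mbs cbPS j = (Einf / Dinf) *: Crow mbs cbQ j.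
  have := norming_relationPS dq dr D1 E1 Dlim Elim Dl El tQ tPS wd j.
  by rewrite /quadpsi /quadphi /= quadJ10 !mulmx1.
have rUV j : Crow ms cUV j = Crow ms cPS j *m IminusAinv2 (jordan (zs j) (ms j)).
  have := norming_relationUV dq dr D1 E1 Dlim Elim Dl El sQ sUV zd j.
  rewrite /quadpsi /quadphi /= quadJ01 quadJN1 // (mulmxA (Crow ms cQ j)) !scalemxAl -rPS.
  (* Both sides end in J^2: on the left from the limit z^2 of the second diagonal entry of the
     gauge, on the right from the factorisation of J^2 - I. *)
  by move=> /(can_inj (mulmxK (jordan_sqr_unit _ (zs0 j)))).
(* In the exterior problem phi and psi exchange the diagonal factors z^2 - 1 and z^2, so I - A^-2
   falls on the side of (u,v). *)
have rbUV j : Crow mbs cbPS j = Crow mbs cbUV j *m IminusAinv2 (jordan (zbs j) (mbs j)).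
  have := norming_relationUV dq dr D1 E1 Dlim Elim Dl El tQ tUV wd j.
  rewrite /quadpsi /quadphi /= quadJ01 quadJN1 // (mulmxA (Crow mbs cbUV j)) scalemxAl -rbPS.
  by move=> /(can_inj (mulmxK (jordan_sqr_unit _ (zbs0 j)))) ->.
have fUV : Cfull ms cUV = Cfull ms cPS *m IminusAinv2 (Afull zs ms).
  by rewrite IminusAinv2_Afull // mul_mxrow_mxdiag; apply/eq_mxrow => j; exact: rUV.
have fbUV : Cfull mbs cbPS = Cfull mbs cbUV *m IminusAinv2 (Afull zbs mbs).
  by rewrite IminusAinv2_Afull // mul_mxrow_mxdiag; apply/eq_mxrow => j; exact: rbUV.
have fPS : Cfull ms cPS = (Dinf / Einf) *: Cfull ms cQ.
  by rewrite scale_mxrow; apply/eq_mxrow => j; exact: rPS.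
have fbPS : Cfull mbs cbPS = (Einf / Dinf) *: Cfull mbs cbQ.
  by rewrite scale_mxrow; apply/eq_mxrow => j; exact: rbPS.
have uA : IminusAinv2 (Afull zbs mbs) \in unitmx.
  have [|//] := @mulmx1_unit _ _ (IminusAinv2 (Afull zbs mbs))
    (\mxdiag_j invmx (IminusAinv2 (jordan (zbs j) (mbs j)))).
  rewrite IminusAinv2_Afull // mul_mxdiag -mxdiagZ; apply/eq_mxdiag => j.
  by rewrite mulmxV // IminusAinv2_unit.
have DE : Einf / Dinf * (Dinf / Einf) = 1 by field; rewrite D0 E0.
have ED : Dinf / Einf * (Einf / Dinf) = 1 by field; rewrite D0 E0.
do !split => //.
- by move=> j; rewrite rPS scalerA DE scale1r.
- by move=> j; rewrite rbPS scalerA ED scale1r.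
- by rewrite -fPS.
- by rewrite -fbPS fbUV mulmxK.
Qed.
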